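(* Let $A,S\in\mathcal M_3^s(\mathbb R)$ with $S=C^HA$. Consider the Lagrangian $\mathcal L:\mathbb L^2_{\#s}\times\mathbb L^2_{\#s}\to\mathbb R\cup\{+\infty\}$ defined by $$\mathcal L(\sigma,e)=\int_Y\langle e,\sigma\rangle\,dy-g^\star(e)+\mathcal I_S(\Lambda\sigma)\qquad\forall(\sigma,e)\in\mathbb L^2_{\#s}\times\mathbb L^2_{\#s}.$$ Then $$\inf_{\sigma\in\mathbb L^2_{\#s}}G(\sigma)=\inf_{\sigma\in\mathbb L^2_{\#s}}\ \sup_{e\in\mathbb L^2_{\#s}}\mathcal L(\sigma,e)=\mathcal L(\sigma_S,\nabla_s u_A)=\sup_{e\in\mathbb L^2_{\#s}}\ \inf_{\sigma\in\mathbb L^2_{\#s}}\mathcal L(\sigma,e),$$ where $\sigma_S$ is the solution of both minimization problems $\inf_{\sigma\in\mathbb T(S)}g(\sigma)$ and $\inf_{\sigma\in\mathbb L^2_{\#s}}G(\sigma)$, and $\nabla_s u_A$ is the solution of the minimization problem $\inf_{e\in\mathbb T(0)^\perp}k(e)$ with $k(e)=\frac12\int_Y\langle Ce,e\rangle\,dy-\langle S,\int_Y e\,dy\rangle$.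
   Context: Let $\mathcal G\subset\mathbb R^3$ be the lattice (additive group) generated by three linearly independent vectors $g_1,g_2,g_3$, and let $Y=\{s_1g_1+s_2g_2+s_3g_3: s_1,s_2,s_3\in[0,1]\}$. A function on $\mathbb R^3$ is $\mathcal G$-periodic if it is invariant under translations by vectors of $\mathcal G$. $\mathcal M_3^s(\mathbb R)$ is the space of real symmetric $3\times3$ matrices, $\langle\cdot,\cdot\rangle$ between matrices is the Frobenius inner product (also used for the duality pairing), $\nabla_s v$ is the symmetric part of the gradient of $v$, and $(\operatorname{div}\mu)_i=\sum_j\partial_j\mu_{ij}$ in the sense of distributions on $\mathbb R^3$. $H^1_\#$ is the space of $\mathcal G$-periodic vector fields in $H^1_{\rm loc}(\mathbb R^3,\mathbb R^3)$, with the $H^1(Y)$ norm; $H^1_{\#0}=\{v\in H^1_\#\mid\int_Y v\,dy=0\}$. For $A\in\mathcal M_3^s(\mathbb R)$, $LP(A)=\{u \mid u(y)=Ay+\varphi(y),\ \varphi\in H^1_\#\}$; $LP=\bigcup_{A\in\mathcal M_3^s(\mathbb R)}LP(A)$, a Hilbert space with dual $(LP)^\star$; $LP_0=\{v\in LP\mid\int_Y v\,dy=0\}$. $\mathbb L^2_{\#s}$ is the space of $\mathcal G$-periodic symmetric $3\times 3$ matrix fields in $L^2_{\rm loc}(\mathbb R^3)$, with the $L^2(Y)$ norm. $\mathbb T(S)=\{\mu\in\mathbb L^2_{\#s}\mid\operatorname{div}\mu=0,\ \frac1{|Y|}\int_Y\mu\,dy=S\}$ and $\mathbb T(0)^\perp=\{e\in\mathbb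 L^2_{\#s}\mid\int_Y\langle e,\mu\rangle\,dy=0\ \forall\mu\in\mathbb T(0)\}$. The rigidity tensor $C$ is a $\mathcal G$-periodic, measurable, essentially bounded field of fourth-order tensors on $\mathbb R^3$, with the usual symmetries of elasticity (for a.e. $y$, $C(y)$ is a self-adjoint linear map of $\mathcal M_3^s(\mathbb R)$ into itself), and uniformly positive definite: there is $\alpha>0$ with $\langle C(y)\xi,\xi\rangle\ge\alpha|\xi|^2$ for all $\xi\in\mathcal M_3^s(\mathbb R)$ and a.e. $y$. The compliance tensor is $D(y)=C(y)^{-1}$ (inverse on $\mathcal M_3^s(\mathbb R)$). $u_A\in LP_0\cap LP(A)$ is the unique solution of $\int_Y\langle C\,\nabla_s u_A,\nabla_s v\rangle\,dy=0$ for all $v\in H^1_{\#0}$. The homogenized tensor $C^H$ is the (invertible) linear map on $\mathcal M_3^s(\mathbb R)$ given by $C^HA=\frac1{|Y|}\int_Y C\,\nabla_s u_A\,dy$. $\Lambda:\mathbb L^2_{\#s}\to(LP)^\star$ is $\langle\Lambda\sigma,v\rangle=\int_Y\langle\sigma,\nabla_s v\rangle\,dy$; $\eta_S=\Lambda S$, i.e. $\eta_S(v)=\int_Y\langle S,\nabla_s v\rangle\,dy$; $\mathcal I_S(\eta)=0$ if $\eta=\eta_S$ and $+\infty$ otherwise, for $\eta\in(LP)^\star$. For $\sigma,e\in\mathbb L^2_{\#s}$: $g(\sigma)=\frac12\int_Y\langle D\sigma,\sigma\rangle\,dy$, its Legendre–Fenchel transform is $g^\star(e)=\sup_{\sigma\in\mathbb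 L^2_{\#s}}\{\int_Y\langle e,\sigma\rangle\,dy-g(\sigma)\}=\frac12\int_Y\langle Ce,e\rangle\,dy$, and $G(\sigma)=g(\sigma)+\mathcal I_S(\Lambda\sigma)$. *)

(* Defs.v *)
From HB Require Import structures.
From mathcomp Require Import all_boot all_order all_algebra.
From mathcomp Require Import all_classical all_reals all_analysis.
(* Importing the whole of all_analysis leaves the measurable structure of
   \bar R unavailable to unification; requiring the two files below again
   restores it. *)
From mathcomp Require Import measurable_realfun lebesgue_measure.
Set Implicit Arguments.
Unset Strict Implicit.
Unset Printing Implicit Defensive.
Import Order.TTheory GRing.Theory Num.Theory.
Import numFieldNormedType.Exports.
Local Open Scope classical_set_scope.
Local Open Scope ring_scope.

(* R^3 is a product type because that is where the library has both the
   product measure and the normed module structure. *)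
Notation E3 R :=
  (measurableTypeR R * measurableTypeR R * measurableTypeR R)%type.

Definition leb2 (R : realType) :
    set (measurableTypeR R * measurableTypeR R) -> \bar R :=
  (@lebesgue_measure R \x @lebesgue_measure R)%E.
HB.instance Definition _ (R : realType) := Measure.on (@leb2 R).

Definition leb3 (R : realType) : set (E3 R) -> \bar R :=
  (@leb2 R \x @lebesgue_measure R)%E.
HB.instance Definition _ (R : realType) := Measure.on (@leb3 R).

Definition crd (R : realType) (y : E3 R) : 'cV[R]_3 :=
  \col_(i < 3) [:: y.1.1; y.1.2; y.2]`_i.

Definition evec (R : realType) (j : 'I_3) : E3 R :=
  ((j == 0%N :> nat)%:R, (j == 1%N :> nat)%:R, (j == 2%N :> nat)%:R).

Definition Msym (R : realType) : set 'M[R]_3 := [set A | A^T = A].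

Definition frob (R : realType) (A B : 'M[R]_3) : R :=
  \sum_(i < 3) \sum_(j < 3) A i j * B i j.

Definition mint (R : realType) (m n : nat) (D : set (E3 R))
    (F : E3 R -> 'M[R]_(m, n)) : 'M[R]_(m, n) :=
  \matrix_(i, j) \int[@leb3 R]_(y in D) F y i j.

Definition lin_indep3 (R : realType) (a : 'I_3 -> E3 R) : Prop :=
  forall s : 'I_3 -> R, \sum_(i < 3) s i *: a i = 0 -> forall i, s i = 0.

Definition lattice3 (R : realType) (a : 'I_3 -> E3 R) : set (E3 R) :=
  [set t | exists n : 'I_3 -> int, t = \sum_(i < 3) a i *~ n i].

Definition cell (R : realType) (a : 'I_3 -> E3 R) : set (E3 R) :=
  [set y | exists2 s : 'I_3 -> R,
     (forall i, 0 <= s i <= 1) & y = \sum_(i < 3) s i *: a i].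

(* Fields stand for their classes modulo a.e. equality, hence the a.e.
   quantifiers here and below. *)
Definition periodic (R : realType) (T : Type) (a : 'I_3 -> E3 R)
    (f : E3 R -> T) : Prop :=
  forall t, lattice3 a t -> {ae @leb3 R, forall y, f (y + t) = f y}.

Definition L2loc (R : realType) (f : E3 R -> R) : Prop :=
  measurable_fun [set: E3 R] f /\
  forall K : set (E3 R), compact K ->
    (@leb3 R).-integrable K (fun y => ((f y) ^+ 2)%:E).

Definition partial (R : realType) (j : 'I_3) (f : E3 R -> R) : E3 R -> R :=
  fun y => 'D_(evec R j) f y.

(* s lists the directions of an iterated partial derivative of any order *)
Definition smooth (R : realType) (f : E3 R -> R) : Prop :=
  forall s : seq 'I_3,
    continuous (foldr (@partial R) f s) /\
    forall (j : 'I_3) (y : E3 R), derivable (foldr (@partial R) f s) y (evec R j).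

Definition test_fun (R : realType) : set (E3 R -> R) :=
  [set p : E3 R -> R | smooth p /\ compact (closure [set y | p y != 0])].

(* V y i j is the weak derivative of the i-th component of v in direction j *)
Definition is_weak_grad (R : realType) (v : E3 R -> 'cV[R]_3)
    (V : E3 R -> 'M[R]_3) : Prop :=
  forall i j, L2loc (fun y => V y i j) /\
    forall p, test_fun p ->
      (\int[@leb3 R]_y (v y i 0 * partial j p y))
      = - (\int[@leb3 R]_y (V y i j * p y)).

Definition H1loc (R : realType) : set (E3 R -> 'cV[R]_3) :=
  [set v : E3 R -> 'cV[R]_3 |
    (forall i, L2loc (fun y => v y i 0)) /\ exists V, is_weak_grad v V].

(* a representative of the weak gradient, which is unique a.e. *)
Definition grad (R : realType) (v : E3 R -> 'cV[R]_3) : E3 R -> 'M[R]_3 :=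
  xget (fun=> 0) [set V | is_weak_grad v V].

Definition sgrad (R : realType) (v : E3 R -> 'cV[R]_3) : E3 R -> 'M[R]_3 :=
  fun y => 2^-1 *: (grad v y + (grad v y)^T).

Definition div_free (R : realType) (mu : E3 R -> 'M[R]_3) : Prop :=
  forall p, test_fun p -> forall i,
    - (\int[@leb3 R]_y \sum_(j < 3) mu y i j * partial j p y) = 0.

(* A fourth-order tensor, given by its components C i j k l. *)
Definition tensor4 (R : realType) := 'I_3 -> 'I_3 -> 'I_3 -> 'I_3 -> R.

Definition tapp (R : realType) (C : tensor4 R) (xi : 'M[R]_3) : 'M[R]_3 :=
  \matrix_(i, j) \sum_(k < 3) \sum_(l < 3) C i j k l * xi k l.

(* the inverse of C on symmetric matrices *)
Definition tinv (R : realType) (C : tensor4 R) (s : 'M[R]_3) : 'M[R]_3 :=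
  xget 0 [set xi | Msym xi /\ tapp C xi = s].

Record rigidity (R : realType) (a : 'I_3 -> E3 R) (C : E3 R -> tensor4 R)
    : Prop := Rigidity {
  rig_periodic : periodic a C;
  rig_measurable :
    forall i j k l, measurable_fun [set: E3 R] (fun y => C y i j k l);
  rig_bounded : exists M : R,
    {ae @leb3 R, forall y, forall i j k l, `|C y i j k l| <= M};
  rig_sym : {ae @leb3 R, forall y, forall xi, Msym xi -> Msym (tapp (C y) xi)};
  rig_selfadjoint : {ae @leb3 R, forall y, forall xi zeta,
    Msym xi -> Msym zeta -> frob (tapp (C y) xi) zeta = frob xi (tapp (C y) zeta)};
  rig_coercive : exists2 alpha : R, 0 < alpha &
    {ae @leb3 R, forall y, forall xi,
      Msym xi -> alpha * frob xi xi <= frob (tapp (C y) xi) xi}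
}.

Section Cell.
Variables (R : realType) (a : 'I_3 -> E3 R).
Local Notation Y := (cell a).
Local Notation vfield := (E3 R -> 'cV[R]_3).
Local Notation mfield := (E3 R -> 'M[R]_3).

Definition volY : R := fine (@leb3 R Y).

Definition ipY (s e : mfield) : R := \int[@leb3 R]_(y in Y) frob (s y) (e y).

Definition L2s : set mfield :=
  [set s : mfield | [/\ forall i j, L2loc (fun y => s y i j), periodic a s
             & {ae @leb3 R, forall y, Msym (s y)}]].

Definition H1per : set vfield := [set v : vfield | H1loc v /\ periodic a v].

Definition H1per0 : set vfield := [set v : vfield | H1per v /\ mint Y v = 0].

Definition LPA (A : 'M[R]_3) : set vfield :=
  [set u : vfield | exists2 phi, H1per phi & u = fun y => A *m crd y + phi y].

Definition LP : set vfield := [set u : vfield | exists2 A, Msym A & LPA A u].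

Definition LP0 : set vfield := [set v : vfield | LP v /\ mint Y v = 0].

Definition TS (S : 'M[R]_3) : set mfield :=
  [set mu : mfield | [/\ L2s mu, div_free mu & volY^-1 *: mint Y mu = S]].

Definition T0perp : set mfield :=
  [set e : mfield | L2s e /\ forall mu, TS 0 mu -> ipY e mu = 0].

(* Elements of the dual of LP are compared as functions on LP. *)
Definition LPfunctional : Type := {v : vfield | LP v} -> R.

Definition Lam (s : mfield) : LPfunctional := fun v => ipY s (sgrad (sval v)).

Definition eta (S : 'M[R]_3) : LPfunctional := Lam (fun=> S).

Definition indS (S : 'M[R]_3) (h : LPfunctional) : \bar R :=
  if pselect (h = eta S) then 0%E else +oo%E.

Section Tensor.
Variable C : E3 R -> tensor4 R.

Definition Cf (e : mfield) : mfield := fun y => tapp (C y) (e y).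

Definition Df (s : mfield) : mfield := fun y => tinv (C y) (s y).

Definition corrector (A : 'M[R]_3) : set vfield :=
  [set u : vfield | [/\ LP0 u, LPA A u
             & forall v, H1per0 v -> ipY (Cf (sgrad u)) (sgrad v) = 0]].

Definition homogenized (A : 'M[R]_3) : 'M[R]_3 :=
  xget 0 [set S | exists2 u, corrector A u & S = volY^-1 *: mint Y (Cf (sgrad u))].

Definition compl_energy (s : mfield) : R := 2^-1 * ipY (Df s) s.

Definition legendre (e : mfield) : \bar R :=
  ereal_sup [set (ipY e s - compl_energy s)%:E | s in L2s].

Definition Gfun (S : 'M[R]_3) (s : mfield) : \bar R :=
  ((compl_energy s)%:E + indS S (Lam s))%E.

Definition kfun (S : 'M[R]_3) (e : mfield) : R :=
  2^-1 * ipY (Cf e) e - frob S (mint Y e).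

Definition lagrangian (S : 'M[R]_3) (s e : mfield) : \bar R :=
  ((ipY e s)%:E - legendre e + indS S (Lam s))%E.

End Tensor.
End Cell.

Definition is_minimizer (R : realType) (F : (E3 R -> 'M[R]_3) -> \bar R)
    (K : set (E3 R -> 'M[R]_3)) (x : E3 R -> 'M[R]_3) : Prop :=
  K x /\ forall z, K z -> (F x <= F z)%E.

Definition is_the_minimizer (R : realType) (F : (E3 R -> 'M[R]_3) -> \bar R)
    (K : set (E3 R -> 'M[R]_3)) (x : E3 R -> 'M[R]_3) : Prop :=
  is_minimizer F K x /\
  forall z, is_minimizer F K z -> {ae @leb3 R, forall y, z y = x y}.

(* Main.v *)
(* Let e0 be the symmetric gradient of u_A and sigma = C e0.  Periodizing test
   functions turns the cell problem into div sigma = 0, so sigma is in T(S).  A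
   field s of T(S) equals C d for some d, all fields of T(S) have the same pairing
   with e0, and completing the square gives
     g(s) - g(sigma) = 1/2 int <C (d - e0), d - e0> >= 0;
   the problem for k and the saddle point inequalities follow in the same way.

   The analytic core is that a divergence-free periodic s is orthogonal to every
   periodic gradient V = grad v.  The function F(z) = int_Y <s(y), V(y + z)> dy
   vanishes in the sense of distributions, because integrating by parts in z moves
   the derivatives onto s.  So F = 0 almost everywhere, and F is continuous at 0
   since translates converge weakly in L^2, whence F(0) = 0. *)

Require Import Defs.
From HB Require Import structures.
From mathcomp Require Import all_boot all_order all_algebra.
From mathcomp Require Import all_classical all_reals all_analysis.
From mathcomp Require Import measurable_realfun lebesgue_measure.
From mathcomp Require Import ring lra.
Set Implicit Arguments.
Unset Strict Implicit.
Unset Printing Implicit Defensive.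
Import Order.TTheory GRing.Theory Num.Theory.
Import numFieldNormedType.Exports.
Import HBNNSimple.
Local Open Scope classical_set_scope.
Local Open Scope ring_scope.

(** [grad], [tinv] and [homogenized] are picked by choice operators, and fields matter only up to
    null sets. Each choice is therefore compared with a controlled representative: [grad] with any
    weak gradient by uniqueness, [tinv] with Cramer's formula, which is measurable in the entries of
    [C], and [homogenized] with the mean stress of the given corrector, because two correctors have
    the same strain almost everywhere. Mollification, density of smooth functions and Fourier series
    are avoided. Products of one-dimensional bumps converge pointwise to indicators of half-open
    boxes, and a Dynkin argument passes from boxes to all of L^2. The resulting criterion for weak
    convergence to zero gives both the continuity of translations and, on a constant sequence, the
    fundamental lemma of the calculus of variations. The closed cell meets its translates along
    faces. Integrals over it are compared with those over the half-open cell, whose translates tile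
    space exactly. No minimax theorem is used: the corrector is a datum and produces the saddle
    point explicitly. *)

(* The library attaches a sigma-finite structure to products of subprobability
   measures only, so leb2 and leb3 get theirs here. *)
Lemma product_measure_sigma_finite d1 d2 (T1 : measurableType d1)
    (T2 : measurableType d2) (R : realType)
    (m1 : {sigma_finite_measure set T1 -> \bar R})
    (m2 : {sigma_finite_measure set T2 -> \bar R}) :
  sigma_finite setT (m1 \x m2)%E.
Proof.
have /sigma_finiteP[F [TF ndF Foo]] := sigma_finiteT m1.
have /sigma_finiteP[G [TG ndG Goo]] := sigma_finiteT m2.
exists (fun n => F n `*` G n).
  apply/esym/seteqP; split => // -[x y] _.
  have [n _ Fn] : (\bigcup_i F i) x by rewrite -TF.
  have [k _ Gk] : (\bigcup_i G i) y by rewrite -TG.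
  exists (maxn n k) => //; split => /=.
    by move: x Fn; exact/subsetPset/ndF/leq_maxl.
  by move: y Gk; exact/subsetPset/ndG/leq_maxr.
move=> k; have [? ?] := Foo k; have [? ?] := Goo k.
split; first exact: measurableX.
by rewrite product_measure1E// lte_mul_pinfty// ge0_fin_numE.
Qed.

Lemma leb2_sigma_finite (R : realType) : sigma_finite setT (@leb2 R).
Proof. exact: product_measure_sigma_finite. Qed.

HB.instance Definition _ (R : realType) :=
  Measure_isSigmaFinite.Build _ _ _ (@leb2 R) (@leb2_sigma_finite R).

Lemma leb3_sigma_finite (R : realType) : sigma_finite setT (@leb3 R).
Proof. exact: product_measure_sigma_finite. Qed.

HB.instance Definition _ (R : realType) :=
  Measure_isSigmaFinite.Build _ _ _ (@leb3 R) (@leb3_sigma_finite R).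

(** * Invariance of Lebesgue measure on R^3 under translations and point reflections *)

Section Invariance.
Variable R : realType.
Implicit Types (b : bool).

(** One family for the translations ([b = false]) and the reflections [c - x] ([b = true]). The
    reflections are needed for integrals of convolution type, where [s (y - z)] is integrated in
    [z]. *)
Definition aff1 (b : bool) (c x : measurableTypeR R) : measurableTypeR R :=
  (-1) ^+ b * x + c.

Lemma measurable_aff1 b c : measurable_fun setT (aff1 b c).
Proof. by apply: measurable_funD => //; apply: measurable_funM. Qed.

(** Lebesgue measure is determined by its values on the intervals []x, y]]. A reflection exchanges
    the closed and the open end, which leaves the length unchanged. *)
Lemma lebesgue_measure_aff1 b c (A : set (measurableTypeR R)) :
  measurable A ->
  @lebesgue_measure R (aff1 b c @^-1` A) = @lebesgue_measure R A.
Proof.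
have mf := measurable_aff1 b c.
move=> mA.
apply/esym.
apply: (@lebesgue_measure_unique R (pushforward (@lebesgue_measure R) (aff1 b c)) _ A mA).
move=> X [[x y] /= _ <-]; rewrite /pushforward.
rewrite lebesgue_measure_itv/=.
have -> : aff1 b c @^-1` `]x, y] =
  if b then `[c - y, c - x[%classic else `]x - c, y - c]%classic.
  apply/seteqP; rewrite /aff1; case: b mf => mf; split => z /=; rewrite !in_itv/= ?expr1 ?expr0; lra.
case: b mf => mf; rewrite lebesgue_measure_itv /= !lte_fin.
  by rewrite ltrD2l ltrN2; case: ifP => // _; rewrite -!EFinB; congr EFin; ring.
by rewrite ltrD2r; case: ifP => // _; rewrite -!EFinB; congr EFin; ring.
Qed.

Definition aff (b : bool) (c y : E3 R) : E3 R :=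
  (aff1 b c.1.1 y.1.1, aff1 b c.1.2 y.1.2, aff1 b c.2 y.2).

Lemma measurable_aff b c : measurable_fun setT (aff b c).
Proof.
apply: measurable_fun_pair; first apply: measurable_fun_pair.
- apply: (measurableT_comp (measurable_aff1 _ _)).
  by apply: measurableT_comp.
- apply: (measurableT_comp (measurable_aff1 _ _)).
  by apply: measurableT_comp.
- apply: (measurableT_comp (measurable_aff1 _ _)).
  exact: measurable_snd.
Qed.

(** Uniqueness of the product measure is used twice, following the nesting of the product: first for
    the planar map [f2], then for its product with the third coordinate. *)
Lemma leb3_aff b c (A : set (E3 R)) : measurable A ->
  @leb3 R (aff b c @^-1` A) = @leb3 R A.
Proof.
move=> mA.
have mf := measurable_aff b c.
pose f2 (y : measurableTypeR R * measurableTypeR R) := (aff1 b c.1.1 y.1, aff1 b c.1.2 y.2).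
have mf2 : measurable_fun setT f2.
  by apply: measurable_fun_pair; apply: (measurableT_comp (measurable_aff1 _ _)).
have H2 B : measurable B -> @leb2 R (f2 @^-1` B) = @leb2 R B.
  move=> mB; apply/esym.
  apply: (@product_measure_unique _ _ _ _ _ (@lebesgue_measure R) (@lebesgue_measure R) (pushforward (@leb2 R) f2)) => //.
  move=> U V mU mV.
  transitivity (@leb2 R ((aff1 b c.1.1 @^-1` U) `*` (aff1 b c.1.2 @^-1` V))) => //.
  rewrite /leb2 product_measure1E//.
  - by congr (_ * _)%E; exact: lebesgue_measure_aff1.
  - by rewrite -[X in measurable X]setTI; exact: measurable_aff1.
  - by rewrite -[X in measurable X]setTI; exact: measurable_aff1.
apply/esym.
apply: (@product_measure_unique _ _ _ _ _ (@leb2 R) (@lebesgue_measure R) (pushforward (@leb3 R) (aff b c))) => //.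
move=> U V mU mV.
transitivity (@leb3 R ((f2 @^-1` U) `*` (aff1 b c.2 @^-1` V))) => //.
rewrite /leb3 product_measure1E//.
- by congr (_ * _)%E; [exact: H2|exact: lebesgue_measure_aff1].
- by rewrite -[X in measurable X]setTI; exact: mf2.
- by rewrite -[X in measurable X]setTI; exact: measurable_aff1.
Qed.

End Invariance.

(** * Boxes and integration on R^3 *)

Section Box.
Variable R : realType.
Implicit Types (a b c y : E3 R).

(** Half-open boxes are stable under intersection and generate the product sigma-algebra, as the
    Dynkin argument for [weak_null] requires. *)
Definition ocbox a b : set (E3 R) :=
  `]a.1.1, b.1.1]%classic `*` `]a.1.2, b.1.2]%classic `*` `]a.2, b.2]%classic.

Definition cst3 (r : R) : E3 R := (r, r, r).

Definition box (n : nat) : set (E3 R) := ocbox (cst3 (- n%:R)) (cst3 n%:R).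

Lemma ocboxE a b y : ocbox a b y <->
  [/\ a.1.1 < y.1.1 <= b.1.1, a.1.2 < y.1.2 <= b.1.2 & a.2 < y.2 <= b.2].
Proof. by rewrite /ocbox/= !in_itv/=; split=> [[[]]|[]]. Qed.

Lemma measurable_ocbox a b : measurable (ocbox a b).
Proof. by apply: measurableX => //; apply: measurableX. Qed.

Lemma leb3_ocbox a b : @leb3 R (ocbox a b) =
  (lebesgue_measure (`]a.1.1, b.1.1]%classic : set R) *
   lebesgue_measure (`]a.1.2, b.1.2]%classic : set R) *
   lebesgue_measure (`]a.2, b.2]%classic : set R))%E.
Proof.
rewrite /leb3 product_measure1E//; last exact: measurableX.
by congr (_ * _)%E; rewrite /leb2; apply: product_measure1E.
Qed.

Lemma leb3_ocbox_lty a b : (@leb3 R (ocbox a b) < +oo)%E.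
Proof.
rewrite leb3_ocbox !lebesgue_measure_itv/=.
by do 3 case: ifP => _; rewrite -?EFinB -?EFinM ?mule0 ?mul0e ?mule0 ?mul0e -?EFinM ?ltry ?lte_fin.
Qed.

Lemma leb3_ocbox_gt0 a b : a.1.1 < b.1.1 -> a.1.2 < b.1.2 -> a.2 < b.2 ->
  (0 < @leb3 R (ocbox a b))%E.
Proof.
move=> h1 h2 h3; rewrite leb3_ocbox !lebesgue_measure_itv/= !lte_fin h1 h2 h3.
by rewrite -!EFinB -!EFinM lte_fin !mulr_gt0// subr_gt0.
Qed.

Lemma boxE n y :
  box n y <-> [/\ - n%:R < y.1.1 <= n%:R, - n%:R < y.1.2 <= n%:R & - n%:R < y.2 <= n%:R].
Proof. exact: ocboxE. Qed.

Lemma measurable_box n : measurable (box n).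
Proof. exact: measurable_ocbox. Qed.

Lemma leb3_box_lty n : (@leb3 R (box n) < +oo)%E.
Proof. exact: leb3_ocbox_lty. Qed.

Lemma norm3E y : `|y| = Num.max (Num.max `|y.1.1| `|y.1.2|) `|y.2|.
Proof. by []. Qed.

Lemma norm3_le y (M : R) :
  `|y| <= M -> [/\ `|y.1.1| <= M, `|y.1.2| <= M & `|y.2| <= M].
Proof. by rewrite norm3E !ge_max => /andP[/andP[]]. Qed.

Lemma norm_lt_box y n : `|y| < n%:R -> box n y.
Proof.
rewrite norm3E !gt_max => /andP[/andP[h1 h2] h3]; apply/boxE.
by move: h1 h2 h3; rewrite !ltr_norml => /andP[? /ltW->] /andP[? /ltW->] /andP[? /ltW->];
  split; rewrite andbT.
Qed.

Lemma box_norm n y : box n y -> `|y| <= n%:R.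
Proof.
move=> /boxE[/andP[h1 h1'] /andP[h2 h2'] /andP[h3 h3']].
by rewrite norm3E !ge_max !ler_norml h1' h2' h3' !ltW.
Qed.

Lemma box_le m n : (m <= n)%N -> box m `<=` box n.
Proof.
move=> mn y /boxE[/andP[h1 h1'] /andP[h2 h2'] /andP[h3 h3']]; apply/boxE.
have mn' : m%:R <= n%:R :> R by rewrite ler_nat.
by split; apply/andP; split; lra.
Qed.

Lemma compact_box_sub (K : set (E3 R)) : compact K -> exists n, K `<=` box n.
Proof.
move=> /compact_bounded[M [Mr MK]].
have [n Mn] : exists n, M < n%:R.
  by exists (Num.bound `|M|); rewrite (le_lt_trans (ler_norm _))// archi_boundP.
exists n.+1 => y Ky; apply: norm_lt_box.
by rewrite (le_lt_trans (MK _ Mn _ Ky))// ltr_nat.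
Qed.

Definition ccube (r : R) : set (E3 R) :=
  `[- r, r]%classic `*` `[- r, r]%classic `*` `[- r, r]%classic.

Lemma compact_ccube r : compact (ccube r).
Proof.
apply: (@compact_setX (measurableTypeR R * measurableTypeR R)%type (measurableTypeR R)); last exact: segment_compact.
apply: (@compact_setX (measurableTypeR R) (measurableTypeR R)); exact: segment_compact.
Qed.

Lemma box_ccube n : box n `<=` ccube n%:R.
Proof.
move=> y /boxE[/andP[h1 h1'] /andP[h2 h2'] /andP[h3 h3']].
by rewrite /ccube/= !in_itv/= h1' h2' h3' !ltW.
Qed.

(** The sigma-algebra is the product one and has to be related to the topology: an open set is the
    union of the countably many rational cubes that it contains. *)
Lemma open_measurable3 (U : set (E3 R)) : open U -> measurable U.
Proof.
move=> oU.
pose Q (q : rat * rat * rat * rat) : set (E3 R) :=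
  (ball (ratr q.1.1.1 : R) (ratr q.2) `*` ball (ratr q.1.1.2 : R) (ratr q.2))
  `*` ball (ratr q.1.2 : R) (ratr q.2).
have mQ q : measurable (Q q).
  have mb (x r : R) : measurable (ball x r : set (measurableTypeR R)).
    exact: measurable_ball.
  by apply: measurableX; [apply: measurableX|]; apply: mb.
pose D q := if pselect (Q q `<=` U) then Q q else set0.
have -> : U = \bigcup_q D q; last first.
  apply: countable_bigcupT_measurable => //.
  by move=> q; rewrite /D; case: pselect => ?; [exact: mQ|exact: measurable0].
apply/seteqP; split; last first.
  by move=> y [q _]; rewrite /D; case: pselect => // sub /sub.
move=> y Uy.
have /nbhs_ballP[e /= e0 eU] : nbhs y U by exact: open_nbhs_nbhs.
have cr (x : R) : exists q : rat, `|x - ratr q| < e / 4.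
  have [|q] := @rat_in_itvoo R (x - e/4) (x + e/4).
    by rewrite ltrD2l (@lt_trans _ _ 0)// ?oppr_lt0 divr_gt0.
  by rewrite in_itv/= => /andP[q1 q2]; exists q; rewrite ltr_norml; lra.
have [q1 h1] := cr y.1.1; have [q2 h2] := cr y.1.2; have [q3 h3] := cr y.2.
(* The rational centre is within [e/4] of [y] in each coordinate. A radius above [e/4] puts [y] in
   the cube, and a radius below [e/2] keeps the cube within [e/4 + e/2 < e] of [y]. *)
have [|r] := @rat_in_itvoo R (e/4) (e/2); first by lra.
rewrite in_itv/= => /andP[r1 r2].
exists (q1, q2, q3, r) => //; rewrite /D.
have Qy : Q (q1, q2, q3, r) y.
  by split; [split|]; rewrite /ball/= distrC; exact: lt_trans r1.
case: pselect => // -[] z [[z1 z2] z3]; apply: eU.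
move: z1 z2 z3; rewrite /ball/= => z1 z2 z3.
have tri (u v w : R) : `|u - v| < e / 4 -> `|v - w| < ratr r -> `|u - w| < e.
  move=> A B; rewrite -(subrKA v); rewrite (le_lt_trans (ler_normD _ _))//.
  lra.
split; first split => /=.
- exact: tri z1.
- exact: tri z2.
- exact: tri z3.
Qed.

Lemma continuous_measurable3 (f : E3 R -> R) :
  continuous f -> measurable_fun setT f.
Proof.
move=> /continuousP cf; apply: (measurability _ (@RGenOpens.measurableE R)).
move=> _ [_ [a [b ->] <-]]; rewrite setTI.
by apply: open_measurable3; apply: cf; exact: interval_open.
Qed.

Lemma closed_measurable3 (U : set (E3 R)) : closed U -> measurable U.
Proof.
move=> cU; rewrite -(setCK U); apply: measurableC; apply: open_measurable3.
exact: closed_openC.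
Qed.

Lemma compact_measurable3 (K : set (E3 R)) : compact K -> measurable K.
Proof.
move=> cK; apply: closed_measurable3; apply: compact_closed => //.
Qed.

End Box.

(** * Real integrals, bounded functions of bounded support, locally square integrable functions *)

Section Integral.
Variable R : realType.
Local Notation mu := (@leb3 R).
Local Notation box := (@box R).
Implicit Types (f g h : E3 R -> R).

Definition intg f := mu.-integrable setT (EFin \o f).
Definition I3 f : R := \int[mu]_y f y.

Lemma intg_measurable f : intg f -> measurable_fun setT f.
Proof. by move=> /measurable_int/measurable_EFinP. Qed.

Lemma intg0 : intg (fun=> 0).
Proof. exact: integrable0. Qed.

Lemma intgD f g : intg f -> intg g -> intg (fun y => f y + g y).
Proof. by move=> h1 h2; apply: (integrableD _ h1 h2). Qed.

Lemma intgZ r f : intg f -> intg (fun y => r * f y).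
Proof. by move=> h1; apply: (integrableZl _ r h1). Qed.

Lemma intgN f : intg f -> intg (fun y => - f y).
Proof. by move=> h1; apply: (integrableN h1). Qed.

Lemma intgB f g : intg f -> intg g -> intg (fun y => f y - g y).
Proof. by move=> h1 h2; apply: (integrableB _ h1 h2). Qed.

Lemma intg_norm f : intg f -> intg (fun y => `|f y|).
Proof. exact: integrable_norm. Qed.

Lemma intg_sum (J : Type) (s : seq J) (F : J -> E3 R -> R) :
  (forall j, intg (F j)) -> intg (fun y => \sum_(j <- s) F j y).
Proof.
move=> hF; elim: s => [|j s IH].
  by under eq_fun do rewrite big_nil; exact: intg0.
by under eq_fun do rewrite big_cons; apply: intgD.
Qed.

Lemma I3_0 : I3 (fun=> 0) = 0.
Proof. by rewrite /I3 Rintegral_cst// mul0r. Qed.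

Lemma I3D f g : intg f -> intg g -> I3 (fun y => f y + g y) = I3 f + I3 g.
Proof. exact: RintegralD. Qed.

Lemma I3B f g : intg f -> intg g -> I3 (fun y => f y - g y) = I3 f - I3 g.
Proof. exact: RintegralB. Qed.

Lemma I3Z r f : intg f -> I3 (fun y => r * f y) = r * I3 f.
Proof. by move=> hf; rewrite /I3 RintegralZl. Qed.

Lemma I3N f : intg f -> I3 (fun y => - f y) = - I3 f.
Proof.
by move=> hf; rewrite -[RHS]mulN1r -I3Z//; congr I3; apply/funext => y; rewrite mulN1r.
Qed.

Lemma I3_sum (J : Type) (s : seq J) (F : J -> E3 R -> R) :
  (forall j, intg (F j)) ->
  I3 (fun y => \sum_(j <- s) F j y) = \sum_(j <- s) I3 (F j).
Proof.
move=> hF; elim: s => [|j s IH].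
  by under eq_fun do rewrite big_nil; rewrite big_nil I3_0.
under eq_fun do rewrite big_cons.
by rewrite big_cons I3D ?IH//; exact: intg_sum.
Qed.

Lemma I3_ge0 f : (forall y, 0 <= f y) -> 0 <= I3 f.
Proof. by move=> f0; apply: Rintegral_ge0. Qed.

Lemma I3_le f g : intg f -> intg g -> (forall y, f y <= g y) -> I3 f <= I3 g.
Proof. by move=> hf hg fg; apply: le_Rintegral. Qed.

Lemma I3_norm_le f : intg f -> `|I3 f| <= I3 (fun y => `|f y|).
Proof. by move=> hf; apply: le_normr_Rintegral. Qed.

Lemma intgE f : intg f -> (I3 f)%:E = (\int[mu]_y (f y)%:E)%E.
Proof. by move=> hf; rewrite /I3 /Rintegral fineK//; exact: integrable_fin_num. Qed.

Lemma intg_le f g : measurable_fun setT f -> (forall y, `|f y| <= g y) ->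
  intg g -> intg f.
Proof.
move=> mf fg; apply: le_integrable => //; first exact/measurable_EFinP.
by move=> y _ /=; rewrite lee_fin (le_trans (fg y))// ler_norm.
Qed.

Lemma intg_ae_le f g : measurable_fun setT f ->
  {ae mu, forall y, `|f y| <= g y} -> intg g -> intg f.
Proof.
move=> mf fg hg; have mg := intg_measurable hg.
apply/integrableP; split; first exact/measurable_EFinP.
move/integrableP: (hg) => [_]; apply: le_lt_trans.
apply: ae_ge0_le_integral => //.
- by apply: measurableT_comp => //; exact/measurable_EFinP.
- by apply: measurableT_comp => //; exact/measurable_EFinP.
- by apply: filterS fg => y fg _; rewrite lee_fin (le_trans fg)// ler_norm.
Qed.

Lemma ge0_int_aff b c (F : E3 R -> \bar R) : measurable_fun setT F ->
  (forall y, (0 <= F y)%E) ->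
  (\int[mu]_y F (aff b c y) = \int[mu]_y F y)%E.
Proof.
move=> mF F0; have ma := measurable_aff b c.
rewrite -[RHS](@eq_measure_integral _ _ _ _ _ (pushforward mu (aff b c))).
  by rewrite ge0_integral_pushforward.
by move=> A mA _; rewrite /pushforward; exact: leb3_aff.
Qed.

Lemma intg_aff b c f : intg f -> intg (fun y => f (aff b c y)).
Proof.
move=> hf; have mf := intg_measurable hf; have ma := measurable_aff b c.
apply/integrableP; split.
  by apply/measurable_EFinP; apply: (measurableT_comp mf).
rewrite /= (@ge0_int_aff b c (fun y => `|(f y)%:E|)%E)//.
  by move/integrableP: hf => [].
by apply: measurableT_comp => //; exact/measurable_EFinP.
Qed.

Lemma I3_aff b c f : intg f -> I3 (fun y => f (aff b c y)) = I3 f.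
Proof.
move=> hf; have mf := intg_measurable hf; have ma := measurable_aff b c.
apply: EFin_inj; rewrite !intgE//; last exact: intg_aff.
rewrite -[RHS](@eq_measure_integral _ _ _ _ _ (pushforward mu (aff b c))).
  rewrite integral_pushforward//; first exact/measurable_EFinP.
  exact: intg_aff.
by move=> A mA _; rewrite /pushforward; exact: leb3_aff.
Qed.

Lemma ae_aff b c (P : E3 R -> Prop) :
  {ae mu, forall y, P y} -> {ae mu, forall y, P (aff b c y)}.
Proof.
move=> [N [mN N0 PN]]; have ma := measurable_aff b c.
exists (aff b c @^-1` N); split.
- by rewrite -[X in measurable X]setTI; exact: ma.
- by rewrite -N0; exact: leb3_aff.
- by move=> y /= nP; apply: PN.
Qed.

(** The integral of a nonnegative function is a supremum over the simple functions below it, whether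
    or not the function is measurable. A simple function below [F], cut off on the null set, is
    below [G] and keeps its integral. *)
Lemma ge0_le_nnint (F G : E3 R -> \bar R) : (forall y, (0 <= F y)%E) ->
  (forall y, (0 <= G y)%E) -> {ae mu, forall y, F y = G y} ->
  (\int[mu]_y F y <= \int[mu]_y G y)%E.
Proof.
move=> F0 G0 [N [mN N0 FG]].
rewrite !ge0_integralTE//; apply: ge_ereal_sup => _ [s sF <-].
pose s' : {nnsfun E3 R >-> R} := proj_nnsfun s (measurableC mN).
have -> : sintegral mu s = sintegral mu s'.
  rewrite -!integralT_nnsfun; apply: ge0_ae_eq_integral => //.
  - by apply/measurable_EFinP.
  - by apply/measurable_EFinP.
  - by move=> y _; rewrite lee_fin.
  - by move=> y _; rewrite lee_fin.
  exists N; split => // y /=; apply: contra_notP => Ny _.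
  by rewrite /= mindicE mem_set// mulr1.
apply: ereal_sup_ubound; exists s' => //= y.
rewrite mindicE; case: (boolP (y \in ~` N)) => [|_]; last by rewrite mulr0.
rewrite inE /= => Ny; rewrite mulr1; suff <- : F y = G y by exact: sF.
by apply: contrapT => nFG; apply: Ny; apply: FG.
Qed.

(* No measurability: fields are only known up to null sets, and tinv need not
   be a Borel function of its argument. *)
Lemma I3_ae f g : {ae mu, forall y, f y = g y} -> I3 f = I3 g.
Proof.
move=> fg; rewrite /I3 /Rintegral.
rewrite [in LHS]integralE [in RHS]integralE; congr (fine (_ - _)).
  apply/eqP; rewrite eq_le; apply/andP.
  by split; apply: ge0_le_nnint => [y|y|]; rewrite ?funepos_ge0//;
    apply: filterS fg => y; move=> fgy; rewrite !funeposE fgy.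
apply/eqP; rewrite eq_le; apply/andP.
by split; apply: ge0_le_nnint => [y|y|]; rewrite ?funeneg_ge0//;
  apply: filterS fg => y; move=> fgy; rewrite !funenegE fgy.
Qed.

Lemma I3_eq0 f : intg f -> (forall y, 0 <= f y) -> I3 f = 0 ->
  {ae mu, forall y, f y = 0}.
Proof.
move=> hf f0 I0; have mf := intg_measurable hf.
have : (\int[mu]_(y in setT) `|(f y)%:E| = 0)%E.
  rewrite -[RHS]/(0%:E) -I0 intgE//; apply: eq_integral => y _.
  by rewrite /= ger0_norm.
move/ae_eq_integral_abs => H.
have mf' : measurable_fun setT (EFin \o f) by exact/measurable_EFinP.
have := H measurableT mf'; apply: filterS => y h.
by apply: EFin_inj; exact: (h I).
Qed.

Lemma I3_dct (fn : nat -> E3 R -> R) f g :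
  (forall n, measurable_fun setT (fn n)) -> measurable_fun setT f ->
  (forall y, fn n y @[n --> \oo] --> f y) ->
  intg g -> (forall n y, `|fn n y| <= g y) ->
  intg f /\ I3 (fn n) @[n --> \oo] --> I3 f.
Proof.
move=> mfn mf fnf hg fng.
have [] := @dominated_convergence _ _ _ mu setT measurableT
  (fun n => EFin \o fn n) (EFin \o f) (EFin \o g).
- by move=> n; exact/measurable_EFinP.
- exact/measurable_EFinP.
- by apply: aeW => y _; apply: cvg_EFin; [exact: nearW|exact: fnf].
- exact: hg.
- by apply: aeW => y n _; rewrite lee_fin.
move=> hf _ cv; split => //; apply: fine_cvg.
by rewrite /I3 /Rintegral fineK//; exact: integrable_fin_num.
Qed.

Lemma Rint_indic (D : set (E3 R)) f :
  \int[mu]_(y in D) f y = I3 (fun y => \1_D y * f y).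
Proof.
rewrite Rintegral_mkcond; congr I3; apply/funext => y; rewrite patchE indicE.
by case: ifP; rewrite ?mul1r ?mul0r.
Qed.

Lemma intg_indic (D : set (E3 R)) : measurable D -> (mu D < +oo)%E ->
  intg (\1_D).
Proof.
move=> mD Doo; apply/integrableP; split; first exact/measurable_EFinP.
under eq_integral do rewrite /= ger0_norm//.
by rewrite integral_indic// setIT.
Qed.

Lemma I3_indic (D : set (E3 R)) : measurable D -> I3 (\1_D) = fine (mu D).
Proof. by move=> mD; rewrite /I3 /Rintegral integral_indic// setIT. Qed.

(** These are the multipliers that make local quantities integrable: test functions and their
    derivatives, indicators of boxes and of the cell. *)
Definition bbs f := measurable_fun setT f /\
  exists n M, forall y, `|f y| <= M * \1_(box n) y.

(** [L2loc] with indicators of boxes as weights in place of integrals over compact sets; [L2locP] is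
    the equivalence. *)
Definition L2b f := measurable_fun setT f /\
  forall n, intg (fun y => \1_(box n) y * f y ^+ 2).

Lemma indic01 (T : Type) (D : set T) y : 0 <= (\1_D y : R) <= 1.
Proof. by rewrite indicE; case: (_ \in _); rewrite ?lexx ?ler01. Qed.

Lemma intg_box n : intg (\1_(box n)).
Proof. by apply: intg_indic; [exact: measurable_box|exact: leb3_box_lty]. Qed.

Lemma bbs_bound f : bbs f -> exists n M, 0 <= M /\ forall y, `|f y| <= M * \1_(box n) y.
Proof.
move=> [_ [n [M H]]]; exists n, `|M|; split => // y.
apply: (le_trans (H y)); rewrite ler_wpM2r ?ler_norm//.
Qed.

Lemma bbs_intg f : bbs f -> intg f.
Proof.
move=> [mf [n [M fM]]]; apply: (intg_le mf fM); apply: intgZ; exact: intg_box.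
Qed.

Lemma bbs_le f g : measurable_fun setT f -> (exists M, forall y, `|f y| <= M * `|g y|) ->
  bbs g -> bbs f.
Proof.
move=> mf [M fM] bg; have [n [K [K0 gK]]] := bbs_bound bg.
split => //; exists n, (`|M| * K) => y; apply: (le_trans (fM y)).
rewrite -mulrA; apply: (@le_trans _ _ (`|M| * `|g y|)).
  by rewrite ler_wpM2r ?ler_norm.
by rewrite ler_wpM2l.
Qed.

Lemma bbsZ r f : bbs f -> bbs (fun y => r * f y).
Proof.
move=> bf; apply: (bbs_le _ _ bf).
  by apply: measurable_funM => //; case: bf.
by exists `|r| => y; rewrite normrM.
Qed.

Lemma bbsM f g : bbs f -> measurable_fun setT g ->
  (exists M, forall y, `|g y| <= M) -> bbs (fun y => f y * g y).
Proof.
move=> bf mg [M gM]; apply: (bbs_le _ _ bf).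
  by apply: measurable_funM => //; case: bf.
by exists M => y; rewrite normrM mulrC ler_wpM2r.
Qed.

Lemma bbs_bounded f : bbs f -> exists M, forall y, `|f y| <= M.
Proof.
move=> bf; have [n [K [K0 fK]]] := bbs_bound bf; exists K => y.
apply: (le_trans (fK y)); rewrite ler_piMr//.
Qed.

Lemma bbs_indic (D : set (E3 R)) n : measurable D -> D `<=` box n -> bbs (\1_D).
Proof.
move=> mD Dn; split => //; exists n, 1 => y; rewrite mul1r ger0_norm//.
  rewrite !indicE ler_nat; case: (boolP (y \in D)) => // yD.
  by rewrite mem_set//; apply: Dn; rewrite -inE.
Qed.

Lemma box_aff b c n : exists m, forall y, box n (aff b c y) -> box m y.
Proof.
have [m mh] : exists m : nat, n%:R + `|c| < m%:R.
  exists (Num.bound (n%:R + `|c|)); rewrite archi_boundP//.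
exists m => y /box_norm/norm3_le[h1 h2 h3]; apply: norm_lt_box.
have /norm3_le[c1 c2 c3] : `|c| <= `|c| by [].
have H (u v : R) : `|aff1 b v u| <= n%:R -> `|v| <= `|c| -> `|u| < m%:R.
  rewrite /aff1; case: b {h1 h2 h3}; rewrite ?expr1 ?expr0 ?mulN1r ?mul1r => A B.
    apply: le_lt_trans mh; rewrite -(normrN u) -(addrK v (- u)).
    by rewrite (le_trans (ler_normB _ _))// lerD.
  apply: le_lt_trans mh; rewrite -(addrK v u).
  by rewrite (le_trans (ler_normB _ _))// lerD.
by rewrite norm3E !gt_max (H _ c.1.1)// (H _ c.1.2)// (H _ c.2).
Qed.

Lemma bbs_aff b c f : bbs f -> bbs (fun y => f (aff b c y)).
Proof.
move=> bf; have [n [K [K0 fK]]] := bbs_bound bf; split.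
  by apply: (measurableT_comp _ (measurable_aff b c)); case: bf.
have [m hm] := box_aff b c n; exists m, K => y.
apply: (le_trans (fK _)); rewrite ler_wpM2l// !indicE ler_nat.
case: (boolP (aff b c y \in box n)) => // yn.
by rewrite mem_set//; apply: hm; rewrite -inE.
Qed.

Lemma L2b_bbs f g : L2b f -> bbs g -> intg (fun y => g y * f y ^+ 2).
Proof.
move=> [mf hf] bg; have [n [K [K0 gK]]] := bbs_bound bg.
apply: (@intg_le _ (fun y => K * (\1_(box n) y * f y ^+ 2))); last exact/intgZ/hf.
  by apply: measurable_funM; [case: bg|exact: measurable_funX].
by move=> y /=; rewrite normrM (ger0_norm (sqr_ge0 _)) [leRHS]mulrA ler_wpM2r ?sqr_ge0.
Qed.

(** A crude Young inequality. It takes the place of the Cauchy-Schwarz inequality in all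
    integrability arguments, where constants do not matter. *)
Lemma mul_le_sqr (x y : R) : `|x * y| <= x ^+ 2 + y ^+ 2.
Proof.
rewrite normrM -(real_normK (num_real x)) -(real_normK (num_real y)).
move: `|x| `|y| (normr_ge0 x) (normr_ge0 y) => u v u0 v0.
have := sqr_ge0 (u - v); have := mulr_ge0 u0 v0; rewrite sqrrB; lra.
Qed.

Lemma bbs_norm f : bbs f -> bbs (fun y => `|f y|).
Proof.
move=> bf; apply: (bbs_le _ _ bf); last by exists 1 => y; rewrite mul1r normr_id.
by apply: measurableT_comp => //; case: bf.
Qed.

Lemma bbs_L2b2 p f g : bbs p -> L2b f -> L2b g ->
  intg (fun y => p y * (f y * g y)).
Proof.
move=> bp hf hg.
have bn := bbs_norm bp.
apply: (@intg_le _ (fun y => `|p y| * f y ^+ 2 + `|p y| * g y ^+ 2)).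
- by apply: measurable_funM; [case: bp|apply: measurable_funM; [case: hf|case: hg]].
- by move=> y; rewrite normrM -mulrDr ler_wpM2l// mul_le_sqr.
- by apply: intgD; apply: L2b_bbs.
Qed.

Lemma L2b_bounded f : measurable_fun setT f ->
  (forall n, exists M, forall y, box n y -> `|f y| <= M) -> L2b f.
Proof.
move=> mf H; split => // n; have [M fM] := H n.
apply: (@intg_le _ (fun y => M ^+ 2 * \1_(box n) y)); last exact/intgZ/intg_box.
- apply: measurable_funM; last exact: measurable_funX.
  by apply: measurable_indic; exact: measurable_box.
move=> y; rewrite indicE; case: (boolP (y \in box n)) => yn; last first.
  by rewrite mul0r mulr0 normr0.
rewrite mul1r mulr1 ger0_norm ?sqr_ge0// -(real_normK (num_real (f y))).
by rewrite lerXn2r ?nnegrE// ?fM ?(le_trans _ (fM y _))//; rewrite -inE.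
Qed.

Lemma L2b_bbs1 p : bbs p -> L2b p.
Proof.
move=> bp; apply: L2b_bounded; first by case: bp.
by have [M pM] := bbs_bounded bp; move=> n; exists M.
Qed.

Lemma L2b_cst r : L2b (fun=> r).
Proof. by apply: L2b_bounded => // n; exists `|r|. Qed.

Lemma bbs_L2b p f : bbs p -> L2b f -> intg (fun y => p y * f y).
Proof.
move=> bp hf; have := bbs_L2b2 bp hf (L2b_cst 1).
by apply: eq_integrable => // y _; rewrite /= mulr1.
Qed.

Lemma L2bZ r f : L2b f -> L2b (fun y => r * f y).
Proof.
move=> [mf hf]; split; first exact: measurable_funM.
move=> n; have := intgZ (r ^+ 2) (hf n); apply: eq_integrable => // y _ /=.
by congr EFin; ring.
Qed.

Lemma L2bN f : L2b f -> L2b (fun y => - f y).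
Proof.
by move=> /(L2bZ (-1)); congr L2b; apply/funext => y; rewrite mulN1r.
Qed.

Lemma L2bD f g : L2b f -> L2b g -> L2b (fun y => f y + g y).
Proof.
move=> [mf hf] [mg hg]; split; first exact: measurable_funD.
move=> n.
apply: (@intg_le _ (fun y => 2 * (\1_(box n) y * f y ^+ 2) + 2 * (\1_(box n) y * g y ^+ 2))).
- apply: measurable_funM; last by apply: measurable_funX; exact: measurable_funD.
  by apply: measurable_indic; exact: measurable_box.
- move=> y; have /andP[i0 _] := indic01 (box n) y.
  rewrite /= (ger0_norm (mulr_ge0 i0 (sqr_ge0 _))) (mulrCA 2 _ (f y ^+ 2)).
  rewrite (mulrCA 2 _ (g y ^+ 2)) -mulrDr ler_wpM2l//.
  have := sqr_ge0 (f y - g y); rewrite sqrrB sqrrD; lra.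
- by apply: intgD; exact: intgZ.
Qed.

Lemma L2bB f g : L2b f -> L2b g -> L2b (fun y => f y - g y).
Proof. by move=> hf /L2bN; exact: L2bD. Qed.

Lemma L2b_sum (J : Type) (s : seq J) (F : J -> E3 R -> R) :
  (forall j, L2b (F j)) -> L2b (fun y => \sum_(j <- s) F j y).
Proof.
move=> hF; elim: s => [|j s IH].
  by under eq_fun do rewrite big_nil; exact: L2b_cst.
by under eq_fun do rewrite big_cons; apply: L2bD.
Qed.

Lemma L2b_ae_le f g : measurable_fun setT f -> (exists M, {ae mu, forall y, `|f y| <= M * `|g y|}) ->
  L2b g -> L2b f.
Proof.
move=> mf [M fM] hg; split => // n.
apply: (@intg_ae_le _ (fun y => `|M| ^+ 2 * (\1_(box n) y * g y ^+ 2))).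
- apply: measurable_funM; last by apply: measurable_funX.
  by apply: measurable_indic; exact: measurable_box.
- apply: filterS fM => y fM; have /andP[i0 _] := indic01 (box n) y.
  rewrite /= (ger0_norm (mulr_ge0 i0 (sqr_ge0 _))) (mulrCA (`|M| ^+ 2)) ler_wpM2l//.
  rewrite -(real_normK (num_real (f y))) -(real_normK (num_real (g y))) -exprMn.
  rewrite lerXn2r ?nnegrE ?mulr_ge0//.
  by apply: (le_trans fM); rewrite ler_wpM2r// ler_norm.
- by apply: intgZ; case: hg.
Qed.

Lemma L2bM f g : L2b f -> measurable_fun setT g ->
  (exists M, {ae mu, forall y, `|g y| <= M}) -> L2b (fun y => g y * f y).
Proof.
move=> hf mg [M gM]; apply: (L2b_ae_le _ _ hf).
  by apply: measurable_funM => //; case: hf.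
by exists M; apply: filterS gM => y gM; rewrite normrM ler_wpM2r.
Qed.

Lemma L2b_aff b c f : L2b f -> L2b (fun y => f (aff b c y)).
Proof.
move=> [mf hf]; split; first exact: (measurableT_comp mf (measurable_aff b c)).
move=> n.
(* The inverse map: a reflection is its own inverse, and a translation is undone by the opposite
   one. The weight [\1_(box n)] is pulled back along it before the change of variables. *)
have [b' [c' bc]] : exists b' c', forall z, aff b c (aff b' c' z) = z /\ aff b' c' (aff b c z) = z.
  exists b, (if b then c else - c) => z; rewrite /aff /aff1.
  case: b; case: z => -[z1 z2] z3; case: c => -[c1 c2] c3 /=; rewrite ?expr1 ?expr0; split;
  by congr (_, _, _); ring.
have := bbs_aff b' c' (bbs_indic (measurable_box n) (@subset_refl _ (box n))).
move=> /(L2b_bbs (conj mf hf))/(intg_aff b c).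
by apply: eq_integrable => // y _ /=; rewrite (bc y).2.
Qed.

Lemma measurable_local f :
  (forall n, exists2 g, measurable_fun setT g & forall y, box n y -> f y = g y) ->
  measurable_fun setT f.
Proof.
move=> H.
have mfn n : measurable_fun setT (fun y => \1_(box n) y * f y).
  have [g mg fg] := H n.
  rewrite (_ : (fun y => \1_(box n) y * f y) = (fun y => \1_(box n) y * g y)).
    by apply: measurable_funM => //; apply: measurable_indic; exact: measurable_box.
  apply/funext => y; rewrite indicE; case: (boolP (y \in box n)) => yn; last by rewrite !mul0r.
  by rewrite fg//; rewrite -inE.
apply: (measurable_fun_cvg mfn) => y _.
have [n yn] : exists n : nat, `|y| < n%:R.
  by exists (Num.bound `|y|); rewrite archi_boundP.
apply: cvg_near_cst; exists n => // m /= nm.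
rewrite indicE mem_set ?mul1r//.
by apply: (box_le nm); apply: norm_lt_box.
Qed.

Lemma L2b_local f :
  (forall n, exists2 g, L2b g & forall y, box n y -> f y = g y) -> L2b f.
Proof.
move=> H; split.
  by apply: measurable_local => n; have [g [mg _] fg] := H n; exists g.
move=> n; have [g [mg hg] fg] := H n; move: (hg n).
apply: eq_integrable => // y _ /=; rewrite indicE.
case: (boolP (y \in box n)) => yn; last by rewrite !mul0r.
by rewrite fg//; rewrite -inE.
Qed.

Lemma L2locP f : L2loc f <-> L2b f.
Proof.
split=> -[mf H]; split => //.
- move=> n; have := H _ (@compact_ccube R n%:R).
  have mc : measurable (ccube (n%:R : R)) by apply: compact_measurable3; exact: compact_ccube.
  move/(integrableS mc (measurable_box n) (@box_ccube R n)).
  rewrite integrable_mkcond; last exact: measurable_box.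
  apply: eq_integrable => // y _; rewrite /= patchE indicE.
  by case: ifP; rewrite ?mul1r ?mul0r.
- move=> K cK; have [n Kn] := compact_box_sub cK.
  have := L2b_bbs (conj mf H) (bbs_indic (compact_measurable3 cK) Kn).
  rewrite (integrable_mkcond _ (compact_measurable3 cK)).
  apply: eq_integrable => // y _; rewrite /= patchE indicE.
  by case: ifP; rewrite ?mul1r ?mul0r.
Qed.

Lemma continuous_bounded_box f n : continuous f ->
  exists M, forall y, box n y -> `|f y| <= M.
Proof.
move=> cf.
have /compact_bounded[M [_ HM]] : compact (f @` ccube n%:R).
  apply: continuous_compact; last exact: compact_ccube.
  exact: continuous_subspaceT.
exists (M + 1) => y yn; apply: HM; first by rewrite ltrDl.
by exists y => //; exact: box_ccube.
Qed.

Lemma L2b_continuous f : continuous f -> L2b f.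
Proof.
move=> cf; apply: L2b_bounded; first exact: continuous_measurable3.
by move=> n; exact: continuous_bounded_box.
Qed.

Lemma bbs_continuous f n : continuous f -> (forall y, ~ box n y -> f y = 0) -> bbs f.
Proof.
move=> cf f0; split; first exact: continuous_measurable3.
have [M fM] := continuous_bounded_box n cf; exists n, M => y.
rewrite indicE; case: (boolP (y \in box n)) => yn.
  by rewrite mulr1 fM//; rewrite -inE.
by rewrite mulr0 f0 ?normr0// => h; rewrite mem_set in yn.
Qed.

End Integral.

(** * A criterion for weak convergence to zero in L^2 *)

Section WeakNull.
Variable R : realType.
Local Notation box := (@box R).

Definition ocboxes : set (set (E3 R)) := [set ocbox p.1 p.2 | p in [set: E3 R * E3 R]].

Lemma ocboxI (a b c d : E3 R) : ocbox a b `&` ocbox c d =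
  ocbox (Num.max a.1.1 c.1.1, Num.max a.1.2 c.1.2, Num.max a.2 c.2)
        (Num.min b.1.1 d.1.1, Num.min b.1.2 d.1.2, Num.min b.2 d.2).
Proof.
apply/seteqP; split => y.
  move=> [/ocboxE[/andP[a1 b1] /andP[a2 b2] /andP[a3 b3]]].
  move=> /ocboxE[/andP[c1 d1] /andP[c2 d2] /andP[c3 d3]].
  by apply/ocboxE; rewrite /= !gt_max !le_min a1 b1 a2 b2 a3 b3 c1 d1 c2 d2 c3 d3.
move=> /ocboxE /=; rewrite !gt_max !le_min.
move=> [/andP[/andP[a1 c1] /andP[b1 d1]] /andP[/andP[a2 c2] /andP[b2 d2]] /andP[/andP[a3 c3] /andP[b3 d3]]].
by split; apply/ocboxE; rewrite ?a1 ?b1 ?a2 ?b2 ?a3 ?b3 ?c1 ?d1 ?c2 ?d2 ?c3 ?d3.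
Qed.

Lemma setI_closed_ocboxes : setI_closed ocboxes.
Proof.
by move=> _ _ [[a b] _ <-] [[c d] _ <-] /=; rewrite ocboxI; eexists (_, _).
Qed.

Lemma ex_nat_gt (x : R) : exists n : nat, `|x| < n%:R.
Proof. by exists (Num.bound `|x|); rewrite archi_boundP. Qed.

(** For the inclusion that matters, the coordinates are measurable for the sigma-algebra generated
    by boxes, since a slab is a countable union of boxes. The identity, written as the triple of its
    coordinates, is then measurable from that sigma-algebra to the product one. *)
Lemma measurable_ocboxes : @measurable _ (E3 R) = <<s ocboxes >>.
Proof.
apply/seteqP; split; last first.
  apply: smallest_sub; first exact: sigma_algebra_measurable.
  by move=> _ [[a b] _ <-]; exact: measurable_ocbox.
pose T := g_sigma_algebraType ocboxes.
have key (pr : E3 R -> measurableTypeR R) (B : R -> R -> nat -> set (E3 R)) :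
    (forall x y, pr @^-1` `]x, y]%classic = \bigcup_n B x y n) ->
    (forall x y n, ocboxes (B x y n)) ->
    measurable_fun [set: T] (pr : T -> measurableTypeR R).
  move=> prB oB; apply: (measurability (@ocitv R)) => //.
  move=> _ [_ [[x y] _ <-] <-]; rewrite setTI prB.
  by apply: bigcupT_measurable => n; apply: sub_sigma_algebra; exact: oB.
have m1 : measurable_fun [set: T] (fun y : T => y.1.1 : measurableTypeR R).
  apply: (key _ (fun x y n => ocbox (x, - n%:R, - n%:R) (y, n%:R, n%:R))) => [x y|x y n]; last by eexists (_, _).
  apply/seteqP; split => z /=; rewrite in_itv/=; last first.
    by move=> [n _ /ocboxE[]].
  move=> hz; have [n nz] := ex_nat_gt `|z|.
  exists n => //; apply/ocboxE; split => //=.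
    by have := norm_lt_box (n := n) (y := z); rewrite normr_id in nz; move=> /(_ nz)/boxE[].
  by have := norm_lt_box (n := n) (y := z); rewrite normr_id in nz; move=> /(_ nz)/boxE[].
have m2 : measurable_fun [set: T] (fun y : T => y.1.2 : measurableTypeR R).
  apply: (key _ (fun x y n => ocbox (- n%:R, x, - n%:R) (n%:R, y, n%:R))) => [x y|x y n]; last by eexists (_, _).
  apply/seteqP; split => z /=; rewrite in_itv/=; last first.
    by move=> [n _ /ocboxE[]].
  move=> hz; have [n nz] := ex_nat_gt `|z|.
  exists n => //; apply/ocboxE; split => //=.
    by have := norm_lt_box (n := n) (y := z); rewrite normr_id in nz; move=> /(_ nz)/boxE[].
  by have := norm_lt_box (n := n) (y := z); rewrite normr_id in nz; move=> /(_ nz)/boxE[].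
have m3 : measurable_fun [set: T] (fun y : T => y.2 : measurableTypeR R).
  apply: (key _ (fun x y n => ocbox (- n%:R, - n%:R, x) (n%:R, n%:R, y))) => [x y|x y n]; last by eexists (_, _).
  apply/seteqP; split => z /=; rewrite in_itv/=; last first.
    by move=> [n _ /ocboxE[]].
  move=> hz; have [n nz] := ex_nat_gt `|z|.
  exists n => //; apply/ocboxE; split => //=.
    by have := norm_lt_box (n := n) (y := z); rewrite normr_id in nz; move=> /(_ nz)/boxE[].
  by have := norm_lt_box (n := n) (y := z); rewrite normr_id in nz; move=> /(_ nz)/boxE[].
have mid : measurable_fun [set: T] (fun y : T => (y.1.1, y.1.2, y.2) : E3 R).
  by apply: measurable_fun_pair => //; apply: measurable_fun_pair.
move=> A mA; have := mid measurableT A mA; rewrite setTI.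
by rewrite (_ : _ @^-1` A = A)//; apply/seteqP; split => -[[]].
Qed.

Variables (h : nat -> E3 R -> R) (N : nat) (C : R).
Hypothesis hL2 : forall n, L2b (h n).
Hypothesis hC : forall n, I3 (fun y => \1_(box N) y * h n y ^+ 2) <= C.
Hypothesis h0 : forall a b, I3 (fun y => \1_(ocbox a b) y * h n y) @[n --> \oo] --> (0 : R).

Let bK : bbs (\1_(box N)).
Proof. exact: (bbs_indic (measurable_box N) (@subset_refl _ _)). Qed.

Let L n f := I3 (fun y => \1_(box N) y * (f y * h n y)).

(** The class of admissible weights for which the weak limit is zero. It is a vector space closed in
    L^2 of [box N], and it is enlarged from boxes to measurable sets, simple functions, nonnegative
    functions and finally all of [L2b]. *)
Let P f := L2b f /\ L n f @[n --> \oo] --> (0 : R).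

Let LD n f g : L2b f -> L2b g -> L n (fun y => f y + g y) = L n f + L n g.
Proof.
move=> hf hg; rewrite /L -I3D; try exact: bbs_L2b2.
by congr I3; apply/funext => y; ring.
Qed.

Let LZ n r f : L2b f -> L n (fun y => r * f y) = r * L n f.
Proof.
move=> hf; rewrite /L -I3Z; try exact: bbs_L2b2.
by congr I3; apply/funext => y; ring.
Qed.

Let PD f g : P f -> P g -> P (fun y => f y + g y).
Proof.
move=> [hf f0] [hg g0]; split; first exact: L2bD.
have -> : (fun n => L n (fun y => f y + g y)) = (fun n => L n f + L n g).
  by apply/funext => n; exact: LD.
have : (fun n => L n f + L n g) @ \oo --> (0 + 0 : R) by apply: cvgD.
by rewrite addr0.
Qed.

Let PZ r f : P f -> P (fun y => r * f y).
Proof.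
move=> [hf f0]; split; first exact: L2bZ.
have -> : (fun n => L n (fun y => r * f y)) = (fun n => r * L n f).
  by apply/funext => n; exact: LZ.
have : (fun n => r * L n f) @ \oo --> (r * 0 : R) by apply: cvgM => //; exact: cvg_cst.
by rewrite mulr0.
Qed.

Let P0 : P (fun=> 0).
Proof.
split; first exact: L2b_cst.
rewrite (_ : (fun n => _) = fun=> 0); first exact: cvg_cst.
apply/funext => n; rewrite /L (_ : (fun y => _) = fun=> 0) ?I3_0//.
by apply/funext => y; rewrite mul0r mulr0.
Qed.

Let Psum (J : Type) (s : seq J) (F : J -> E3 R -> R) :
  (forall j, P (F j)) -> P (fun y => \sum_(j <- s) F j y).
Proof.
move=> hF; elim: s => [|j s IH].
  by under eq_fun do rewrite big_nil; exact: P0.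
by under eq_fun do rewrite big_cons; apply: PD.
Qed.

Let C0 : 0 <= C.
Proof.
apply: le_trans (hC 0); apply: I3_ge0 => y.
by rewrite mulr_ge0 ?sqr_ge0//; have /andP[] := indic01 R (box N) y.
Qed.

(* Young's inequality makes the functionals equicontinuous in L2. *)
Let Pclosed f : L2b f -> (forall e, 0 < e -> exists g, P g /\
    I3 (fun y => \1_(box N) y * (f y - g y) ^+ 2) <= e) -> P f.
Proof.
move=> hf H; split => //; apply/cvgrPdist_lt => e e0.
(* Weight for [|u v| <= s u^2 + v^2 / s]: the approximation error [e / (4 s)] and the bound [C] on
   the [h n] then contribute at most [e / 4] each. The [+ 1] keeps [s] positive when [C = 0]. *)
pose s := 4 * (C + 1) / e.
have s0 : 0 < s by rewrite divr_gt0// mulr_gt0// ltr_wpDl.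
have [g [[hg g0] fg]] := H (e / (4 * s)) (divr_gt0 e0 (mulr_gt0 (ltr0n _ 4) s0)).
move/cvgrPdist_lt: g0 => /(_ (e / 2) (divr_gt0 e0 (ltr0n _ 2))).
apply: filterS => n; rewrite !sub0r !normrN => gn.
have hd : L2b (fun y => f y - g y) by exact: L2bB.
have -> : L n f = L n g + L n (fun y => f y - g y).
  by rewrite -LD//; congr L; apply/funext => y; ring.
rewrite (le_lt_trans (ler_normD _ _))//.
rewrite [ltRHS](splitr e) ltr_leD//.
rewrite (le_trans (I3_norm_le _))//; first exact: bbs_L2b2.
have i1 : intg (fun y => s * (\1_(box N) y * (f y - g y) ^+ 2)) by apply/intgZ/hd.2.
have i2 : intg (fun y => s^-1 * (\1_(box N) y * h n y ^+ 2)) by apply/intgZ/(hL2 n).2.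
apply: (@le_trans _ _ (I3 (fun y => s * (\1_(box N) y * (f y - g y) ^+ 2) +
    s^-1 * (\1_(box N) y * h n y ^+ 2)))).
  apply: I3_le => [||y]; first by apply: intg_norm; exact: bbs_L2b2.
    exact: intgD.
  have /andP[j0 _] := indic01 R (box N) y.
  rewrite normrM (ger0_norm j0) (mulrCA s) (mulrCA s^-1) -mulrDr ler_wpM2l//.
  set u := f y - g y; set v := h n y.
  rewrite -[leRHS](@mulfK _ s) ?gt_eqF// ler_pdivlMr//.
  have -> : (s * u ^+ 2 + s^-1 * v ^+ 2) * s = (s * u) ^+ 2 + v ^+ 2.
    by field; rewrite gt_eqF.
  by rewrite -{1}(gtr0_norm s0) -normrM mulrC mulrA mul_le_sqr.
rewrite I3D// I3Z ?I3Z; [|exact: (hL2 n).2|exact: hd.2].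
have -> : e / 2 = s * (e / (4 * s)) + s^-1 * (s * (e / 4)).
  by field; rewrite gt_eqF.
apply: lerD; apply: ler_wpM2l => //; rewrite ?invr_ge0 ?(ltW s0)//.
apply: (le_trans (hC n)); rewrite (_ : s * _ = C + 1); first lra.
by rewrite /s; field; rewrite gt_eqF.
Qed.

Let Pindic S : measurable S -> P (\1_S).
Proof.
have hS T : measurable T -> L2b (\1_T : E3 R -> R).
  move=> mT; apply: L2b_bounded => // n; exists 1 => y _.
  by have /andP[? ?] := indic01 R T y; rewrite ger0_norm.
have Pb a b : P (\1_(ocbox a b)).
  split; first by apply: hS; exact: measurable_ocbox.
  have := h0 (Num.max (- N%:R) a.1.1, Num.max (- N%:R) a.1.2, Num.max (- N%:R) a.2)
             (Num.min N%:R b.1.1, Num.min N%:R b.1.2, Num.min N%:R b.2).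
  rewrite -(ocboxI (cst3 (- N%:R)) (cst3 N%:R)).
  by under eq_fun do (under eq_fun do rewrite indicI -mulrA).
have PT : P (\1_setT).
  split; first exact: hS.
  have [_] := Pb (cst3 (- N%:R)) (cst3 N%:R).
  apply: cvg_trans; apply: near_eq_cvg; apply: nearW => n.
  rewrite /L; congr I3; apply/funext => y; rewrite indicT mulrA mulrA.
  rewrite -/(box N) mulr1 -expr2 indicE; case: (_ \in _); rewrite ?expr1n ?expr0n//.
move=> mS; have := mS; rewrite measurable_ocboxes.
apply: (@dynkin_induction _ (E3 R) ocboxes (fun T => P (\1_T)) measurable_ocboxes
  setI_closed_ocboxes PT).
- by move=> _ [[a b] _ <-]; exact: Pb.
- move=> T mT PT'; have := PD PT (PZ (-1) PT').
  rewrite (_ : (fun y => _) = \1_(~` T))//; apply/funext => y.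
  by rewrite !indicE in_setC in_setT mulN1r; case: (y \in T); rewrite ?subrr ?subr0.
move=> F mF tF PF; set U := \bigcup_k F k.
have mU : measurable U by exact: bigcupT_measurable.
pose B m := \big[setU/set0]_(i < m) F i.
have mB m : measurable (B m) by exact: bigsetU_measurable.
have PB m : P (\1_(B m)).
  elim: m => [|m IH].
    rewrite /B big_ord0 (_ : \1_set0 = fun=> 0)//.
    by apply/funext => y; rewrite indic0.
  have := PD IH (PF m); rewrite (_ : (fun y => _) = \1_(B m.+1))//.
  have -> : B m.+1 = B m `|` F m by rewrite /B big_ord_recr.
  apply/funext => y; rewrite !indicE in_setU; case: (boolP (y \in B m)) => [|_]; last by rewrite add0r.
  rewrite inE => yB; case: (boolP (y \in F m)) => [|_]; last by rewrite addr0.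
  rewrite inE => yF; exfalso.
  move: yB; rewrite /B -bigcup_mkord => -[i /= im Fi].
  by have := tF i m I I (ex_intro _ y (conj Fi yF)); move: im => /[swap] ->; rewrite ltnn.
(* The finite partial unions converge to [U] in L^2 of [box N] by dominated convergence: at each
   point the difference of the indicators is eventually zero. *)
apply: Pclosed; first exact: hS.
move=> e e0.
have [] := @I3_dct R (fun m y => \1_(box N) y * (\1_U y - \1_(B m) y) ^+ 2) (fun=> 0) (\1_(box N)).
- move=> m; apply: measurable_funM; first by case: bK.
  apply: measurable_funX; apply: measurable_funB; exact: measurable_indic.
- by [].
- move=> y; apply: cvg_near_cst.
  have [[k _ Fk]|nU] := pselect (U y); last first.
    apply: nearW => m.
    have nB : ~ B m y.
      by rewrite /B -bigcup_mkord; move=> -[i _ Fi]; apply: nU; exists i.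
    by rewrite !(indicE _ U) !(indicE _ (B m)) (memNset nU) (memNset nB) subrr expr0n mulr0.
  exists k.+1 => // m /= km; have Uy : U y by exists k.
  have By : B m y by rewrite /B -bigcup_mkord; exists k.
  by rewrite !(indicE _ U) !(indicE _ (B m)) (mem_set Uy) (mem_set By) subrr expr0n mulr0.
- exact: intg_box.
- move=> m y; have /andP[j0 _] := indic01 R (box N) y.
  rewrite normrM (ger0_norm j0) ler_piMr//.
  rewrite !indicE; case: (y \in U); case: (y \in B m);
  by rewrite ?subrr ?sub0r ?subr0 ?expr0n ?sqrrN ?expr1n ?normr0 ?normr1.
move=> _; rewrite I3_0 => /cvgrPdist_lt /(_ e e0)[m _ Hm].
exists (\1_(B m)); split; first exact: PB.
have := Hm m (leqnn m); rewrite sub0r normrN => /ltW; apply: le_trans.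
exact: ler_norm.
Qed.

Let Pnnsfun (s : {nnsfun E3 R >-> R}) : P s.
Proof.
rewrite (_ : (s : E3 R -> R) = fun y =>
    \sum_(r <- finmap.enum_fset (fset_set (range s))) r * \1_(s @^-1` [set r]) y).
  by apply: Psum => r; apply: PZ; exact: Pindic.
apply/funext => y; rewrite {1}(fimfunE s y) fsbig_finite//.
Qed.

Let Pge0 f : L2b f -> (forall y, 0 <= f y) -> P f.
Proof.
move=> hf f0; have mf := hf.1.
have [g [ndg gf]] := @approximation _ _ _ _ measurableT (EFin \o f)
  ((measurable_EFinP _ _).2 mf) (fun y _ => f0 y).
have gf' y : g n y @[n --> \oo] --> f y.
  by have /fine_cvg := gf y I.
have gle n y : g n y <= f y.
  have := @nondecreasing_cvgn_le _ (fun n => g n y) _ _ n.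
  rewrite (cvg_lim _ (gf' y))//; apply => //.
    by move=> a b ab; have /asboolP := ndg _ _ ab; exact.
apply: Pclosed => // e e0.
have [] := @I3_dct R (fun m y => \1_(box N) y * (f y - g m y) ^+ 2) (fun=> 0)
  (fun y => \1_(box N) y * f y ^+ 2).
- move=> m; apply: measurable_funM; first by case: bK.
  by apply: measurable_funX; exact: measurable_funB.
- by [].
- move=> y.
  have cd : (fun n => f y - g n y) @ \oo --> (f y - f y : R).
    by apply: cvgB; [exact: cvg_cst|exact: gf'].
  have : (fun n => \1_(box N) y * ((f y - g n y) * (f y - g n y))) @ \oo -->
      (\1_(box N) y * ((f y - f y) * (f y - f y)) : R).
    by apply: cvgM; [exact: cvg_cst|exact: cvgM].
  by rewrite subrr mul0r mulr0.
- by apply: hf.2.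
- move=> m y; have /andP[j0 _] := indic01 R (box N) y.
  rewrite (ger0_norm (mulr_ge0 j0 (sqr_ge0 _))) ler_wpM2l//.
  by rewrite lerXn2r ?nnegrE ?subr_ge0// gerBl.
move=> _; rewrite I3_0 => /cvgrPdist_lt /(_ e e0)[m _ Hm].
exists (g m); split; first exact: Pnnsfun.
have := Hm m (leqnn m); rewrite sub0r normrN => /ltW; apply: le_trans.
exact: ler_norm.
Qed.

(** Boundedness in L^2 of [box N] makes the functionals equicontinuous, so that convergence on the
    indicators of boxes propagates to their closed linear span. A signed [f] is the difference of
    the nonnegative functions [|f| + f] and [|f|]. *)
Lemma weak_null f : L2b f ->
  I3 (fun y => \1_(box N) y * (f y * h n y)) @[n --> \oo] --> (0 : R).
Proof.
move=> hf.
have hn : L2b (fun y => `|f y|).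
  apply: (L2b_ae_le _ _ hf); first by apply: measurableT_comp => //; case: hf.
  by exists 1; apply: aeW => y; rewrite normr_id mul1r.
have p1 : P (fun y => `|f y| + f y).
  apply: Pge0 => [|y]; first exact: L2bD.
  by have := ler_norm (- f y); rewrite normrN; lra.
have p2 : P (fun y => `|f y|) by exact: Pge0.
have [_] := PD p1 (PZ (-1) p2).
by rewrite (_ : (fun y => _) = f)//; apply/funext => y; ring.
Qed.

End WeakNull.

(** * Test functions *)

Section Flat.
Variable R : realType.
Implicit Types (P : {poly R}) (x : R).

(* The polynomial factor makes this family of functions stable under derivation. *)
Definition flat P x : R := if 0 < x then P.[x^-1] * expR (- x^-1) else 0.

(** With [t = 1/x] one has [d/dx = - t^2 d/dt], and [- t^2] times the derivative of [P(t) exp(-t)]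
    is [t^2 (P - P')(t) exp(-t)]. *)
Definition dflat P := 'X^2 * (P - P^`()).

(** From [exp t >= t^(i+2) / (i+2)!] each monomial satisfies [t^i exp(-t) <= (i+2)! t^(-2)]. The two
    spare powers become the factor [x^2] in [flat_bound]. *)
Lemma horner_expR_bound P :
  exists2 K, 0 <= K & forall t, 0 < t -> `|P.[t]| * expR (- t) <= K * t ^- 2.
Proof.
exists (\sum_(i < size P) `|P`_i| * (i.+2)`!%:R).
  by apply: sumr_ge0 => i _; rewrite mulr_ge0.
move=> t t0; rewrite horner_coef mulr_suml.
apply: (@le_trans _ _ ((\sum_(i < size P) `|P`_i * t ^+ i|) * expR (- t))).
  by rewrite ler_wpM2r ?expR_ge0// ler_norm_sum.
rewrite mulr_suml; apply: ler_sum => i _.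
rewrite normrM -!mulrA ler_wpM2l// ger0_norm ?exprn_ge0 ?(ltW t0)//.
rewrite ler_pdivlMr ?exprn_gt0// expRN mulrAC -exprD ler_pdivrMr ?expR_gt0//.
have := @expR_ge1Dxn R t i.+1 (ltW t0).
have h1 : t ^+ i.+2 / (i.+2)`!%:R <= 1 + t ^+ i.+2 / (i.+2)`!%:R by rewrite lerDr.
move/(le_trans h1); rewrite ler_pdivrMr ?ltr0n ?fact_gt0//.
by rewrite -addn2 mulrC.
Qed.

Lemma flat_bound P : exists2 K, 0 <= K & forall x, `|flat P x| <= K * x ^+ 2.
Proof.
have [K K0 HK] := horner_expR_bound P; exists K => // x; rewrite /flat.
case: ifP => [x0|_]; last by rewrite normr0 mulr_ge0 ?sqr_ge0.
rewrite normrM (ger0_norm (expR_ge0 _)).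
by have := HK x^-1; rewrite invr_gt0 => /(_ x0); rewrite -exprVn invrK.
Qed.

(** Away from 0 the function is locally constant or a composition. At 0 the quadratic bound makes
    the difference quotient of order [|h|], so that the derivative vanishes there. *)
Lemma is_derive_flat P x : is_derive x 1 (flat P) (flat (dflat P) x).
Proof.
have [x0|x0|->] := ltgtP x 0.
- have -> : flat (dflat P) x = 0 by rewrite /flat ltNge (ltW x0).
  apply: (@near_eq_is_derive _ _ _ (cst 0)).
  near=> y; rewrite /flat/= ltNge (_ : y <= 0)//.
  by rewrite ltW//; near: y; exact: lt_nbhsl.
- have -> : flat (dflat P) x = (dflat P).[x^-1] * expR (- x^-1) by rewrite /flat x0.
  have xn0 : x != 0 by rewrite gt_eqF.
  have dV : is_derive x (1 : R) (fun y : R => y^-1) (- x ^- 2).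
    have := @is_deriveV R id x 1 1 xn0 (is_derive_id _ _).
    by rewrite /GRing.scale/= mulr1.
  have d1 : is_derive x (1 : R) (horner P \o (fun y : R => y^-1)) (P^`().[x^-1] * - x ^- 2).
    by apply: is_derive1_comp; exact: is_derive_poly.
  have dN : is_derive x (1 : R) (fun y : R => - y^-1) (x ^- 2).
    by have := is_deriveN dV; rewrite opprK.
  have d2 : is_derive x (1 : R) (expR \o (fun y : R => - y^-1)) (expR (- x^-1) * x ^- 2).
    exact: is_derive1_comp.
  have := is_deriveM d1 d2; rewrite /GRing.scale/=.
  move=> H; apply: (@near_eq_is_derive _ _ _ _ _ _ _ _ _ (is_derive_eq H _)).
    near=> y; rewrite /flat (_ : 0 < y)//.
    by near: y; exact: lt_nbhsr.
  rewrite /dflat hornerM hornerXn hornerD hornerN -exprVn /=. ring.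
- have -> : flat (dflat P) 0 = 0 by rewrite /flat ltxx.
  have [K K0 HK] := flat_bound P.
  have f0 : flat P 0 = 0 by rewrite /flat ltxx.
  have cv : h^-1 *: ((flat P \o shift 0) (h *: (1 : R)) - flat P 0) @[h --> 0^'] --> (0 : R).
    apply/cvgrPdist_le => e e0; near=> h.
    rewrite /= f0 subr0 sub0r normrN addr0 /GRing.scale/= mulr1 normrM.
    have h0 : h != 0 by near: h; exact: nbhs_dnbhs_neq.
    rewrite normfV ler_pdivrMl ?normr_gt0//.
    apply: (le_trans (HK h)); rewrite -(real_normK (num_real h)) expr2 mulrA mulrC ler_wpM2l//.
    have hK : `|h| <= e / (K + 1).
      near: h; apply: dnbhs0_le; rewrite divr_gt0// ltr_wpDl//.
    apply: (le_trans (ler_wpM2l K0 hK)).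
    rewrite mulrCA ler_piMr ?(ltW e0)// ler_pdivrMr ?ltr_wpDl// mul1r lerDl//.
  apply: DeriveDef; first by apply: (cvgP (0 : R)); exact: cv.
  by apply: cvg_lim => //.
Unshelve. all: by end_near. Qed.

Lemma derivable_flat P x : derivable (flat P) x 1.
Proof. by have [] := is_derive_flat P x. Qed.

Lemma continuous_flat P : continuous (flat P).
Proof.
move=> x; apply: differentiable_continuous; apply/derivable1_diffP.
exact: derivable_flat.
Qed.

Lemma flat_scale r P x : flat (r *: P) x = r * flat P x.
Proof. by rewrite /flat hornerZ; case: ifP; rewrite ?mulr0 ?mulrA. Qed.

Lemma flat1_ge0 x : 0 <= flat 1 x.
Proof. by rewrite /flat hornerE mul1r; case: ifP => // _; exact: expR_ge0. Qed.

Lemma flat1_le1 x : flat 1 x <= 1.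
Proof.
rewrite /flat hornerE mul1r; case: ifP => // x0.
by rewrite -expR0 ler_expR oppr_le0 invr_ge0 ltW.
Qed.

Lemma flat1_le0 x : x <= 0 -> flat 1 x = 0.
Proof. by rewrite /flat leNgt => /negbTE ->. Qed.

Lemma flat1_cvg (u : nat -> R) : u n @[n --> \oo] --> +oo ->
  flat 1 (u n) @[n --> \oo] --> (1 : R).
Proof.
move=> uoo.
have H : expR (- (u n)^-1) @[n --> \oo] --> (1 : R).
  rewrite -expR0; apply: continuous_cvg; first exact: continuous_expR.
  have V : (fun n => (u n)^-1) @ \oo --> (0 : R).
    by apply/gtr0_cvgV0 => //; move/cvgryPgt: uoo => /(_ 0).
  have : (fun n => - (u n)^-1) @ \oo --> (- 0 : R) by apply: cvgN.
  by rewrite oppr0.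
apply: cvg_trans H; apply: near_eq_cvg; near=> n.
rewrite /flat hornerE mul1r ifT//.
by near: n; move/cvgryPgt: uoo => /(_ 0).
Unshelve. all: by end_near. Qed.

End Flat.

Section LineDerivative.
Variable R : realType.
Implicit Types (y v : E3 R) (F f g : E3 R -> R).

(** The two difference quotients are the same function of the increment. This reduces directional
    derivatives on R^3 to calculus in one variable. *)
Lemma is_derive_line F v y (t d : R) :
  is_derive t (1 : R) (fun h : R => F (h *: v + y)) d <->
  is_derive (t *: v + y) v F d.
Proof.
pose G (h : R) := F (h *: v + y).
have E : (fun h : R => h^-1 *: ((G \o shift t) (h *: (1 : R)) - G t)) =
  (fun h : R => h^-1 *: ((F \o shift (t *: v + y)) (h *: v) - F (t *: v + y))).
  apply/funext => h; rewrite /G /=; congr (_ *: (F _ - _)).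
  by rewrite /GRing.scale/= mulr1 -/(GRing.scale _ _) scalerDl addrA.
have dE : derivable G t 1 <-> derivable F (t *: v + y) v.
  by rewrite /derivable E.
have DE : 'D_1 G t = 'D_v F (t *: v + y) by rewrite /derive E.
split=> -[h1 h2]; apply: DeriveDef.
- exact: (dE.1 h1).
- by rewrite -DE.
- exact: (dE.2 h1).
- by rewrite DE.
Qed.

Lemma is_derive_line0 F v y (d : R) :
  is_derive (0 : R) (1 : R) (fun h : R => F (h *: v + y)) d -> is_derive y v F d.
Proof. by move=> /is_derive_line; rewrite scale0r add0r. Qed.

Lemma is_derive_affine (c d t : R) :
  is_derive t (1 : R) (fun h : R => c * h + d) c.
Proof.
have := @is_deriveD _ _ _ _ _ _ _ _ _
  (is_deriveM (is_derive_cst c t 1) (is_derive_id t 1)) (is_derive_cst d t 1).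
by move=> H; apply: (is_derive_eq H); rewrite scaler0 !addr0 /GRing.scale/= mulr1.
Qed.

Lemma is_derive_aff (b : bool) (c : E3 R) f y v d :
  is_derive (aff b c y) v f d ->
  is_derive y v (fun z => f (aff b c z)) ((-1) ^+ b * d).
Proof.
move=> fd; apply: is_derive_line0.
have E : (fun h : R => f (aff b c (h *: v + y))) =
    (fun h : R => f (h *: v + aff b c y)) \o (fun h : R => (-1) ^+ b * h + 0).
  apply/funext => h /=; congr f; rewrite addr0 /aff /aff1.
  by case: v {fd} => -[v1 v2] v3; case: y => -[y1 y2] y3; congr (_, _, _) => /=;
    rewrite /GRing.scale/=; ring.
rewrite E mulrC; apply: is_derive1_comp; last exact: is_derive_affine.
by apply/is_derive_line; rewrite mulr0 addr0 scale0r add0r.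
Qed.

Definition co (k : 'I_3) y : R := crd y k 0.

Lemma co_line (k j : 'I_3) (h : R) y :
  co k (h *: evec R j + y) = h * (k == j)%:R + co k y.
Proof.
rewrite /co /crd !mxE.
by case: k => -[|[|[|//]]] hk /=; case: j => -[|[|[|//]]] hj /=.
Qed.

Lemma continuous_co k : continuous (co k).
Proof.
have c1 : continuous (fun y : E3 R => y.1.1 : R).
  by move=> y; apply: (@continuous_comp _ _ _ fst fst); exact: cvg_fst.
have c2 : continuous (fun y : E3 R => y.1.2 : R).
  by move=> y; apply: (@continuous_comp _ _ _ fst snd); [exact: cvg_fst|exact: cvg_snd].
have c3 : continuous (fun y : E3 R => y.2 : R).
  by move=> y; exact: cvg_snd.
case: k => -[|[|[|//]]] hk.
- by rewrite (_ : co _ = fun y => y.1.1)//; apply/funext => y; rewrite /co /crd mxE.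
- by rewrite (_ : co _ = fun y => y.1.2)//; apply/funext => y; rewrite /co /crd mxE.
- by rewrite (_ : co _ = fun y => y.2)//; apply/funext => y; rewrite /co /crd mxE.
Qed.

Lemma is_derive_coord (u : R -> R) (k j : 'I_3) (c d du : R) y :
  is_derive (c * co k y + d) (1 : R) u du ->
  is_derive y (evec R j) (fun z => u (c * co k z + d)) (du * (c * (k == j)%:R)).
Proof.
move=> Hu; apply: is_derive_line0.
rewrite (_ : (fun h : R => _) = u \o (fun h : R => (c * (k == j)%:R) * h + (c * co k y + d))).
  by apply: is_derive1_comp; [rewrite mulr0 add0r|exact: is_derive_affine].
by apply/funext => h /=; congr u; rewrite co_line; ring.
Qed.

End LineDerivative.

(** * Smoothness order by order, and bumps approximating the indicators of boxes *)

Section Smooth.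
Variable R : realType.
Implicit Types (y v : E3 R) (F f g p : E3 R -> R).

(** Smoothness up to order [n], with the first derivative taken of [f] itself, so that sums,
    products and the family [flat] are handled by induction on the order. *)
Fixpoint Sm n f : Prop := continuous f /\
  if n is m.+1 then forall j, (forall y, derivable f y (evec R j)) /\ Sm m (partial j f)
  else True.

Lemma Sm_smooth f : (forall n, Sm n f) -> smooth f.
Proof.
move=> H s; have := H (size s).+1 => {H}.
(* [foldr] differentiates first in the last direction of the list, so the induction peels the list
   from its end. *)
elim/last_ind: s f => [|s j IH] f.
  by move=> /= [cf df]; split => // j y; case: (df j).
rewrite size_rcons -cats1 foldr_cat /= => -[_ /(_ j)[_ Hj]].
exact: IH.
Qed.

Lemma SmS n f : Sm n.+1 f -> Sm n f.
Proof.
elim: n f => [|n IH] f; first by case.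
move=> [cf H]; split => // j; have [d Hj] := H j; split => //.
exact: IH.
Qed.

Lemma SmD n f g : Sm n f -> Sm n g -> Sm n (fun y => f y + g y).
Proof.
have cD f' g' : continuous f' -> continuous g' -> continuous (fun y => f' y + g' y :> R).
  by move=> cf cg y; apply: cvgD; [exact: cf|exact: cg].
elim: n f g => [|n IH] f g; first by move=> [cf _] [cg _]; split => //; exact: cD.
move=> [cf Hf] [cg Hg]; split; first exact: cD.
move=> j; have [df Sf] := Hf j; have [dg Sg] := Hg j.
split=> [y|]; first exact: derivableD.
rewrite (_ : partial j _ = fun y => partial j f y + partial j g y); first exact: IH.
by apply/funext => y; rewrite /partial deriveD.
Qed.

Lemma SmM n f g : Sm n f -> Sm n g -> Sm n (fun y => f y * g y).
Proof.
have cM f' g' : continuous f' -> continuous g' -> continuous (fun y => f' y * g' y :> R).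
  by move=> cf cg y; apply: cvgM; [exact: cf|exact: cg].
elim: n f g => [|n IH] f g; first by move=> [cf _] [cg _]; split => //; exact: cM.
move=> Hf Hg; have [cf df] := Hf; have [cg dg] := Hg; split; first exact: cM.
move=> j; have [dfj Sf] := df j; have [dgj Sg] := dg j.
split=> [y|]; first exact: derivableM.
rewrite (_ : partial j _ = fun y => f y * partial j g y + g y * partial j f y).
  by apply: SmD; apply: IH => //; exact: SmS.
by apply/funext => y; rewrite /partial deriveM.
Qed.

Lemma Sm_flat n P (k : 'I_3) (c d : R) : Sm n (fun y => flat P (c * co k y + d)).
Proof.
have cF P' : continuous (fun y : E3 R => flat P' (c * co k y + d)).
  move=> y; apply: (@continuous_comp _ _ _ (fun y : E3 R => c * co k y + d)).
    apply: cvgD; last exact: cvg_cst.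
    by apply: cvgM; [exact: cvg_cst|exact: continuous_co].
  exact: continuous_flat.
elim: n P => [|n IH] P; first by split.
split => // j.
have D y := is_derive_coord j (is_derive_flat P (c * co k y + d)).
split=> [y|]; first by have [] := D y.
rewrite (_ : partial j _ = fun y => flat ((c * (k == j)%:R) *: dflat P) (c * co k y + d)).
  exact: IH.
by apply/funext => y; rewrite /partial (@derive_val _ _ _ _ _ _ _ (D y)) flat_scale mulrC.
Qed.

Lemma test_funI p n : smooth p -> (forall y, ~ box n y -> p y = 0) -> test_fun p.
Proof.
move=> sp p0; split => //. apply: (subclosed_compact _ (@compact_ccube R n%:R)).
  exact: closed_closure.
rewrite closureE; apply: smallest_sub.
  by apply: compact_closed; [exact: norm_hausdorff|exact: compact_ccube].
move=> y /= /eqP py; apply: box_ccube; apply: contrapT => ny; apply: py.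
exact: p0.
Qed.

(** The arguments of the two factors are [n (y_k - a_k)] and [n^2 (b_k - y_k) + n]. The second is at
    least [n] for [y_k <= b_k], the endpoint included, and is nonpositive from [b_k + 1/n] on. The
    bumps therefore converge at every point to the indicator of the half-open box, with supports
    bounded uniformly in [n]. *)
Definition boxbump (a b : E3 R) n y : R := \prod_(k < 3)
  (flat 1 (n%:R * co k y + - (n%:R * co k a)) *
   flat 1 (- n%:R ^+ 2 * co k y + (n%:R ^+ 2 * co k b + n%:R))).

Lemma co_box n y : (forall k, - n%:R < co k y <= n%:R) -> box n y.
Proof.
move=> H; apply/boxE; split.
- by have := H (@Ordinal 3 0 isT); rewrite /co /crd mxE.
- by have := H (@Ordinal 3 1 isT); rewrite /co /crd mxE.
- by have := H (@Ordinal 3 2 isT); rewrite /co /crd mxE.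
Qed.

Lemma co_norm k y : `|co k y| <= `|y|.
Proof.
have [h1 h2 h3] := norm3_le (lexx `|y|).
by case: k => -[|[|[|//]]] hk; rewrite /co /crd mxE.
Qed.

Lemma boxbump01 a b n y : 0 <= boxbump a b n y <= 1.
Proof.
apply: (@big_ind _ (fun x : R => 0 <= x <= 1)) => [|u v|k _].
- by rewrite ler01 lexx.
- by move=> /andP[u0 u1] /andP[v0 v1]; rewrite mulr_ge0// mulr_ile1.
- by rewrite mulr_ge0 ?mulr_ile1 ?flat1_ge0 ?flat1_le1.
Qed.

Lemma boxbump_factor0 a b n y k : ~ (co k a < co k y <= co k b + 1) -> boxbump a b n y = 0.
Proof.
move=> H; rewrite /boxbump (bigD1 k)//=.
suff -> : flat 1 (n%:R * co k y + - (n%:R * co k a)) *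
   flat 1 (- n%:R ^+ 2 * co k y + (n%:R ^+ 2 * co k b + n%:R)) = 0 :> R by rewrite mul0r.
have [ay|ay] := ltP (co k a) (co k y); last first.
  by rewrite flat1_le0 ?mul0r// -mulrBr mulr_ge0_le0// subr_le0.
have [yb|yb] := leP (co k y) (co k b + 1); first by rewrite ay yb in H.
rewrite (@flat1_le0 _ (- n%:R ^+ 2 * _ + _)) ?mulr0//.
have n0 : 0 <= n%:R :> R by [].
(* For [n = 0] both arguments are 0, where [flat 1] vanishes. *)
have [->|n1] := eqVneq n 0%N; first by rewrite expr0n/= oppr0 !mul0r !addr0.
have {}n1 : 1 <= n%:R :> R by rewrite ler1n lt0n.
rewrite -[leRHS](_ : - n%:R ^+ 2 * (co k b + 1) + (n%:R ^+ 2 * co k b + n%:R ^+ 2) = 0); last by ring.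
rewrite lerD//; first by rewrite !mulNr lerN2 ler_wpM2l ?sqr_ge0// ltW.
by rewrite lerD2l expr2 ler_peMl.
Qed.

Lemma boxbump_support a b : exists m, forall n y, ~ box m y -> boxbump a b n y = 0.
Proof.
have [m hm] : exists m : nat, `|a| + `|b| + 1 < m%:R.
  exists (Num.bound (`|a| + `|b| + 1)); rewrite archi_boundP//.
exists m => n y ny.
have [k hk] : exists k, ~ (co k a < co k y <= co k b + 1).
  apply: contrapT => /forallNP H; apply: ny; apply: co_box => k.
  have /contrapT/andP[h1 h2] := H k.
  have := co_norm k a; have := co_norm k b; have := normr_ge0 a; have := normr_ge0 b.
  by rewrite !ler_norml; lra.
exact: boxbump_factor0 hk.
Qed.

Lemma boxbump_test a b n : test_fun (boxbump a b n).
Proof.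
have [m hm] := boxbump_support a b.
apply: (@test_funI _ m); last exact: hm.
apply: Sm_smooth => j; rewrite /boxbump.
under eq_fun do rewrite !big_ord_recl big_ord0 mulr1.
by do ! apply: SmM; exact: Sm_flat.
Qed.

Lemma ramp_cvg (a b x : R) :
  (fun n : nat => flat 1 (n%:R * x + - (n%:R * a)) *
     flat 1 (- n%:R ^+ 2 * x + (n%:R ^+ 2 * b + n%:R))) @ \oo --> ((a < x <= b)%R%:R : R).
Proof.
have lin (c : R) : 0 < c -> (fun n : nat => n%:R * c) @ \oo --> +oo.
  move=> c0; apply/cvgryPge => M; near=> n.
  rewrite -ler_pdivrMr//; near: n; exact: nbhs_infty_ger.
have [ax|xa] := ltP a x; last first.
  apply: cvg_near_cst; apply: nearW => n.
  by rewrite flat1_le0 ?mul0r// -mulrBr mulr_ge0_le0// subr_le0.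
have c1 : (fun n : nat => flat 1 (n%:R * x + - (n%:R * a))) @ \oo --> (1 : R).
  apply: flat1_cvg; under eq_fun do rewrite -mulrBr.
  by apply: lin; rewrite subr_gt0.
have [xb|bx] := leP x b.
  rewrite -[true%:R]mulr1; apply: cvgM => //.
  apply: flat1_cvg; apply/cvgryPge => M; near=> n.
  have nM : M <= n%:R by near: n; exact: nbhs_infty_ger.
  apply: (le_trans nM); rewrite addrA lerDr addrC mulNr -mulrBr.
  by rewrite mulr_ge0 ?sqr_ge0// subr_ge0.
apply: cvg_near_cst; near=> n.
rewrite (@flat1_le0 _ (- n%:R ^+ 2 * _ + _)) ?mulr0//.
have h : 1 / (x - b) <= n%:R by near: n; exact: nbhs_infty_ger.
rewrite ler_pdivrMr ?subr_gt0// in h.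
have : n%:R * 1 <= n%:R * (n%:R * (x - b)) :> R by rewrite ler_wpM2l.
by rewrite mulr1 mulrA -expr2; lra.
Unshelve. all: by end_near. Qed.

Lemma indic_ocboxE a b y :
  \1_(ocbox a b) y = \prod_(k < 3) (co k a < co k y <= co k b)%R%:R :> R.
Proof.
rewrite !big_ord_recl big_ord0 mulr1 /co /crd !mxE/= -!natrM !mulnb indicE.
congr (_%:R); congr nat_of_bool; apply/idP/idP.
  by rewrite inE => /ocboxE[-> -> ->].
by move=> /and3P[h1 h2 h3]; rewrite inE; apply/ocboxE.
Qed.

Lemma boxbump_cvg a b y : boxbump a b n y @[n --> \oo] --> (\1_(ocbox a b) y : R).
Proof.
rewrite indic_ocboxE /boxbump.
under [X in X @ _]eq_fun do rewrite !big_ord_recl big_ord0.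
rewrite !big_ord_recl big_ord0.
by do ! (apply: cvgM; first exact: ramp_cvg); exact: cvg_cst.
Qed.

End Smooth.

(** * Integration by parts and the fundamental lemma *)

Section TestFunctions.
Variable R : realType.
Local Notation mu := (@leb3 R).
Implicit Types (y v : E3 R) (f g p q : E3 R -> R).

Lemma test_continuous p : test_fun p -> continuous p.
Proof. by move=> [/(_ [::])[]]. Qed.

Lemma test_derivable p j y : test_fun p -> derivable p y (evec R j).
Proof. by move=> [/(_ [::])[_ +] _]. Qed.

Lemma test_partial_continuous p j : test_fun p -> continuous (partial j p).
Proof. by move=> [/(_ [:: j])[]]. Qed.

Lemma test_box p : test_fun p -> exists N, forall y, ~ box N y ->
  p y = 0 /\ forall j, partial j p y = 0.
Proof.
move=> [_ /compact_box_sub[N HN]]; exists N => y ny.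
have yc : ~ closure [set y | p y != 0] y by move=> /HN.
have y0 : \near y, 0 = p y.
  have : nbhs y (~` closure [set y | p y != 0]).
    by apply: open_nbhs_nbhs; split => //; apply: closed_openC; exact: closed_closure.
  apply: filterS => z nz; apply/esym; apply: contrapT => /eqP pz.
  by apply: nz; apply: subset_closure.
split; first by rewrite -(nbhs_singleton y0).
move=> j; have D := near_eq_is_derive y0 (is_derive_cst (0 : R) y (evec R j)).
by rewrite /partial (@derive_val _ _ _ _ _ _ _ D).
Qed.

Lemma test_bbs p : test_fun p -> bbs p.
Proof.
move=> tp; have [N HN] := test_box tp.
by apply: (@bbs_continuous _ _ N); [exact: test_continuous|move=> y /HN[]].
Qed.

Lemma test_partial_bbs p j : test_fun p -> bbs (partial j p).
Proof.
move=> tp; have [N HN] := test_box tp.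
by apply: (@bbs_continuous _ _ N); [exact: test_partial_continuous|move=> y /HN[]].
Qed.

Lemma continuous_aff b (c : E3 R) : continuous (aff b c).
Proof.
have H1 (bb : bool) (cc : R) (u : E3 R -> R) : continuous u ->
    continuous (fun y : E3 R => (-1) ^+ bb * u y + cc).
  move=> cu y; apply: cvgD; last exact: cvg_cst.
  by apply: cvgM; [exact: cvg_cst|exact: cu].
have a1 : continuous (fun y : E3 R => aff1 b c.1.1 y.1.1 : R).
  have := @H1 b c.1.1 _ (@continuous_co R (@Ordinal 3 0 isT)).
  by rewrite /aff1 (_ : co _ = fun y => y.1.1)//; apply/funext => y; rewrite /co /crd mxE.
have a2 : continuous (fun y : E3 R => aff1 b c.1.2 y.1.2 : R).
  have := @H1 b c.1.2 _ (@continuous_co R (@Ordinal 3 1 isT)).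
  by rewrite /aff1 (_ : co _ = fun y => y.1.2)//; apply/funext => y; rewrite /co /crd mxE.
have a3 : continuous (fun y : E3 R => aff1 b c.2 y.2 : R).
  have := @H1 b c.2 _ (@continuous_co R (@Ordinal 3 2 isT)).
  by rewrite /aff1 (_ : co _ = fun y => y.2)//; apply/funext => y; rewrite /co /crd mxE.
move=> y; rewrite /aff.
have a12 : (fun y : E3 R => (aff1 b c.1.1 y.1.1, aff1 b c.1.2 y.1.2)) @ y -->
   (aff1 b c.1.1 y.1.1, aff1 b c.1.2 y.1.2).
  exact: (cvg_pair (a1 y) (a2 y)).
exact: (cvg_pair a12 (a3 y)).
Qed.

Lemma partial_aff b c f j : (forall y, derivable f y (evec R j)) ->
  (forall y, derivable (fun z => f (aff b c z)) y (evec R j)) /\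
  partial j (fun z => f (aff b c z)) = fun z => (-1) ^+ b * partial j f (aff b c z).
Proof.
move=> df; have D y := is_derive_aff (derivableP (df (aff b c y))).
split=> [y|]; first by have [] := D y.
by apply/funext => y; rewrite /partial (@derive_val _ _ _ _ _ _ _ (D y)).
Qed.

Lemma smooth_aff b c f : smooth f -> smooth (fun z => f (aff b c z)).
Proof.
move=> sf s.
suff -> : foldr (@partial R) (fun z => f (aff b c z)) s =
    fun z => (-1) ^+ (b * size s) * foldr (@partial R) f s (aff b c z).
  have [cfs dfs] := sf s; split.
    move=> y; apply: cvgM; first exact: cvg_cst.
    apply: (@continuous_comp _ _ _ (aff b c)); first exact: continuous_aff.
    exact: cfs.
  move=> j y; have [d _] := partial_aff b c (dfs j).
  by apply: derivableM => //; exact: derivable_cst.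
elim: s => [|j s IH] /=; first by rewrite muln0 expr0; apply/funext => z; rewrite mul1r.
rewrite IH.
have [cfs dfs] := sf s; have [d E] := partial_aff b c (dfs j).
apply/funext => z.
have : partial j (fun z => (-1) ^+ (b * size s) * foldr (@partial R) f s (aff b c z)) z =
  (-1) ^+ (b * size s) * partial j (fun z => foldr (@partial R) f s (aff b c z)) z.
  by rewrite /partial (deriveZ ((-1) ^+ (b * size s)) (d z)).
move=> ->; rewrite E mulrA -exprD; congr (_ * _).
by rewrite mulnS addnC.
Qed.

Lemma test_aff b c p : test_fun p -> test_fun (fun z => p (aff b c z)).
Proof.
move=> tp; have [N HN] := test_box tp; have [m hm] := box_aff b c N.
apply: (@test_funI _ _ m); first by apply: smooth_aff; case: tp.
by move=> y ny; have [] // := HN (aff b c y); move=> /hm.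
Qed.

Lemma test_partial_aff b c p j : test_fun p ->
  partial j (fun z => p (aff b c z)) = fun z => (-1) ^+ b * partial j p (aff b c z).
Proof. by move=> tp; apply: (partial_aff b c _).2 => y; exact: test_derivable. Qed.

(** Difference quotients have integral zero by translation invariance. The mean value theorem bounds
    them by the supremum of the derivative, and dominated convergence passes to the limit; no
    iterated integral is needed. *)
Lemma I3_partial_eq0 f j N : continuous f -> (forall y, derivable f y (evec R j)) ->
  continuous (partial j f) -> (forall y, ~ box N y -> f y = 0 /\ partial j f y = 0) ->
  I3 (partial j f) = 0.
Proof.
move=> cf df cdf fN.
have bf : bbs f by apply: (@bbs_continuous _ _ N) => // y /fN[].
have bdf : bbs (partial j f) by apply: (@bbs_continuous _ _ N) => // y /fN[].
have [M HM] := bbs_bounded bdf.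
have M0 : 0 <= M by apply: le_trans (HM 0).
pose h (n : nat) : R := n.+1%:R^-1.
have h0 n : 0 < h n by rewrite invr_gt0.
pose g n y := (h n)^-1 * (f (aff false (h n *: evec R j) y) - f y).
have affE n y : aff false (h n *: evec R j) y = h n *: evec R j + y.
  by rewrite addrC; case: y => -[y1 y2] y3; rewrite /aff /aff1 /= !expr0 !mul1r.
have Ig n : I3 (g n) = 0.
  rewrite /g I3Z; last by apply: intgB; [apply: intg_aff|]; exact: bbs_intg.
  rewrite I3B; [|by apply: intg_aff; exact: bbs_intg|exact: bbs_intg].
  by rewrite I3_aff ?subrr ?mulr0//; exact: bbs_intg.
(* The increments [h n] are at most 1, so a point where [g n] does not vanish has norm at most
   [N + 1]. One more unit is spent on the strict inequality in [norm_lt_box]. *)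
have gM n y : `|g n y| <= M * \1_(box N.+2) y.
  rewrite indicE; case: (boolP (y \in box N.+2)) => yN; last first.
    have ny : ~ box N.+2 y by move=> H; rewrite mem_set in yN.
    have far z : `|y - z| <= 1 -> ~ box N z.
      move=> yz /box_norm zN; apply: ny; apply: norm_lt_box.
      rewrite -(subrK z y); apply: (le_lt_trans (ler_normD _ _)).
      by rewrite -addn2 natrD; apply: (@le_lt_trans _ _ (1 + N%:R)); [exact: lerD|lra].
    rewrite /g (fN y _).1; last by apply: far; rewrite subrr normr0.
    rewrite (fN _ _).1 ?subrr ?mulr0 ?normr0//.
    apply: far; rewrite affE opprD addrCA subrr addr0 normrN normrZ.
    rewrite (ger0_norm (ltW (h0 n))) mulr_ile1 ?(ltW (h0 n))//.
      by rewrite /h invf_le1// ler1n.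
    by rewrite norm3E /= !ger0_norm// !ge_max; do 3 case: (_ == _); rewrite ?lexx ?ler01.
  rewrite mulr1 /g affE normrM normfV ler_pdivrMl ?normr_gt0 ?gt_eqF//.
  pose phi (t : R) := f (t *: evec R j + y).
  have D t : is_derive t (1 : R) phi (partial j f (t *: evec R j + y)).
    by apply/is_derive_line; apply: derivableP; exact: df.
  have [] := @MVT R phi (fun t => partial j f (t *: evec R j + y)) 0 (h n) (h0 n).
  - by apply: derivable_within_continuous => x _; have [] := D x.
  move=> c _; rewrite /phi scale0r add0r subr0 => ->.
  by rewrite normrM mulrC ler_wpM2l.
have gcv y : g n y @[n --> \oo] --> partial j f y.
  have /cvg_ex[l Hl] := df y.
  have E : partial j f y = l by rewrite /partial /derive; apply: cvg_lim => //.
  have hcv : h n @[n --> \oo] --> (0 : R) by exact: cvg_harmonic.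
  rewrite E; have := (cvgr_dnbhsP _ _ _).1 Hl h (conj (fun n => lt0r_neq0 (h0 n)) hcv).
  by under eq_fun do rewrite /= -affE.
have mg n : measurable_fun setT (g n).
  apply: measurable_funM => //; apply: measurable_funB; last by case: bf.
  by case: (bbs_aff false (h n *: evec R j) bf).
have [_ H] := I3_dct mg (continuous_measurable3 cdf) gcv (intgZ M (@intg_box R N.+2)) gM.
have H0 : (fun n => I3 (g n)) @ \oo --> (0 : R).
  by rewrite (_ : (fun n => _) = fun=> 0); [exact: cvg_cst|apply/funext].
exact: (cvg_unique _ H H0).
Qed.

Definition C1 f := continuous f /\
  forall j, (forall y, derivable f y (evec R j)) /\ continuous (partial j f).

Lemma test_C1 p : test_fun p -> C1 p.
Proof.
move=> tp; split; first exact: test_continuous.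
by move=> j; split => [y|]; [exact: test_derivable|exact: test_partial_continuous].
Qed.

Lemma partial_cst (r : R) j : partial j (fun _ : E3 R => r) = fun=> 0.
Proof. by apply/funext => y; rewrite /partial derive_cst. Qed.

Lemma C1_cst (r : R) : C1 (fun=> r).
Proof.
split; first by move=> y; exact: cvg_cst.
by move=> j; split => [y|]; [exact: derivable_cst|rewrite partial_cst => y; exact: cvg_cst].
Qed.

Lemma co_is_derive (k j : 'I_3) y : is_derive y (evec R j) (@co R k) ((k == j)%:R).
Proof.
have := @is_derive_coord R id k j 1 0 1 y (is_derive_id _ _).
rewrite !mul1r (_ : (fun z => _) = @co R k)//.
by apply/funext => z; rewrite mul1r addr0.
Qed.

Lemma partial_co (k j : 'I_3) : partial j (@co R k) = fun=> (k == j)%:R.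
Proof. by apply/funext => y; exact: (@derive_val _ _ _ _ _ _ _ (co_is_derive k j y)). Qed.

Lemma C1_co k : C1 (@co R k).
Proof.
split; first exact: continuous_co.
move=> j; split => [y|]; first by have [] := co_is_derive k j y.
by rewrite partial_co => y; exact: cvg_cst.
Qed.

Lemma I3_by_parts f p j : C1 f -> test_fun p ->
  I3 (fun y => f y * partial j p y) = - I3 (fun y => partial j f y * p y).
Proof.
move=> [cf /(_ j)[df cdf]] tp; have [N HN] := test_box tp.
have cp := test_continuous tp.
have dp y : derivable p y (evec R j) by exact: test_derivable.
have cdp : continuous (partial j p) by exact: test_partial_continuous.
have cM (u v : E3 R -> R) : continuous u -> continuous v -> continuous (fun y => u y * v y).
  by move=> cu cv y; apply: cvgM; [exact: cu|exact: cv].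
have E : partial j (fun y => f y * p y) = fun y => f y * partial j p y + partial j f y * p y.
  by apply/funext => y; rewrite /partial deriveM// /GRing.scale/= (mulrC (p y)).
have i1 : intg (fun y => f y * partial j p y).
  apply: bbs_intg; apply: (@bbs_continuous _ _ N); first exact: cM.
  by move=> y /HN[_ ->]; rewrite mulr0.
have i2 : intg (fun y => partial j f y * p y).
  apply: bbs_intg; apply: (@bbs_continuous _ _ N); first exact: cM.
  by move=> y /HN[-> _]; rewrite mulr0.
apply/eqP; rewrite -addr_eq0 -I3D// -E; apply/eqP.
apply: (@I3_partial_eq0 _ _ N).
- exact: cM.
- by move=> y; apply: derivableM.
- rewrite E => y; apply: cvgD; exact: cM.
- by move=> y /HN[p0 dp0]; rewrite E p0 dp0 !mulr0 addr0.
Qed.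

Lemma I3_partial_test p j : test_fun p -> I3 (partial j p) = 0.
Proof.
move=> tp; have := @I3_by_parts _ _ j (C1_cst 1) tp.
rewrite partial_cst; under eq_fun do rewrite mul1r.
by move=> ->; under eq_fun do rewrite mul0r; rewrite I3_0 oppr0.
Qed.

Lemma I3_co_partial p k j : test_fun p ->
  I3 (fun y => co k y * partial j p y) = - ((k == j)%:R * I3 p).
Proof.
move=> tp; rewrite I3_by_parts//; last exact: C1_co.
by rewrite partial_co I3Z//; apply: bbs_intg; exact: test_bbs.
Qed.

(** The bumps [boxbump] give zero integral over every half-open box. The criterion [weak_null] then
    tests [f] against [f] itself, so that the integral of [f^2] over each [box N] is zero. *)
Lemma fundamental_lemma f : L2b f ->
  (forall p, test_fun p -> I3 (fun y => f y * p y) = 0) ->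
  {ae mu, forall y, f y = 0}.
Proof.
move=> hf Hf.
have box0 a b : I3 (fun y => \1_(ocbox a b) y * f y) = 0.
  have [m hm] := boxbump_support a b.
  have bb : bbs (\1_(box m) : E3 R -> R).
    exact: (bbs_indic (@measurable_box R m) (@subset_refl _ (@box R m))).
  have [] := @I3_dct R (fun n y => boxbump a b n y * f y) (fun y => \1_(ocbox a b) y * f y)
     (fun y => `|\1_(box m) y * f y|).
  - move=> n; apply: measurable_funM; last by case: hf.
    by have [] := test_bbs (boxbump_test a b n).
  - apply: measurable_funM; last by case: hf.
    by apply: measurable_indic; exact: measurable_ocbox.
  - by move=> y; apply: cvgM; [exact: boxbump_cvg|exact: cvg_cst].
  - by apply: intg_norm; exact: bbs_L2b.
  - move=> n y; rewrite !normrM ler_wpM2r//.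
    have /andP[b0 b1] := boxbump01 a b n y.
    rewrite (ger0_norm b0) indicE; case: (boolP (y \in box m)) => yb.
      by rewrite normr1.
    by rewrite hm ?normr0// => H; rewrite mem_set in yb.
  move=> _ H.
  have H0 : (fun n => I3 (fun y => boxbump a b n y * f y)) @ \oo --> (0 : R).
    rewrite (_ : (fun n => _) = fun=> 0); first exact: cvg_cst.
    apply/funext => n; rewrite -(Hf _ (boxbump_test a b n)); congr I3.
    by apply/funext => y; rewrite mulrC.
  exact: (cvg_unique _ H H0).
have ae0 N : {ae mu, forall y, \1_(box N) y * f y ^+ 2 = 0}.
  apply: I3_eq0.
  - by case: hf.
  - by move=> y; rewrite mulr_ge0 ?sqr_ge0//; have /andP[] := indic01 R (box N) y.
  have c0 a b : I3 (fun y => \1_(ocbox a b) y * f y) @[n --> \oo] --> (0 : R).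
    by rewrite box0; exact: cvg_cst.
  (* The sequence is constant, so its convergence to 0 says that the integral of [f^2] over [box N]
     is 0. *)
  have := @weak_null R (fun=> f) N _ (fun=> hf) (fun=> lexx _) c0 f hf.
  set v := I3 _ => H.
  have H1 : (fun _ : nat => v) @ \oo --> (v : R) by exact: cvg_cst.
  exact: (cvg_unique _ H1 H).
have : {ae mu, forall y, forall N, \1_(box N) y * f y ^+ 2 = 0} by exact/ae_foralln.
apply: filterS => y H; have [N yN] := ex_nat_gt `|y|.
have := H N; rewrite indicE mem_set ?mul1r; last by apply: norm_lt_box; rewrite normr_id in yN.
by move/eqP; rewrite sqrf_eq0 => /eqP.
Qed.

End TestFunctions.

(** * The lattice and its unit cell *)

Section Lattice.
Variables (R : realType) (a : 'I_3 -> E3 R).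
Hypothesis ha : lin_indep3 a.
Local Notation box := (@box R).
Implicit Types (y z : E3 R) (f g : E3 R -> R) (i k : 'I_3).

Lemma co_inj y z : (forall k, co k y = co k z) -> y = z.
Proof.
move=> H; have := (H (@Ordinal 3 0 isT), H (@Ordinal 3 1 isT), H (@Ordinal 3 2 isT)).
rewrite /co /crd !mxE /=; case: y {H} => -[y1 y2] y3; case: z => -[z1 z2] z3 /=.
by move=> [[-> ->] ->].
Qed.

Lemma coD k y z : co k (y + z) = co k y + co k z.
Proof. by rewrite /co /crd !mxE; case: k => -[|[|[|//]]] hk. Qed.

Lemma coZ k (r : R) y : co k (r *: y) = r * co k y.
Proof. by rewrite /co /crd !mxE; case: k => -[|[|[|//]]] hk. Qed.

Lemma co0 k : co k (0 : E3 R) = 0.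
Proof. by rewrite /co /crd !mxE; case: k => -[|[|[|//]]] hk. Qed.

Lemma co_sum k (J : Type) (s : seq J) (F : J -> E3 R) :
  co k (\sum_(j <- s) F j) = \sum_(j <- s) co k (F j).
Proof. by apply: (big_morph (@co R k)); [exact: coD|exact: co0]. Qed.

Definition amx : 'M[R]_3 := \matrix_(i, k) co k (a i).

Lemma amx_unit : amx \in unitmx.
Proof.
rewrite -row_free_unit; apply: inj_row_free => v v0.
apply/rowP => i; rewrite mxE; apply: (ha (s := fun i => v 0 i)).
apply: co_inj => k; rewrite co0 co_sum.
transitivity ((v *m amx) 0 k); last by rewrite v0 mxE.
by rewrite mxE; apply: eq_bigr => j _; rewrite coZ mxE.
Qed.

(** The coordinates of [y] in the basis [a]: the row of Cartesian coordinates times the inverse of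
    the matrix whose rows are the vectors [a i]. *)
Definition sc i y : R := \sum_k co k y * invmx amx k i.

Lemma scD i y z : sc i (y + z) = sc i y + sc i z.
Proof. by rewrite /sc -big_split/=; apply: eq_bigr => k _; rewrite coD mulrDl. Qed.

Lemma scZ i (r : R) y : sc i (r *: y) = r * sc i y.
Proof. by rewrite /sc mulr_sumr; apply: eq_bigr => k _; rewrite coZ mulrA. Qed.

Lemma sc0 i : sc i 0 = 0.
Proof. by rewrite /sc big1// => k _; rewrite co0 mul0r. Qed.

Lemma scN i y : sc i (- y) = - sc i y.
Proof. by rewrite -scaleN1r scZ mulN1r. Qed.

Lemma sc_sum i (J : Type) (s : seq J) (F : J -> E3 R) :
  sc i (\sum_(j <- s) F j) = \sum_(j <- s) sc i (F j).
Proof. by apply: (big_morph (sc i)); [exact: scD|exact: sc0]. Qed.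

Lemma sc_a i j : sc i (a j) = (j == i)%:R.
Proof.
transitivity ((amx *m invmx amx) j i); last by rewrite mulmxV ?amx_unit// mxE.
by rewrite mxE; apply: eq_bigr => k _; rewrite mxE.
Qed.

Lemma sc_comb i (c : 'I_3 -> R) : sc i (\sum_j c j *: a j) = c i.
Proof.
rewrite sc_sum (bigD1 i)//= big1 => [|j ji]; rewrite scZ sc_a ?eqxx ?mulr1 ?addr0//.
by rewrite (negbTE ji) mulr0.
Qed.

Lemma sc_expand y : y = \sum_i sc i y *: a i.
Proof.
apply: co_inj => k; rewrite co_sum.
pose w : 'rV[R]_3 := \row_k co k y.
transitivity ((w *m invmx amx *m amx) 0 k); first by rewrite mulmxKV ?amx_unit// mxE.
rewrite mxE; apply: eq_bigr => i _; rewrite coZ !mxE; congr (_ * _).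
by apply: eq_bigr => l _; rewrite mxE.
Qed.

Lemma sc_bound : exists2 L : R, 0 < L & forall i y, `|sc i y| <= L * `|y|.
Proof.
exists (1 + \sum_i \sum_k `|invmx amx k i|).
  by rewrite ltr_pwDl// sumr_ge0// => i _; rewrite sumr_ge0.
move=> i y; apply: (le_trans (ler_norm_sum _ _ _)).
apply: (@le_trans _ _ (\sum_k `|y| * `|invmx amx k i|)).
  by apply: ler_sum => k _; rewrite normrM ler_wpM2r// co_norm.
rewrite -mulr_sumr mulrC ler_wpM2r// [leRHS](_ : _ = \sum_k `|invmx amx k i| +
  (1 + \sum_(j | j != i) \sum_k `|invmx amx k j|)); last first.
  by rewrite (bigD1 i)//= addrCA.
rewrite lerDl.
by rewrite addr_ge0// sumr_ge0// => j _; rewrite sumr_ge0.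
Qed.

Lemma measurable_co k : measurable_fun [set: E3 R] (@co R k).
Proof. exact: continuous_measurable3 (@continuous_co R k). Qed.

Lemma measurable_sc i : measurable_fun [set: E3 R] (sc i).
Proof. by apply: measurable_sum => k; apply: measurable_funM => //; exact: measurable_co. Qed.

Definition tl (n : {ffun 'I_3 -> int}) : E3 R := \sum_i a i *~ n i.

Lemma lattice3P t : lattice3 a t <-> exists n, t = tl n.
Proof.
split=> [[n ->]|[n ->]]; last by exists n.
by exists (finfun n); rewrite /tl; apply: eq_bigr => i _; rewrite ffunE.
Qed.

Lemma tlD m n : tl (m + n) = tl m + tl n.
Proof. by rewrite /tl -big_split/=; apply: eq_bigr => i _; rewrite ffunE mulrzDr. Qed.

Lemma tlN m : tl (- m) = - tl m.
Proof. by rewrite /tl -sumrN; apply: eq_bigr => i _; rewrite ffunE mulrNz. Qed.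

Lemma sc_tl i n : sc i (tl n) = (n i)%:~R.
Proof.
rewrite /tl -(sc_comb i (fun j => (n j)%:~R)); congr sc; apply: eq_bigr => j _.
by rewrite scaler_int.
Qed.

(** Half-open so that every point lies in exactly one lattice translate, the one given by the
    integer parts of its coordinates. It differs from the closed cell by a null set
    ([cell_hcell_ae]). *)
Definition hcell : set (E3 R) := [set y | forall i, 0 <= sc i y < 1].

Lemma cellE : cell a = [set y | forall i, 0 <= sc i y <= 1].
Proof.
apply/seteqP; split => y.
  by move=> [s hs ->] i; rewrite sc_comb.
by move=> H; exists (sc^~ y); [exact: H|exact: sc_expand].
Qed.

Lemma hcell_sub_cell : hcell `<=` cell a.
Proof. by move=> y H; rewrite cellE => i; have /andP[-> /ltW ->] := H i. Qed.

Lemma measurable_sc_itv (I : interval R) : measurable [set y | forall i, sc i y \in I].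
Proof.
rewrite (_ : [set y | _] = \bigcap_(i in [set: 'I_3]) (sc i @^-1` [set` I])).
  apply: fin_bigcap_measurable => // i _.
  by rewrite -[X in measurable X]setTI; apply: measurable_sc.
by apply/seteqP; split => y H i; [move=> _|]; exact: H.
Qed.

Lemma measurable_hcell : measurable hcell.
Proof.
rewrite (_ : hcell = [set y | forall i, sc i y \in `[0, 1[]); first exact: measurable_sc_itv.
by apply/seteqP; split => y H i; have := H i; rewrite in_itv.
Qed.

Lemma measurable_cell : measurable (cell a).
Proof.
rewrite cellE (_ : [set y | _] = [set y | forall i, sc i y \in `[0, 1]]); first exact: measurable_sc_itv.
by apply/seteqP; split => y H i; have := H i; rewrite in_itv.
Qed.

Lemma sc_ball_box (r : R) : exists N, forall y, (forall i, `|sc i y| <= r) -> box N y.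
Proof.
have [N HN] := ex_nat_gt (\sum_i `|r| * `|a i|); exists N => y Hy.
apply: norm_lt_box; apply: le_lt_trans HN; rewrite (sc_expand y).
apply: (le_trans (ler_norm_sum _ _ _)); apply: le_trans (ler_norm _).
by apply: ler_sum => i _; rewrite normrZ ler_wpM2r// (le_trans (Hy i))// ler_norm.
Qed.

Lemma cell_box : exists N, cell a `<=` box N.
Proof.
have [N HN] := sc_ball_box 1; exists N => y; rewrite cellE => Hy; apply: HN => i.
by have /andP[h0 h1] := Hy i; rewrite ger0_norm.
Qed.

Lemma bbs_hcell : bbs (\1_hcell : E3 R -> R).
Proof.
have [N HN] := cell_box; apply: (bbs_indic measurable_hcell).
exact: subset_trans hcell_sub_cell HN.
Qed.

Lemma bbs_cell : bbs (\1_(cell a) : E3 R -> R).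
Proof. by have [N HN] := cell_box; exact: (bbs_indic measurable_cell HN). Qed.

Definition flr y : {ffun 'I_3 -> int} := [ffun i => Num.floor (sc i y)].

Lemma hcell_flr y n : hcell (y - tl n) <-> n = flr y.
Proof.
split=> [H|->].
  apply/ffunP => i; rewrite ffunE; have := H i; rewrite scD scN sc_tl => h.
  by apply/esym/floor_def; rewrite intrD; lra.
move=> i; rewrite scD scN sc_tl ffunE.
by have /andP[] := floor_itv (sc i y); rewrite intrD; lra.
Qed.

End Lattice.

Section Ae.
Variable R : realType.
Implicit Types P Q : E3 R -> Prop.

Lemma ae_imp P Q : (forall y, P y -> Q y) ->
  {ae @leb3 R, forall y, P y} -> {ae @leb3 R, forall y, Q y}.
Proof. by move=> PQ; apply: filterS => y /PQ. Qed.

Lemma ae_imp2 P1 P2 Q : (forall y, P1 y -> P2 y -> Q y) ->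
  {ae @leb3 R, forall y, P1 y} -> {ae @leb3 R, forall y, P2 y} ->
  {ae @leb3 R, forall y, Q y}.
Proof. by move=> PQ; apply: filterS2 => y /PQ; apply. Qed.

End Ae.

(** * Periodization, and unfolding of integrals over the cell *)

Section Periodization.
Variables (R : realType) (a : 'I_3 -> E3 R).
Hypothesis ha : lin_indep3 a.
Local Notation mu := (@leb3 R).
Local Notation box := (@box R).
Local Notation Z3 := ({ffun 'I_3 -> int}).
Implicit Types (y z : E3 R) (f g p : E3 R -> R) (i k : 'I_3) (n : Z3).
Local Notation sc := (sc a).
Local Notation tl := (tl a).
Local Notation hcell := (hcell a).

Lemma aff_add y z : aff false z y = y + z.
Proof. by case: y => -[y1 y2] y3; rewrite /aff /aff1 !expr0 !mul1r. Qed.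

Lemma aff_sub y z : aff true z y = z - y.
Proof.
rewrite addrC; case: y => -[y1 y2] y3; rewrite /aff /aff1 !expr1 !mulN1r.
by case: z => -[z1 z2] z3.
Qed.

(** The translates of the face by [a i / (m + 1)] lie in distinct parallel planes, hence are
    disjoint, and all stay in one box. Any number [N] of them fits, so [N] times the measure of the
    face is bounded independently of [N]. *)
Lemma face_null i : I3 (\1_(cell a `&` [set y | sc i y = 1]) : E3 R -> R) = 0.
Proof.
set Z := _ `&` _.
have mZ : measurable Z.
  apply: measurableI; first exact: measurable_cell.
  by have := @measurable_sc R a i measurableT _ (measurable_set1 1); rewrite setTI.
have ZY : Z `<=` cell a by move=> y [].
have [N0 HN0] := cell_box ha.
have bZ : bbs (\1_Z : E3 R -> R) by apply: (bbs_indic mZ (subset_trans ZY HN0)).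
(* A point of the cell has lattice coordinates in [[0, 1]] and the shift adds at most 1 to one of
   them. *)
have [K HK] := sc_ball_box ha 2.
pose h (m : nat) : R := m.+1%:R^-1.
have h0 m : 0 < h m by rewrite invr_gt0.
have h1 m : h m <= 1 by rewrite invf_le1// ler1n.
pose s m y : R := \1_Z (aff false (- (h m *: a i)) y).
have sP m y : s m y != 0 -> s m y = 1 /\ [/\ sc i y = 1 + h m & box K y].
  rewrite /s indicE; case: (boolP (_ \in Z)); rewrite ?eqxx// inE aff_add => -[+ + _].
  rewrite cellE// => yY; rewrite /= scD scN scZ sc_a// eqxx mulr1 => yi.
  split => //; split; first by rewrite -yi subrK.
  apply: HK => j; have := yY j; rewrite scD scN scZ sc_a//.
  have := h0 m; have := h1 m; case: (i == j) => /=; rewrite ?mulr1 ?mulr0 ler_norml; lra.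
have H N : N%:R * I3 (\1_Z) <= I3 (\1_(box K)).
  have -> : N%:R * I3 (\1_Z) = I3 (fun y => \sum_(m < N) s m y).
    rewrite I3_sum; last by move=> m; apply: bbs_intg; exact: bbs_aff.
    under eq_bigr do rewrite /s I3_aff ?bbs_intg//.
    by rewrite sumr_const card_ord mulr_natl.
  apply: I3_le; first by apply: intg_sum => m; apply: bbs_intg; exact: bbs_aff.
    exact: intg_box.
  move=> y.
  have [[m sm]|/forallNP H] := pselect (exists m : 'I_N, s m y != 0); last first.
    rewrite big1 => [|m _]; first by have /andP[] := indic01 R (box K) y.
    by have := H m; case: eqP.
  have [sm1 [im bm]] := sP _ _ sm; rewrite (bigD1 m)//= big1 => [|m' mm'].
    by rewrite sm1 addr0 indicE mem_set.
  apply/eqP/negPn/negP => sm'; have [_ [im' _]] := sP _ _ sm'.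
  move: im'; rewrite im => /addrI/invr_inj/eqP; rewrite eqr_nat eqSS => /eqP E.
  by move/eqP: mm'; apply; apply: val_inj.
have c0 : 0 <= I3 (\1_Z : E3 R -> R).
  by apply: I3_ge0 => y; have /andP[] := indic01 R Z y.
apply/eqP; rewrite eq_le c0 andbT leNgt; apply/negP => c1.
have [N] := ex_nat_gt (I3 (\1_(box K)) / I3 (\1_Z)).
move=> /(le_lt_trans (ler_norm _)); rewrite ltr_pdivrMr// => /lt_le_trans/(_ (H N)).
by rewrite ltxx.
Qed.

Lemma cell_hcell_ae : {ae mu, forall y, \1_(cell a) y = \1_hcell y :> R}.
Proof.
have : {ae mu, forall y, forall i, \1_(cell a `&` [set y | sc i y = 1]) y = 0 :> R}.
  apply: filter_forall => i; apply: I3_eq0; last exact: face_null.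
    apply: bbs_intg; have [N0 HN0] := cell_box ha.
    apply: (@bbs_indic _ _ N0).
      apply: measurableI; first exact: measurable_cell.
      by have := @measurable_sc R a i measurableT _ (measurable_set1 1); rewrite setTI.
    by move=> y [/HN0].
  by move=> y; have /andP[] := indic01 R (cell a `&` [set y | sc i y = 1]) y.
apply: filterS => y H; rewrite !indicE; congr (_ %:R); congr nat_of_bool.
apply/idP/idP; rewrite !inE; last exact: hcell_sub_cell.
move=> yY i; have := yY; rewrite cellE// => /(_ i)/andP[-> y1] /=.
rewrite lt_neqAle y1 andbT; apply/eqP => yi.
have := H i; rewrite indicE mem_set; last by split.
by move/eqP; rewrite oner_eq0.
Qed.

(** A sum of finite support: the default value 0 for infinite support never occurs when [p] vanishes
    outside a box, since then finitely many translates of [y] meet that box. *)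
Definition per p y : R := \sum_(n \in [set: Z3]) p (y + tl n).

Definition nball (K : nat) : set Z3 := [set n | forall i, `|n i| <= K%:Z].

Lemma finite_nball K : finite_set (nball K).
Proof.
pose F (m : {ffun 'I_3 -> 'I_(K.*2.+1)}) : Z3 := [ffun i => (m i)%:Z - K%:Z].
apply: (@sub_finite_set _ _ (F @` setT)); last exact: finite_image.
move=> n Hn; exists [ffun i => inord (absz (n i + K%:Z))] => //.
apply/ffunP => i; rewrite !ffunE; have := Hn i; rewrite ler_norml => /andP[n1 n2].
have n0 : 0 <= n i + K%:Z by rewrite -lerBlDr sub0r.
rewrite inordK; last first.
  rewrite -ltz_nat (gez0_abs n0) -addnn.
  by apply: (@le_lt_trans _ _ (K + K)%N%:Z); [rewrite PoszD lerD2r|rewrite ltz_nat].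
by rewrite gez0_abs// addrK.
Qed.

Definition nseq3 K : seq Z3 := finmap.enum_fset (fset_set (nball K)).

Lemma big_nball K (F : Z3 -> R) : \sum_(n \in nball K) F n = \sum_(n <- nseq3 K) F n.
Proof. by rewrite fsbig_finite//; exact: finite_nball. Qed.

(** If [y] and [y + tl n] both lie in fixed boxes, then [tl n] is bounded, and so are its lattice
    coordinates [n]. The bound is uniform in [y], which turns [per] into a sum over one fixed finite
    set and allows its exchange with integrals. *)
Lemma far_translates p N M : (forall y, ~ box N y -> p y = 0) ->
  exists K0, forall K, (K0 <= K)%N -> forall y n, box M y -> ~ nball K n ->
    p (y + tl n) = 0.
Proof.
move=> pN; have [L L0 HL] := sc_bound a.
have [K0 HK0] := ex_nat_gt (L * (N%:R + M%:R)); exists K0 => K K0K y n yM nK.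
apply: pN => yN; apply: nK => i.
have h : `|sc i (tl n)| <= L * (N%:R + M%:R).
  apply: (le_trans (HL _ _)); rewrite ler_wpM2l ?(ltW L0)//.
  have -> : `|tl n| = `|(y + tl n) - y| by rewrite addrC addKr.
  apply: (le_trans (ler_normD _ _)); rewrite normrN.
  by apply: lerD; exact: box_norm.
rewrite sc_tl// in h; rewrite -(ler_int R) intr_norm.
apply: (le_trans h); apply: (le_trans (ler_norm _)); apply: (le_trans (ltW HK0)).
by rewrite -[leRHS]/((K%:R) : R) ler_nat.
Qed.

Lemma per_finite p y K : (forall n, ~ nball K n -> p (y + tl n) = 0) ->
  per p y = \sum_(n <- nseq3 K) p (y + tl n).
Proof.
move=> H; rewrite -big_nball /per; apply/esym/fsbig_widen => // n [_ /= nK].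
exact: H.
Qed.

Lemma per_finiteN p y K : (forall n, ~ nball K n -> p (y + tl n) = 0) ->
  per p y = \sum_(n <- nseq3 K) p (y - tl n).
Proof.
move=> H; rewrite -big_nball /per (@reindex_fsbigT _ _ _ _ _ (@GRing.opp Z3)); last first.
  by exists -%R; exact: opprK.
rewrite [RHS](eq_fsbigr (fun n => p (y + tl (- n)))); last by move=> n _; rewrite tlN.
apply/esym/fsbig_widen => // n [_ /= nK]; apply: H => nK'; apply: nK => i.
by have := nK' i; rewrite ffunE normrN.
Qed.

Lemma bbs_support p : bbs p -> exists N, forall y, ~ box N y -> p y = 0.
Proof.
move=> [_ [N [M H]]]; exists N => y ny; have := H y.
rewrite indicE memNset// mulr0 normr_le0 => /eqP; exact.
Qed.

Lemma per_tl p y n : per p (y + tl n) = per p y.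
Proof.
rewrite /per (@reindex_fsbigT _ _ _ _ _ (fun m : Z3 => n + m) (fun m => p (y + tl m))).
  by apply: eq_fsbigr => m _; rewrite tlD addrA.
by exists (fun m => - n + m) => m; rewrite ?addKr ?addNKr.
Qed.

(** The translates of the half-open cell tile space, so a single term, [n = - flr a (y - z)], is
    nonzero. The shift [z] expresses that every translate of the cell is again a fundamental
    domain. *)
Lemma per_indic_hcell z y : per (fun y => \1_hcell (y - z)) y = 1.
Proof.
rewrite /per -(fsbig_widen [set - flr a (y - z)]) => //.
  rewrite fsbig_set1 indicE mem_set// tlN addrAC; exact/hcell_flr.
move=> n [_ /= nn]; rewrite indicE memNset// => H; apply: nn.
apply/oppr_inj; rewrite opprK; apply/(hcell_flr ha); rewrite tlN opprK.
by rewrite -addrAC.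
Qed.

(** Local integrability in the form needed for products of two [L2b] functions, which need not be in
    [L2b] themselves. *)
Definition locint g := forall p, bbs p -> intg (fun y => p y * g y).

(** Space is cut into the translates of the half-open cell, and each piece is moved back to the
    cell, where periodicity leaves [g] unchanged almost everywhere. The sum of the moved copies of
    [p] is [per a p]. *)
Lemma unfolding p g : bbs p -> locint g -> Defs.periodic a g ->
  I3 (fun y => p y * g y) = I3 (fun y => \1_(cell a) y * (per p y * g y)).
Proof.
move=> bp lg pg; have [N pN] := bbs_support bp.
have bh := bbs_hcell ha; have [N1 hN1] := bbs_support bh.
have [K1 HK1] := far_translates N hN1.
have [K2 HK2] := far_translates N1 pN.
pose K := maxn K1 K2.
have {}HK1 := HK1 K (leq_maxl _ _); have {}HK2 := HK2 K (leq_maxr _ _).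
have i1 n : intg (fun y => \1_hcell (y + tl n) * p y * g y).
  apply: lg; rewrite (_ : (fun y => _) = (fun y => p y * \1_hcell (aff false (tl n) y))).
    apply: bbsM => //; first by case: (bbs_aff false (tl n) bh).
    by exists 1 => y; rewrite ger0_norm; have /andP[] := indic01 R hcell (aff false (tl n) y).
  by apply/funext => y; rewrite aff_add mulrC.
have -> : I3 (fun y => p y * g y) = I3 (fun y =>
    \sum_(n <- nseq3 K) \1_hcell (y + tl n) * p y * g y).
  congr I3; apply/funext => y; rewrite -!mulr_suml.
  have [yN|yN] := pselect (box N y); last by rewrite pN// mulr0 mul0r.
  rewrite -per_finite; last by move=> n nK; exact: HK1.
  by have := per_indic_hcell 0 y; under eq_fun do rewrite subr0; move=> ->; rewrite mul1r.
rewrite I3_sum//.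
have E n : I3 (fun y => \1_hcell (y + tl n) * p y * g y) =
    I3 (fun y => \1_hcell y * p (y - tl n) * g y).
  rewrite -(I3_aff false (- tl n)) //; apply: I3_ae.
  have /pg pgn : lattice3 a (- tl n) by apply/lattice3P; exists (- n); rewrite tlN.
  by apply: ae_imp pgn => y gy; rewrite aff_add subrK gy.
under eq_bigr do rewrite E.
rewrite -I3_sum; last first.
  move=> n; apply: lg; apply: bbsM => //.
    by case: (bbs_aff false (- tl n) bp) => + _; under eq_fun do rewrite aff_add.
  by have [M HM] := bbs_bounded bp; exists M.
apply: I3_ae; have := cell_hcell_ae; apply: filterS => y ->.
rewrite indicE; have [yh|yh] := boolP (y \in hcell); last first.
  by rewrite mul0r big1// => n _; rewrite !mul0r.
rewrite mul1r (@per_finiteN _ _ K).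
  by rewrite mulr_suml; apply: eq_bigr => n _; rewrite mul1r.
move=> n nK; apply: HK2 nK; apply: contrapT => /hN1; rewrite indicE yh.
by move/eqP; rewrite oner_eq0.
Qed.

(** Translation moves the shift onto the indicator of the half-open cell, whose periodization is
    still 1; [unfolding] then returns to the original cell. *)
Lemma I3_cell_translate g z : locint g -> Defs.periodic a g ->
  I3 (fun y => \1_(cell a) y * g (y + z)) = I3 (fun y => \1_(cell a) y * g y).
Proof.
move=> lg pg.
have bh := bbs_hcell ha.
have bq : bbs (fun y => \1_hcell (y - z)).
  have := bbs_aff false (- z) bh; congr bbs.
  by apply/funext => y; rewrite aff_add.
transitivity (I3 (fun y => \1_hcell y * g (y + z))).
  by apply: I3_ae; have := cell_hcell_ae; apply: filterS => y ->.
transitivity (I3 (fun y => \1_hcell (y - z) * g y)).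
  rewrite -[RHS](I3_aff false z); last exact: lg.
  by congr I3; apply/funext => y; rewrite aff_add addrK.
rewrite unfolding//; congr I3; apply/funext => y.
by rewrite per_indic_hcell mul1r.
Qed.

End Periodization.

(** * Weak gradients and periodic fields *)

Section WeakGradient.
Variable R : realType.
Local Notation mu := (@leb3 R).
Implicit Types (y z : E3 R) (f g p q : E3 R -> R) (u v : E3 R -> 'cV[R]_3)
  (U V : E3 R -> 'M[R]_3).

Lemma ae_forall_ord (n : nat) (P : E3 R -> 'I_n -> Prop) :
  (forall i, {ae mu, forall y, P y i}) -> {ae mu, forall y, forall i, P y i}.
Proof. by move=> H; apply: filter_forall. Qed.

Definition wgrad v V := forall i j, L2b (fun y => V y i j) /\
  forall p, test_fun p ->
    I3 (fun y => v y i 0 * partial j p y) = - I3 (fun y => V y i j * p y).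

Lemma wgradP v V : is_weak_grad v V <-> wgrad v V.
Proof.
split=> H i j; have [h1 h2] := H i j; split=> //; exact/L2locP.
Qed.

Lemma wgrad_unique v V V' : wgrad v V -> wgrad v V' ->
  {ae mu, forall y, V y = V' y}.
Proof.
move=> h h'.
have : {ae mu, forall y, forall i j, V y i j - V' y i j = 0}.
  apply: ae_forall_ord => i; apply: ae_forall_ord => j.
  have [L H] := h i j; have [L' H'] := h' i j.
  apply: fundamental_lemma; first exact: L2bB.
  move=> p tp; have bp := test_bbs tp.
  rewrite (_ : (fun y => _) = fun y => p y * V y i j - p y * V' y i j); last first.
    by apply/funext => y; ring.
  rewrite I3B; [|exact: bbs_L2b..].
  apply/eqP; rewrite subr_eq0; apply/eqP.
  have sw (W : E3 R -> 'M[R]_3) : I3 (fun y => p y * W y i j) = I3 (fun y => W y i j * p y).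
    by congr I3; apply/funext => y; rewrite mulrC.
  by rewrite !sw; apply: oppr_inj; rewrite -H// -H'.
apply: ae_imp => y H; apply/matrixP => i j; apply/eqP; rewrite -subr_eq0.
by rewrite H.
Qed.

Lemma wgrad_grad v V : wgrad v V -> wgrad v (grad v).
Proof.
move=> /wgradP h; apply/wgradP; rewrite /grad.
by apply: (@xgetPex _ (fun=> 0) [set V | is_weak_grad v V]); exists V.
Qed.

Lemma grad_ae v V : wgrad v V -> {ae mu, forall y, grad v y = V y}.
Proof. by move=> h; exact: (wgrad_unique (wgrad_grad h) h). Qed.

Definition symm (M : 'M[R]_3) : 'M[R]_3 := 2^-1 *: (M + M^T).

Lemma sgrad_ae v V : wgrad v V -> {ae mu, forall y, sgrad v y = symm (V y)}.
Proof. by move=> /grad_ae; apply: ae_imp => y E; rewrite /sgrad E. Qed.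

Lemma wgradD u v U V : (forall i, L2b (fun y => u y i 0)) ->
  (forall i, L2b (fun y => v y i 0)) -> wgrad u U -> wgrad v V ->
  wgrad (fun y => u y + v y) (fun y => U y + V y).
Proof.
move=> lu lv hu hv i j; have [LU HU] := hu i j; have [LV HV] := hv i j; split.
  by under eq_fun do rewrite mxE; exact: L2bD.
move=> p tp; have bp := test_bbs tp; have bdp := test_partial_bbs j tp.
have sp (f g h : E3 R -> R) : bbs h -> L2b f -> L2b g ->
    I3 (fun y => (f y + g y) * h y) = I3 (fun y => f y * h y) + I3 (fun y => g y * h y).
  move=> bh hf hg; rewrite -I3D.
  - by congr I3; apply/funext => y; rewrite mulrDl.
  - by have := bbs_L2b bh hf; congr intg; apply/funext => y; rewrite mulrC.
  - by have := bbs_L2b bh hg; congr intg; apply/funext => y; rewrite mulrC.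
under eq_fun do rewrite mxE; rewrite sp//.
by under [in RHS]eq_fun do rewrite mxE; rewrite sp// HU// HV// opprD.
Qed.

Lemma wgradZ (r : R) u U : (forall i, L2b (fun y => u y i 0)) -> wgrad u U ->
  wgrad (fun y => r *: u y) (fun y => r *: U y).
Proof.
move=> lu hu i j; have [LU HU] := hu i j; split.
  by under eq_fun do rewrite mxE; exact: L2bZ.
move=> p tp; have bp := test_bbs tp; have bdp := test_partial_bbs j tp.
have sp (f h : E3 R -> R) : bbs h -> L2b f ->
    I3 (fun y => (r * f y) * h y) = r * I3 (fun y => f y * h y).
  move=> bh hf; rewrite -I3Z.
    by congr I3; apply/funext => y; rewrite mulrA.
  by have := bbs_L2b bh hf; congr intg; apply/funext => y; rewrite mulrC.
under eq_fun do rewrite mxE; rewrite sp//.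
by under [in RHS]eq_fun do rewrite mxE; rewrite sp// HU// mulrN.
Qed.

Lemma wgrad_affine (A : 'M[R]_3) : wgrad (fun y => A *m crd y) (fun=> A).
Proof.
move=> i j; split; first exact: L2b_cst.
move=> p tp; have bdp := test_partial_bbs j tp; have bp := test_bbs tp.
have i1 k : intg (fun y => A i k * (co k y * partial j p y)).
  apply: intgZ; have := bbs_L2b bdp (L2b_continuous (@continuous_co R k)).
  by congr intg; apply/funext => y; rewrite mulrC.
transitivity (I3 (fun y => \sum_k A i k * (co k y * partial j p y))).
  congr I3; apply/funext => y; rewrite mxE mulr_suml.
  by apply: eq_bigr => k _; rewrite mulrA.
rewrite I3_sum// I3Z; last exact: bbs_intg.
rewrite -mulrN (bigD1 j)//= big1 => [|k kj]; rewrite I3Z ?I3_co_partial ?(negbTE kj) ?eqxx//.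
- by rewrite mul1r addr0.
- have := bbs_L2b bdp (L2b_continuous (@continuous_co R j)).
  by congr intg; apply/funext => y; rewrite mulrC.
- by rewrite mul0r oppr0 mulr0.
have := bbs_L2b bdp (L2b_continuous (@continuous_co R k)).
by congr intg; apply/funext => y; rewrite mulrC.
Qed.

Lemma wgrad_cst (c : 'cV[R]_3) : wgrad (fun=> c) (fun=> 0).
Proof.
move=> i j; split; first by under eq_fun do rewrite mxE; exact: L2b_cst.
move=> p tp; rewrite I3Z; last by apply: bbs_intg; exact: test_partial_bbs.
rewrite I3_partial_test// mulr0 (_ : (fun y => _) = fun=> 0) ?I3_0 ?oppr0//.
by apply/funext => y; rewrite mxE mul0r.
Qed.

Section Periodic.
Variable a : 'I_3 -> E3 R.
Hypothesis ha : lin_indep3 a.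

(** The translate of [V] by a lattice vector is again a weak gradient of [v], so uniqueness of weak
    gradients gives periodicity. *)
Lemma wgrad_periodic v V : wgrad v V -> (forall i, L2b (fun y => v y i 0)) ->
  Defs.periodic a v -> Defs.periodic a V.
Proof.
move=> h lv pv t lt.
suff h' : wgrad v (fun y => V (y + t)) by exact: wgrad_unique h' h.
move=> i j; have [L H] := h i j; split.
  by have := L2b_aff false t L; under eq_fun do rewrite aff_add.
move=> p tp; have tp' := test_aff false (- t) tp.
have bdp := test_partial_bbs j tp; have bp := test_bbs tp.
transitivity (I3 (fun y => v (y + t) i 0 * partial j p y)).
  by apply: I3_ae; have := pv t lt; apply: ae_imp => y ->.
have := H _ tp'; rewrite test_partial_aff// expr0.
have comm (f g : E3 R -> R) : intg (fun y => f y * g y) -> intg (fun y => g y * f y).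
  by congr intg; apply/funext => y; rewrite mulrC.
rewrite -(I3_aff false t); last first.
  under eq_fun do rewrite mul1r; apply: comm.
  by apply: bbs_L2b => //; exact: bbs_aff.
rewrite -(I3_aff false t (f := fun y => V y i j * _)); last first.
  by apply: comm; apply: bbs_L2b => //; exact: bbs_aff.
under eq_fun do rewrite mul1r !aff_add addrK.
by move=> ->; under eq_fun do rewrite !aff_add addrK.
Qed.

Lemma L2b_per p : bbs p -> L2b (per a p).
Proof.
move=> bp; have [N pN] := bbs_support bp; apply: L2b_local => M.
have [K HK] := far_translates ha M pN.
exists (fun y => \sum_(n <- nseq3 K) p (y + tl a n)).
  apply: L2b_sum => n; have := L2b_aff false (tl a n) (L2b_bbs1 bp).
  by under eq_fun do rewrite aff_add.
by move=> y yM; apply: per_finite => n nK; apply: HK nK.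
Qed.

(** On the support of [q] both periodizations are finite sums over the same index set, and each
    translate of [p] is integrated by parts. Thus the weak derivative of [per a p] is the
    periodization of the derivative of [p]. *)
Lemma per_by_parts p q j : test_fun p -> test_fun q ->
  I3 (fun y => per a p y * partial j q y) = - I3 (fun y => per a (partial j p) y * q y).
Proof.
move=> tp tq; have [N HN] := test_box tp; have [M HM] := test_box tq.
have [K HK] := far_translates ha M (fun y ny => (HN y ny).1).
have [K' HK'] := far_translates ha M (fun y ny => (HN y ny).2 j).
pose KK := maxn K K'.
have {}HK := HK KK (leq_maxl _ _); have {}HK' := HK' KK (leq_maxr _ _).
have bq := test_bbs tq; have bdq := test_partial_bbs j tq.
have tpn n : test_fun (fun y => p (y + tl a n)).
  by have := test_aff false (tl a n) tp; under eq_fun do rewrite aff_add.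
have dpn n : partial j (fun y => p (y + tl a n)) = fun y => partial j p (y + tl a n).
  have := test_partial_aff false (tl a n) j tp; under eq_fun do rewrite aff_add.
  by move=> ->; apply/funext => y; rewrite aff_add expr0 mul1r.
have comm (f g : E3 R -> R) : intg (fun y => f y * g y) -> intg (fun y => g y * f y).
  by congr intg; apply/funext => y; rewrite mulrC.
transitivity (I3 (fun y => \sum_(n <- nseq3 KK) p (y + tl a n) * partial j q y)).
  congr I3; apply/funext => y; rewrite -mulr_suml.
  have [yM|/HM[_ ->]] := pselect (box M y); last by rewrite !mulr0.
  by rewrite (@per_finite _ _ _ _ KK)// => n nK; exact: HK.
transitivity (- I3 (fun y => \sum_(n <- nseq3 KK) partial j p (y + tl a n) * q y)); last first.
  congr (- I3 _); apply/funext => y; rewrite -mulr_suml.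
  have [yM|/HM[-> _]] := pselect (box M y); last by rewrite !mulr0.
  by rewrite (@per_finite _ _ _ _ KK)// => n nK; exact: HK'.
rewrite I3_sum; last first.
  by move=> n; apply: comm; apply: bbs_L2b => //; apply: L2b_bbs1; exact: test_bbs.
rewrite I3_sum; last first.
  move=> n; apply: comm; apply: bbs_L2b => //; rewrite -dpn.
  by apply: L2b_bbs1; exact: test_partial_bbs.
rewrite -sumrN; apply: eq_bigr => n _.
by rewrite (I3_by_parts j (test_C1 (tpn n)) tq) dpn.
Qed.

End Periodic.

End WeakGradient.

(** * Matrix fields on the cell and their inner product *)

Section CellFields.
Variables (R : realType) (a : 'I_3 -> E3 R).
Hypothesis ha : lin_indep3 a.
Local Notation mu := (@leb3 R).
Local Notation box := (@box R).
Local Notation Y := (cell a).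
Implicit Types (y z : E3 R) (f g p q : E3 R -> R) (u v : E3 R -> 'cV[R]_3)
  (s e U V : E3 R -> 'M[R]_3).

Definition Mloc s := forall i j, L2b (fun y => s y i j).

Lemma L2sP s : L2s a s <->
  [/\ Mloc s, Defs.periodic a s & {ae mu, forall y, Msym (s y)}].
Proof. by split=> -[h1 h2 h3]; split=> // i j; apply/L2locP; exact: h1. Qed.

Lemma ipYE s e : ipY a s e = I3 (fun y => \1_Y y * frob (s y) (e y)).
Proof. exact: Rint_indic. Qed.

Lemma mintE m n (F : E3 R -> 'M[R]_(m, n)) i j :
  mint Y F i j = I3 (fun y => \1_Y y * F y i j).
Proof. by rewrite mxE; exact: Rint_indic. Qed.

Lemma volYE : volY a = I3 (\1_Y).
Proof. by rewrite I3_indic//; exact: measurable_cell. Qed.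

Lemma locint_L2b f : L2b f -> locint f.
Proof. by move=> hf p bp; exact: bbs_L2b. Qed.

Lemma locint_mul f g : L2b f -> L2b g -> locint (fun y => f y * g y).
Proof. by move=> hf hg p bp; exact: bbs_L2b2. Qed.

(** Vanishing on the cell spreads to every box: by [unfolding] the integral of [g] over a box is an
    integral over the cell of a multiple of [g]. *)
Lemma locint_ae0 g : locint g -> Defs.periodic a g -> (forall y, 0 <= g y) ->
  I3 (fun y => \1_Y y * g y) = 0 -> {ae mu, forall y, g y = 0}.
Proof.
move=> lg pg g0 Ig.
have Yg : {ae mu, forall y, \1_Y y * g y = 0}.
  apply: I3_eq0 => //; first by apply: lg; exact: bbs_cell.
  by move=> y; rewrite mulr_ge0//; have /andP[] := indic01 R Y y.
have ae0 N : {ae mu, forall y, \1_(box N) y * g y = 0}.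
  have bb : bbs (\1_(box N) : E3 R -> R).
    exact: (bbs_indic (@measurable_box R N) (@subset_refl _ (box N))).
  apply: I3_eq0; first exact: lg.
    by move=> y; rewrite mulr_ge0//; have /andP[] := indic01 R (box N) y.
  rewrite (unfolding ha)// -[RHS](I3_0 R); apply: I3_ae; apply: ae_imp Yg => y E.
  by rewrite mulrCA E mulr0.
have : {ae mu, forall y, forall N, \1_(box N) y * g y = 0} by exact/ae_foralln.
apply: ae_imp => y H; have [N] := ex_nat_gt `|y|; rewrite normr_id => yN.
by have := H N; rewrite indicE mem_set ?mul1r//; exact: norm_lt_box.
Qed.

(** Without a determinant formula: if the cell were null, the periodic constant 1 would vanish
    almost everywhere by [locint_ae0], against the positive measure of a box. *)
Lemma volY_gt0 : 0 < volY a.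
Proof.
rewrite volYE lt_neqAle I3_ge0 ?andbT => [|y]; last by have /andP[] := indic01 R Y y.
apply/eqP => /esym v0.
have l1 : locint (fun _ : E3 R => 1 : R) by apply: locint_L2b; exact: L2b_cst.
have : {ae mu, forall y : E3 R, (1 : R) = 0}.
  apply: (locint_ae0 l1) => //; first by move=> t _; exact: aeW.
  by under eq_fun do rewrite mulr1.
move=> /(ae_imp (Q := fun y => \1_(box 1) y = 0)) H.
have : I3 (\1_(box 1) : E3 R -> R) = 0.
  rewrite -[RHS](I3_0 R); apply: I3_ae; apply: H => y /eqP.
  by rewrite oner_eq0.
rewrite I3_indic; last exact: measurable_box.
move=> /eqP; rewrite fine_eq0; last first.
  by rewrite ge0_fin_numE; [exact: leb3_box_lty|exact: measure_ge0].
by rewrite gt_eqF//; apply: leb3_ocbox_gt0 => /=; lra.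
Qed.

Lemma volY_neq0 : volY a != 0.
Proof. by rewrite gt_eqF// volY_gt0. Qed.

Lemma frobC (A B : 'M[R]_3) : frob A B = frob B A.
Proof. by apply: eq_bigr => i _; apply: eq_bigr => j _; rewrite mulrC. Qed.

Lemma frobDl (A B D : 'M[R]_3) : frob (A + B) D = frob A D + frob B D.
Proof.
rewrite /frob -big_split; apply: eq_bigr => i _ /=; rewrite -big_split.
by apply: eq_bigr => j _ /=; rewrite mxE mulrDl.
Qed.

Lemma frobZl (r : R) (A D : 'M[R]_3) : frob (r *: A) D = r * frob A D.
Proof.
rewrite /frob mulr_sumr; apply: eq_bigr => i _; rewrite mulr_sumr.
by apply: eq_bigr => j _; rewrite mxE mulrA.
Qed.

Lemma frobDr (A B D : 'M[R]_3) : frob D (A + B) = frob D A + frob D B.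
Proof. by rewrite frobC frobDl !(frobC D). Qed.

Lemma frobZr (r : R) (A D : 'M[R]_3) : frob D (r *: A) = r * frob D A.
Proof. by rewrite frobC frobZl (frobC D). Qed.

Lemma frob_ge0 (A : 'M[R]_3) : 0 <= frob A A.
Proof. by apply: sumr_ge0 => i _; apply: sumr_ge0 => j _; rewrite -expr2 sqr_ge0. Qed.

Lemma frob_eq0 (A : 'M[R]_3) : frob A A = 0 -> A = 0.
Proof.
move=> H; apply/matrixP => i j; rewrite mxE.
have /(_ i isT) : forall i, true -> \sum_j A i j * A i j = 0.
  move=> k _; have /eqP := H; rewrite psumr_eq0 => [/allP/(_ k)|k' _]; last first.
    by apply: sumr_ge0 => l _; rewrite -expr2 sqr_ge0.
  by rewrite mem_index_enum => /(_ isT)/eqP.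
move=> /eqP; rewrite psumr_eq0 => [/allP/(_ j)|l _]; last by rewrite -expr2 sqr_ge0.
by rewrite mem_index_enum mulf_eq0 orbb => /(_ isT)/eqP.
Qed.

Lemma frob_symm (A B : 'M[R]_3) : Msym A -> frob A (symm B) = frob A B.
Proof.
move=> sA; rewrite /symm frobZr frobDr.
have -> : frob A B^T = frob A B.
  rewrite /frob exchange_big; apply: eq_bigr => i _; apply: eq_bigr => j _.
  by rewrite mxE -{1}sA mxE.
by field.
Qed.

Lemma Msym_symm (A : 'M[R]_3) : Msym (symm A).
Proof. by rewrite /Msym/= /symm linearZ/= linearD/= trmxK addrC. Qed.

Lemma L2b_frob_intg p s e : bbs p -> Mloc s -> Mloc e ->
  intg (fun y => p y * frob (s y) (e y)).
Proof.
move=> bp hs he; rewrite (_ : (fun y => _) = fun y =>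
    \sum_i \sum_j p y * (s y i j * e y i j)).
  by apply: intg_sum => i; apply: intg_sum => j; exact: bbs_L2b2.
by apply/funext => y; rewrite /frob mulr_sumr; apply: eq_bigr => i _; rewrite mulr_sumr.
Qed.

Lemma locint_frob s e : Mloc s -> Mloc e -> locint (fun y => frob (s y) (e y)).
Proof. by move=> hs he p bp; exact: L2b_frob_intg. Qed.

Lemma intg_ipY s e : Mloc s -> Mloc e -> intg (fun y => \1_Y y * frob (s y) (e y)).
Proof. by apply: L2b_frob_intg; exact: bbs_cell. Qed.

Lemma ipY_ae s s' e e' : {ae mu, forall y, s y = s' y} ->
  {ae mu, forall y, e y = e' y} -> ipY a s e = ipY a s' e'.
Proof.
by move=> hs he; rewrite !ipYE; apply: I3_ae; apply: ae_imp2 hs he => y -> ->.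
Qed.

Lemma ipYC s e : ipY a s e = ipY a e s.
Proof. by rewrite !ipYE; congr I3; apply/funext => y; rewrite frobC. Qed.

Lemma MlocD s e : Mloc s -> Mloc e -> Mloc (fun y => s y + e y).
Proof. by move=> hs he i j; under eq_fun do rewrite mxE; exact: L2bD. Qed.

Lemma MlocZ r s : Mloc s -> Mloc (fun y => r *: s y).
Proof. by move=> hs i j; under eq_fun do rewrite mxE; exact: L2bZ. Qed.

Lemma Mloc_cst (A : 'M[R]_3) : Mloc (fun=> A).
Proof. by move=> i j; exact: L2b_cst. Qed.

Lemma Mloc_tr s : Mloc s -> Mloc (fun y => (s y)^T).
Proof. by move=> hs i j; under eq_fun do rewrite mxE. Qed.

Lemma Mloc_symm s : Mloc s -> Mloc (fun y => symm (s y)).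
Proof. by move=> hs; apply: MlocZ; apply: MlocD => //; exact: Mloc_tr. Qed.

Lemma ipYDl s s' e : Mloc s -> Mloc s' -> Mloc e ->
  ipY a (fun y => s y + s' y) e = ipY a s e + ipY a s' e.
Proof.
move=> hs hs' he; rewrite !ipYE -I3D; [|exact: intg_ipY..].
by congr I3; apply/funext => y; rewrite frobDl mulrDr.
Qed.

Lemma ipYZl r s e : Mloc s -> Mloc e -> ipY a (fun y => r *: s y) e = r * ipY a s e.
Proof.
move=> hs he; rewrite !ipYE -I3Z; last exact: intg_ipY.
by congr I3; apply/funext => y; rewrite frobZl mulrCA.
Qed.

Lemma ipYDr s e e' : Mloc s -> Mloc e -> Mloc e' ->
  ipY a s (fun y => e y + e' y) = ipY a s e + ipY a s e'.
Proof. by move=> hs he he'; rewrite ipYC ipYDl// !(ipYC s). Qed.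

Lemma ipY_cst (S : 'M[R]_3) e : Mloc e -> ipY a (fun=> S) e = frob S (mint Y e).
Proof.
move=> he; rewrite ipYE /frob.
have i1 i j : intg (fun y => S i j * (\1_Y y * e y i j)).
  by apply: intgZ; apply: bbs_L2b => //; exact: bbs_cell.
transitivity (I3 (fun y => \sum_i \sum_j S i j * (\1_Y y * e y i j))).
  congr I3; apply/funext => y; rewrite mulr_sumr; apply: eq_bigr => i _.
  by rewrite mulr_sumr; apply: eq_bigr => j _; rewrite mulrCA.
rewrite I3_sum => [|i]; last exact: intg_sum.
apply: eq_bigr => i _; rewrite I3_sum//; apply: eq_bigr => j _.
by rewrite I3Z ?mintE//; apply: bbs_L2b => //; exact: bbs_cell.
Qed.

Lemma mintD s e : Mloc s -> Mloc e -> mint Y (fun y => s y + e y) = mint Y s + mint Y e.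
Proof.
move=> hs he; apply/matrixP => i j; rewrite [RHS]mxE !mintE -I3D.
- by congr I3; apply/funext => y; rewrite mxE mulrDr.
- by apply: bbs_L2b => //; exact: bbs_cell.
- by apply: bbs_L2b => //; exact: bbs_cell.
Qed.

Lemma mintZ r s : Mloc s -> mint Y (fun y => r *: s y) = r *: mint Y s.
Proof.
move=> hs; apply/matrixP => i j; rewrite [RHS]mxE !mintE -I3Z.
- by congr I3; apply/funext => y; rewrite mxE mulrCA.
- by apply: bbs_L2b => //; exact: bbs_cell.
Qed.

Lemma mint_cst (S : 'M[R]_3) : mint Y (fun=> S) = volY a *: S.
Proof.
apply/matrixP => i j; rewrite [RHS]mxE mintE volYE mulrC -I3Z.
  by congr I3; apply/funext => y; rewrite mulrC.
by apply: bbs_intg; exact: bbs_cell.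
Qed.

Lemma mint_ae s e : {ae mu, forall y, s y = e y} -> mint Y s = mint Y e.
Proof.
move=> h; apply/matrixP => i j; rewrite !mintE; apply: I3_ae.
by apply: ae_imp h => y ->.
Qed.

Lemma Msym_mint s : {ae mu, forall y, Msym (s y)} -> Msym (mint Y s).
Proof.
move=> h; apply/matrixP => i j; rewrite [LHS]mxE !mintE; apply: I3_ae.
by apply: ae_imp h => y E; rewrite -{1}E mxE.
Qed.

Lemma ipY_ge0 e : 0 <= ipY a e e.
Proof.
rewrite ipYE; apply: I3_ge0 => y; rewrite mulr_ge0 ?frob_ge0//.
Qed.

Lemma ipY_eq0 e : Mloc e -> Defs.periodic a e -> ipY a e e = 0 ->
  {ae mu, forall y, e y = 0}.
Proof.
move=> he pe; rewrite ipYE => /(locint_ae0 (locint_frob he he)) H.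
have : {ae mu, forall y, frob (e y) (e y) = 0}.
  by apply: H => [t /pe|y]; [apply: ae_imp => y ->|exact: frob_ge0].
by apply: ae_imp => y /frob_eq0.
Qed.

Lemma L2sD s e : L2s a s -> L2s a e -> L2s a (fun y => s y + e y).
Proof.
move=> /L2sP[h1 h2 h3] /L2sP[k1 k2 k3]; apply/L2sP; split.
- exact: MlocD.
- by move=> t lt; apply: ae_imp2 (h2 t lt) (k2 t lt) => y -> ->.
- by apply: ae_imp2 h3 k3 => y E F; rewrite /Msym/= linearD/= E F.
Qed.

Lemma L2sZ r s : L2s a s -> L2s a (fun y => r *: s y).
Proof.
move=> /L2sP[h1 h2 h3]; apply/L2sP; split.
- exact: MlocZ.
- by move=> t lt; apply: ae_imp (h2 t lt) => y ->.
- by apply: ae_imp h3 => y E; rewrite /Msym/= linearZ/= E.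
Qed.

Lemma L2s_cst (S : 'M[R]_3) : Msym S -> L2s a (fun=> S).
Proof.
move=> sS; apply/L2sP; split; first exact: Mloc_cst.
- by move=> t _; exact: aeW.
- exact: aeW.
Qed.

Lemma L2sB s e : L2s a s -> L2s a e -> L2s a (fun y => s y - e y).
Proof.
move=> hs /(L2sZ (-1)) he; have := L2sD hs he.
by congr L2s; apply/funext => y; rewrite scaleN1r.
Qed.

Lemma L2s_Mloc s : L2s a s -> Mloc s.
Proof. by move=> /L2sP[]. Qed.

Lemma H1perP v : H1per a v <->
  [/\ forall i, L2b (fun y => v y i 0), exists V, wgrad v V & Defs.periodic a v].
Proof.
split.
  move=> [[h1 [V /wgradP hV]] h3]; split => //; last by exists V.
  by move=> i; apply/L2locP.
move=> [h1 [V hV] h3]; split => //; split; last by exists V; apply/wgradP.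
by move=> i; apply/L2locP.
Qed.

(* The periodized test field, normalised to mean zero, transfers the cell
   formulation to the distributional one. *)
Lemma test_field p (i0 : 'I_3) : test_fun p -> exists2 v, H1per0 a v &
  forall s, L2s a s ->
    ipY a s (sgrad v) = I3 (fun y => \sum_(j < 3) s y i0 j * partial j p y).
Proof.
move=> tp; have bp := test_bbs tp.
have bY := bbs_cell ha.
(* The mean of [per a p] over the cell. Subtracting it achieves mean zero and leaves the gradient
   unchanged. *)
pose c := (volY a)^-1 * I3 (fun y => \1_Y y * per a p y).
pose v (y : E3 R) : 'cV[R]_3 := \col_i ((i == i0)%:R * (per a p y - c)).
pose V (y : E3 R) : 'M[R]_3 := \matrix_(i, j) ((i == i0)%:R * per a (partial j p) y).
have hv : wgrad v V.
  move=> i j; split.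
    under eq_fun do rewrite mxE; apply: L2bZ; apply: L2b_per => //.
    exact: test_partial_bbs.
  move=> q tq; have bq := test_bbs tq; have bdq := test_partial_bbs j tq.
  have lp := L2b_per ha bp; have ldp := L2b_per ha (test_partial_bbs j tp).
  have comm (f g : E3 R -> R) : intg (fun y => f y * g y) -> intg (fun y => g y * f y).
    by congr intg; apply/funext => y; rewrite mulrC.
  transitivity ((i == i0)%:R * (I3 (fun y => per a p y * partial j q y) -
      c * I3 (partial j q))).
    rewrite -(I3Z c); last exact: bbs_intg.
    rewrite -I3B; [|apply: comm; exact: bbs_L2b|apply: intgZ; exact: bbs_intg].
    rewrite -I3Z.
      by congr I3; apply/funext => y; rewrite mxE; ring.
    apply: intgB; [apply: comm; exact: bbs_L2b|apply: intgZ; exact: bbs_intg].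
  rewrite I3_partial_test// mulr0 subr0 per_by_parts// mulrN; congr (- _).
  rewrite -I3Z; last by apply: comm; exact: bbs_L2b.
  by congr I3; apply/funext => y; rewrite mxE mulrA.
exists v.
  split.
    apply/H1perP; split; last first.
    - move=> t /lattice3P[n ->]; apply: aeW => y; apply/colP => i.
      by rewrite !mxE per_tl.
    - by exists V.
    move=> i; under eq_fun do rewrite mxE; apply: L2bZ.
    by apply: L2bB; [exact: L2b_per|exact: L2b_cst].
  apply/colP => i; rewrite [RHS]mxE mintE.
  have i1 : intg (fun y => \1_Y y * per a p y) by apply: bbs_L2b => //; exact: L2b_per.
  transitivity ((i == i0)%:R * (I3 (fun y => \1_Y y * per a p y) - c * I3 (\1_Y))).
    rewrite -(I3Z c); last exact: bbs_intg.
    rewrite -I3B//; last by apply: intgZ; exact: bbs_intg.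
    rewrite -I3Z; first by congr I3; apply/funext => y; rewrite mxE; ring.
    by apply: intgB => //; apply: intgZ; exact: bbs_intg.
  by rewrite -volYE /c mulrAC mulVf ?volY_neq0// mul1r subrr mulr0.
move=> s /L2sP[ls ps ss].
transitivity (I3 (fun y => \sum_(j < 3) \1_Y y * (per a (partial j p) y * s y i0 j))).
  rewrite ipYE; apply: I3_ae; apply: ae_imp2 (sgrad_ae hv) ss => y -> sy.
  rewrite frob_symm// /frob (bigD1 i0)//= [X in _ + X]big1 => [|i ii0].
    rewrite addr0 mulr_sumr; apply: eq_bigr => j _; rewrite mxE eqxx mul1r.
    by rewrite (mulrC (s y i0 j)).
  by rewrite big1// => j _; rewrite mxE (negbTE ii0) mul0r mulr0.
rewrite I3_sum => [|j]; last first.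
  by apply: bbs_L2b2 => //; apply: L2b_per => //; exact: test_partial_bbs.
transitivity (\sum_(j < 3) I3 (fun y => partial j p y * s y i0 j)).
  apply: eq_bigr => j _; rewrite (unfolding ha)//.
  - exact: test_partial_bbs.
  - exact: locint_L2b.
  - by move=> t /ps; apply: ae_imp => y ->.
rewrite -I3_sum => [|j]; last by apply: bbs_L2b => //; exact: test_partial_bbs.
by congr I3; apply/funext => y; apply: eq_bigr => j _; rewrite mulrC.
Qed.

End CellFields.

(** * Divergence-free fields are orthogonal to periodic gradients *)

Section Orthogonality.
Variables (R : realType) (a : 'I_3 -> E3 R).
Hypothesis ha : lin_indep3 a.
Local Notation box := (@box R).
Local Notation Y := (cell a).
Implicit Types (y z : E3 R) (f g p q : E3 R -> R) (u v : E3 R -> 'cV[R]_3)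
  (s e U V : E3 R -> 'M[R]_3).

(** The indicator of []b, c]] is continuous from the left, so shifts of constant sign give
    convergence at every point, the endpoints included. This is the origin of the sign condition in
    [translation_cvg]. *)
Lemma indic_itv_shift_cvg (b c x : R) (u : nat -> R) : (forall n, 0 <= u n) ->
  u n @[n --> \oo] --> (0 : R) ->
  (fun n => (b < x - u n <= c)%R%:R : R) @ \oo --> ((b < x <= c)%R%:R : R).
Proof.
move=> u0 ucv; apply: cvg_near_cst.
have lt_u d : 0 < d -> \forall n \near \oo, u n < d.
  by move=> d0; move/cvgrPdist_lt: ucv => /(_ d d0); apply: filterS => n;
    rewrite sub0r normrN ger0_norm.
have [bx|xb] := ltP b x; last first.
  apply: nearW => n; rewrite ltNge; have -> // : x - u n <= b.
  by rewrite lerBlDr (le_trans xb)// lerDl.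
have [xc|cx] := leP x c.
  have : 0 < x - b by rewrite subr_gt0.
  move=> /lt_u; apply: filterS => n h.
  have -> // : (b < x - u n <= c)%R by apply/andP; split; have := u0 n; lra.
have : 0 < x - c by rewrite subr_gt0.
move=> /lt_u; apply: filterS => n h.
by rewrite andbC leNgt; have -> : c < x - u n by lra.
Qed.

Lemma itv_norm (b c x B D : R) : b < x <= c -> `|b| <= B -> `|c| <= D -> `|x| <= B + D.
Proof.
move=> /andP[bx xc]; rewrite !ler_norml => /andP[B1 B2] /andP[D1 D2].
have B0 : 0 <= B by lra.
have D0 : 0 <= D by lra.
by apply/andP; split; lra.
Qed.

Lemma shift_box N y z : `|z| <= 1 -> box N (y + z) -> box N.+2 y.
Proof.
move=> z1 /box_norm h; apply: norm_lt_box; rewrite -(addrK z y).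
apply: (le_lt_trans (ler_normD _ _)); rewrite normrN -addn2 natrD.
by apply: (@le_lt_trans _ _ (N%:R + 1)); [exact: lerD|lra].
Qed.

Lemma L2b_shift g z : L2b g -> L2b (fun y => g (y + z)).
Proof. by move=> /(L2b_aff false z); under eq_fun do rewrite aff_add. Qed.

Lemma I3_shift f z : intg f -> I3 (fun y => f (y + z)) = I3 f.
Proof. by move=> hf; rewrite -[RHS](I3_aff false z)//; congr I3; apply/funext => y; rewrite aff_add. Qed.

Lemma bbs_box N : bbs (\1_(box N) : E3 R -> R).
Proof. exact: (bbs_indic (@measurable_box R N) (@subset_refl _ (box N))). Qed.

(** [weak_null] is applied to the differences [g (y + zs n) - g y]. They are bounded in L^2 of
    [box N] because unit shifts stay in a larger box, and their integrals over boxes tend to 0 once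
    the shift is moved onto the indicator. *)
Lemma translation_cvg f g (zs : nat -> E3 R) : L2b f -> L2b g ->
  (forall n, `|zs n| <= 1) -> (forall n k, 0 <= co k (zs n)) ->
  (forall k, co k (zs n) @[n --> \oo] --> (0 : R)) ->
  I3 (fun y => \1_Y y * (f y * g (y + zs n))) @[n --> \oo] -->
  I3 (fun y => \1_Y y * (f y * g y)).
Proof.
move=> hf hg z1 z0 zcv.
have [N HN] := cell_box ha; have bY := bbs_cell ha.
have [mY _] := bY.
pose h n y := g (y + zs n) - g y.
have hL n : L2b (h n) by apply: L2bB => //; exact: L2b_shift.
have sqr_shift n : I3 (fun y => \1_(box N) y * g (y + zs n) ^+ 2) <=
    I3 (fun y => \1_(box N.+2) y * g y ^+ 2).
  have E : I3 (fun y => \1_(box N) y * g (y + zs n) ^+ 2) =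
      I3 (fun y => \1_(box N) (y - zs n) * g y ^+ 2).
    rewrite -(I3_shift (- zs n)).
      by congr I3; apply/funext => y; rewrite subrK.
    exact: (L2b_shift (zs n) hg).2.
  have bs : bbs (fun y => \1_(box N) (y - zs n) : R).
    have := bbs_aff false (- zs n) (bbs_box N); congr bbs.
    by apply/funext => y; rewrite aff_add.
  rewrite E; apply: I3_le; [exact: L2b_bbs|exact: hg.2|] => y.
  rewrite ler_wpM2r ?sqr_ge0// !indicE ler_nat.
  case: (boolP (y - zs n \in box N)) => // yn; rewrite mem_set//.
  by apply: (@shift_box _ _ (- zs n)); rewrite ?normrN// -inE.
(* From [(u - v)^2 <= 2 u^2 + 2 v^2], with the shifted term bounded on [box N.+2]. *)
pose C := 2 * I3 (fun y => \1_(box N.+2) y * g y ^+ 2) +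
  2 * I3 (fun y => \1_(box N) y * g y ^+ 2).
have hC n : I3 (fun y => \1_(box N) y * h n y ^+ 2) <= C.
  apply: (@le_trans _ _ (2 * I3 (fun y => \1_(box N) y * g (y + zs n) ^+ 2) +
      2 * I3 (fun y => \1_(box N) y * g y ^+ 2))); last first.
    by rewrite /C lerD2r ler_wpM2l.
  have i1 := (L2b_shift (zs n) hg).2 N; have i2 := hg.2 N.
  rewrite -I3Z// -I3Z// -I3D; try exact: intgZ.
  apply: I3_le; [exact: (hL n).2|by apply: intgD; exact: intgZ|] => y.
  have /andP[i0 _] := indic01 R (box N) y.
  rewrite (mulrCA 2 _ (g (y + zs n) ^+ 2)) (mulrCA 2 _ (g y ^+ 2)) -mulrDr ler_wpM2l//.
  rewrite /h; have := sqr_ge0 (g (y + zs n) + g y); rewrite sqrrD sqrrB; lra.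
have h0 b c : I3 (fun y => \1_(ocbox b c) y * h n y) @[n --> \oo] --> (0 : R).
  have [M HM] : exists M, ocbox b c `<=` box M.
    have [M HM] := ex_nat_gt (`|b| + `|c|); exists M => y /ocboxE[y1 y2 y3].
    rewrite ger0_norm in HM; last by rewrite addr_ge0.
    have [b1 b2 b3] := norm3_le (lexx `|b|); have [c1 c2 c3] := norm3_le (lexx `|c|).
    apply: norm_lt_box; apply: le_lt_trans HM; rewrite norm3E !ge_max.
    by rewrite (itv_norm y1)// (itv_norm y2)// (itv_norm y3).
  have bo : bbs (\1_(ocbox b c) : E3 R -> R) := bbs_indic (@measurable_ocbox R b c) HM.
  have bs n : bbs (fun y => \1_(ocbox b c) (y - zs n) : R).
    have := bbs_aff false (- zs n) bo; congr bbs.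
    by apply/funext => y; rewrite aff_add.
  have cvp y : (fun n => \1_(ocbox b c) (y - zs n) * g y) @ \oo --> (\1_(ocbox b c) y * g y : R).
    apply: cvgM; last exact: cvg_cst.
    rewrite indic_ocboxE.
    rewrite (_ : (fun n => \1_(ocbox b c) (y - zs n)) = fun n =>
       \prod_(k < 3) (co k b < co k y - co k (zs n) <= co k c)%R%:R :> R); last first.
      apply/funext => n; rewrite indic_ocboxE; apply: eq_bigr => k _.
      by rewrite coD -scaleN1r coZ mulN1r.
    rewrite !big_ord_recl big_ord0.
    under [X in X @ _]eq_fun do rewrite !big_ord_recl big_ord0.
    by do ! (apply: cvgM; first exact: indic_itv_shift_cvg); exact: cvg_cst.
  have bd n y : `|\1_(ocbox b c) (y - zs n) * g y| <= `|\1_(box M.+2) y * g y|.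
    rewrite !normrM ler_wpM2r// !indicE !ger0_norm// ler_nat.
    case: (boolP (y - zs n \in ocbox b c)) => // yn; rewrite mem_set//.
    by apply: (@shift_box _ _ (- zs n)); rewrite ?normrN//; apply: HM; rewrite -inE.
  have [_ H] := I3_dct (fun n => measurable_funM (bs n).1 hg.1)
    (measurable_funM bo.1 hg.1) cvp (intg_norm (bbs_L2b (bbs_box M.+2) hg)) bd.
  have : (fun n => I3 (fun y => \1_(ocbox b c) (y - zs n) * g y) -
      I3 (fun y => \1_(ocbox b c) y * g y)) @ \oo -->
      (I3 (fun y => \1_(ocbox b c) y * g y) - I3 (fun y => \1_(ocbox b c) y * g y) : R).
    by apply: cvgB; [exact: H|exact: cvg_cst].
  rewrite subrr; apply: cvg_trans; apply: near_eq_cvg; apply: nearW => n.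
  have <- : I3 (fun y => \1_(ocbox b c) y * g (y + zs n)) =
      I3 (fun y => \1_(ocbox b c) (y - zs n) * g y).
    rewrite -(I3_shift (- zs n)); first by congr I3; apply/funext => y; rewrite subrK.
    by apply: bbs_L2b => //; exact: L2b_shift.
  rewrite -I3B; [|by apply: bbs_L2b => //; exact: L2b_shift|exact: bbs_L2b].
  by congr I3; apply/funext => y; rewrite mulrBr.
have hYf : L2b (fun y => \1_Y y * f y).
  apply: L2bM => //; exists 1; apply: aeW => y.
  by have /andP[i0 i1] := indic01 R Y y; rewrite ger0_norm.
have := weak_null hL hC h0 hYf.
have i1 : intg (fun y => \1_Y y * (f y * g y)) by exact: bbs_L2b2.
move=> H; have : (fun n => I3 (fun y => \1_(box N) y * (\1_Y y * f y * h n y)) +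
   I3 (fun y => \1_Y y * (f y * g y))) @ \oo --> (0 + I3 (fun y => \1_Y y * (f y * g y)) : R).
  by apply: cvgD; [exact: H|exact: cvg_cst].
rewrite add0r; apply: cvg_trans; apply: near_eq_cvg; apply: nearW => n.
rewrite -I3D//; last by exact: (bbs_L2b2 (bbs_box N)).
congr I3; apply/funext => y; rewrite /h.
have [yY|yY] := pselect (Y y); last by rewrite (indicE _ Y) memNset// !mul0r mulr0 addr0.
by rewrite (indicE _ (box N)) mem_set ?mul1r; [ring|exact: HN].
Qed.

End Orthogonality.

(** * Correlations over the cell and Fubini's theorem for them *)

Section Averages.
Variables (R : realType) (a : 'I_3 -> E3 R).
Hypothesis ha : lin_indep3 a.
Local Notation mu := (@leb3 R).
Local Notation box := (@box R).
Local Notation Y := (cell a).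
Implicit Types (b : bool) (y z : E3 R) (f g p q : E3 R -> R).

Lemma aff_swap b y z : aff b y z = aff false (aff b 0 z) y.
Proof.
rewrite /aff /aff1 /=; case: y => -[y1 y2] y3; case: z => -[z1 z2] z3 /=.
by rewrite !expr0; congr (_, _, _); ring.
Qed.

Lemma measurable_aff2 b : measurable_fun [set: (E3 R * E3 R)%type]
  (fun zy : (E3 R * E3 R)%type => aff b zy.2 zy.1).
Proof.
have m1 (q : E3 R -> measurableTypeR R) : measurable_fun [set: E3 R] q ->
    measurable_fun [set: (E3 R * E3 R)%type]
      (fun zy : (E3 R * E3 R)%type => aff1 b (q zy.2) (q zy.1)).
  move=> mq; rewrite /aff1; apply: measurable_funD.
    apply: measurable_funM => //.
    by apply: (measurableT_comp mq); exact: measurable_fst.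
  by apply: (measurableT_comp mq); exact: measurable_snd.
apply: measurable_fun_pair; first apply: measurable_fun_pair.
- by apply: (m1 (fun y => y.1.1)); apply: measurableT_comp.
- by apply: (m1 (fun y => y.1.2)); apply: measurableT_comp.
- by apply: (m1 (fun y => y.2)); exact: measurable_snd.
Qed.

Section Exchange.
Variables (b : bool) (p f g : E3 R -> R).
Hypotheses (bp : bbs p) (hf : L2b f) (hg : L2b g).

Let Phi (zy : (E3 R * E3 R)%type) : \bar R :=
  (p zy.1 * (\1_Y zy.2 * (f zy.2 * g (aff b zy.2 zy.1))))%:E.

Let gy z : L2b (fun y => g (aff b y z)).
Proof.
have := L2b_aff false (aff b 0 z) hg; congr L2b; apply/funext => y.
by rewrite [in RHS]aff_swap.
Qed.

Let bY : bbs (\1_Y : E3 R -> R) := bbs_cell ha.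

Let mPhi : measurable_fun setT Phi.
Proof.
have m1 (q : E3 R -> R) : measurable_fun [set: E3 R] q ->
    measurable_fun [set: (E3 R * E3 R)%type] (fun zy : (E3 R * E3 R)%type => q zy.1).
  by move=> mq; apply: (measurableT_comp mq); exact: measurable_fst.
have m2 (q : E3 R -> R) : measurable_fun [set: E3 R] q ->
    measurable_fun [set: (E3 R * E3 R)%type] (fun zy : (E3 R * E3 R)%type => q zy.2).
  by move=> mq; apply: (measurableT_comp mq); exact: measurable_snd.
apply/measurable_EFinP; apply: measurable_funM; first exact: (m1 _ bp.1).
apply: measurable_funM; first exact: (m2 _ bY.1).
apply: measurable_funM; first exact: (m2 _ hf.1).
exact: (measurableT_comp hg.1 (measurable_aff2 b)).
Qed.

(** This bound makes [Phi] integrable on the product by Tonelli's theorem: the integral over the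
    cell is bounded uniformly for [z] in a box by Young's inequality and translation invariance, and
    [p] vanishes outside that box. *)
Let inner_bound : exists N C, 0 <= C /\ forall z,
  I3 (fun y => `|p z * (\1_Y y * (f y * g (aff b y z)))|) <= C * \1_(box N) z.
Proof.
have [N [M [M0 HM]]] := bbs_bound bp.
have [K HK] := cell_box ha.
have [D [D0 HD]] : exists D, 0 <= D /\ forall z, box N z ->
    I3 (fun y => \1_Y y * g (aff b y z) ^+ 2) <= D.
  (* The cell lies in [box K] and the shift has norm at most [N]; the extra 1 gives the strict
     inequality of [norm_lt_box]. *)
  exists (I3 (fun y => \1_(box (K + N).+1) y * g y ^+ 2)); split.
    by apply: I3_ge0 => y; rewrite mulr_ge0 ?sqr_ge0//.
  move=> z zN; set w := aff b 0 z.
  have bs : bbs (fun y => \1_Y (y - w) : R).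
    have := bbs_aff false (- w) bY; congr bbs.
    by apply/funext => y; rewrite aff_add.
  have -> : I3 (fun y => \1_Y y * g (aff b y z) ^+ 2) =
      I3 (fun y => \1_Y (y - w) * g y ^+ 2).
    rewrite -(I3_shift w (f := fun y => \1_Y (y - w) * g y ^+ 2)); last first.
      exact: L2b_bbs.
    by congr I3; apply/funext => y; rewrite addrK aff_swap aff_add.
  apply: I3_le; [exact: L2b_bbs|exact: hg.2|] => y.
  rewrite ler_wpM2r ?sqr_ge0// !indicE ler_nat.
  case: (boolP (y - w \in Y)) => // yw; rewrite mem_set//.
  rewrite inE in yw; have /box_norm h1 := HK _ yw; have /box_norm h2 := zN.
  have wz : `|w| = `|z|.
    rewrite /w; case: (b); last by rewrite aff_add addr0.
    by rewrite aff_sub sub0r normrN.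
  apply: norm_lt_box; rewrite -(subrK w y); apply: (le_lt_trans (ler_normD _ _)).
  by rewrite wz; apply: (@le_lt_trans _ _ (K%:R + N%:R)); [exact: lerD|rewrite -natrD ltr_nat].
pose D1 := I3 (fun y => \1_Y y * f y ^+ 2).
have D10 : 0 <= D1 by apply: I3_ge0 => y; rewrite mulr_ge0 ?sqr_ge0.
exists N, (M * (D1 + D)); split; first by rewrite mulr_ge0// addr_ge0.
move=> z.
have i1 : intg (fun y => \1_Y y * f y ^+ 2) by exact: L2b_bbs.
have i2 : intg (fun y => \1_Y y * g (aff b y z) ^+ 2) by exact: (L2b_bbs (gy z) bY).
have i3 : intg (fun y => \1_Y y * (f y * g (aff b y z))) by exact: bbs_L2b2.
have step : I3 (fun y => `|p z * (\1_Y y * (f y * g (aff b y z)))|) <=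
    `|p z| * (D1 + I3 (fun y => \1_Y y * g (aff b y z) ^+ 2)).
  rewrite /D1 -I3D// -I3Z; last exact: intgD.
  apply: I3_le; [by apply: intg_norm; exact: intgZ|by apply: intgZ; exact: intgD|] => y.
  rewrite normrM ler_wpM2l// normrM ger0_norm// -mulrDr ler_wpM2l//.
  exact: mul_le_sqr.
apply: (le_trans step); have := HM z; rewrite indicE.
case: (boolP (z \in box N)) => zN; last first.
  by rewrite mulr0 normr_le0 => /eqP ->; rewrite normr0 mul0r mulr0.
rewrite !mulr1 => pz; apply: ler_pM => //.
  by rewrite addr_ge0// I3_ge0// => y; rewrite mulr_ge0 ?sqr_ge0.
by rewrite lerD2l; apply: HD; rewrite -inE.
Qed.

Let iPhi : (mu \x mu)%E.-integrable setT Phi.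
Proof.
apply/(@integrable12ltyP _ _ _ _ _ mu mu Phi mPhi).
have [N [C [C0 H]]] := inner_bound.
apply: (@le_lt_trans _ _ (\int[mu]_z (C * \1_(box N) z)%:E)%E).
  apply: ge0_le_integral => //.
  - by move=> z _; exact: integral_ge0.
  - have := @measurable_fun_fubini_tonelli_F _ _ _ _ R mu (abse \o Phi).
    have mA : measurable_fun setT (abse \o Phi) by exact: (measurableT_comp _ mPhi).
    by apply => // zy; exact: abse_ge0.
  - apply/measurable_EFinP; apply: measurable_funM => //.
    by apply: measurable_indic; exact: measurable_box.
  - move=> z _; rewrite /Phi /=.
    have i3 : intg (fun y => `|p z * (\1_Y y * (f y * g (aff b y z)))|).
      by apply: intg_norm; apply: intgZ; apply: bbs_L2b2.
    by rewrite -(intgE i3) lee_fin.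
by rewrite -intgE ?ltry//; apply: intgZ; exact: intg_box.
Qed.

Let Fz z : (\int[mu]_y Phi (z, y) =
  (p z * I3 (fun y => \1_Y y * (f y * g (aff b y z))))%:E)%E.
Proof.
have i3 : intg (fun y => \1_Y y * (f y * g (aff b y z))) by exact: bbs_L2b2.
by rewrite /Phi /= -intgE ?I3Z//; exact: intgZ.
Qed.

Let Gy y : (\int[mu]_z Phi (z, y) =
  (\1_Y y * (f y * I3 (fun z => p z * g (aff b y z))))%:E)%E.
Proof.
have i2 : intg (fun z => p z * g (aff b y z)).
  by apply: bbs_L2b => //; exact: L2b_aff.
rewrite mulrA -I3Z// intgE; last exact: intgZ.
by rewrite /Phi /=; apply: eq_integral => z _; congr EFin; ring.
Qed.

(** [aff b y z] is [y + z] or [y - z] according to [b]. The first form serves for the gradient in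
    [wgrad_avg], the second for the divergence in [divfree_avg]. *)
Lemma exchange_avg :
  I3 (fun z => p z * I3 (fun y => \1_Y y * (f y * g (aff b y z)))) =
  I3 (fun y => \1_Y y * (f y * I3 (fun z => p z * g (aff b y z)))).
Proof.
rewrite {1 3}/I3 /Rintegral; congr fine.
transitivity (\int[mu]_z \int[mu]_y Phi (z, y))%E.
  by apply: eq_integral => z _; rewrite Fz.
by rewrite (Fubini iPhi); apply: eq_integral => y _; rewrite Gy.
Qed.

Lemma intg_exchange :
  intg (fun y => \1_Y y * (f y * I3 (fun z => p z * g (aff b y z)))).
Proof.
have mG : measurable_fun setT (fun y => \int[mu]_z Phi (z, y))%E.
  exact: (measurable_fubini_G iPhi).
have EG : (fun y => \int[mu]_z Phi (z, y))%E = EFin \o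
    (fun y => \1_Y y * (f y * I3 (fun z => p z * g (aff b y z)))).
  by apply/funext => y; rewrite Gy.
rewrite /intg -EG; apply/integrableP; split => //.
apply: (@le_lt_trans _ _ (\int[mu]_y \int[mu]_z `|Phi (z, y)|)%E); last first.
  exact: ((integrable21ltyP _ _ mPhi).1 iPhi).
apply: ge0_le_integral => //.
- exact: measurableT_comp.
- have := @measurable_fun_fubini_tonelli_G _ _ _ _ R mu (abse \o Phi).
  have mA : measurable_fun setT (abse \o Phi) by exact: (measurableT_comp _ mPhi).
  by apply => // zy; exact: abse_ge0.
move=> y _; apply: le_abse_integral => //.
have i2 : intg (fun z => (\1_Y y * f y) * (p z * g (aff b y z))).
  by apply: intgZ; apply: bbs_L2b => //; exact: L2b_aff.
apply: (measurable_int mu); move: i2; congr (mu.-integrable setT).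
by apply/funext => z; rewrite /Phi /=; congr EFin; ring.
Qed.

Lemma measurable_avg :
  measurable_fun setT (fun z => p z * I3 (fun y => \1_Y y * (f y * g (aff b y z)))).
Proof.
apply/measurable_EFinP; have := measurable_fubini_F iPhi.
by congr measurable_fun; apply/funext => z; rewrite /= -Fz.
Qed.

Lemma avg_bound : exists C, forall z,
  `|p z * I3 (fun y => \1_Y y * (f y * g (aff b y z)))| <= C.
Proof.
have [N [C [C0 H]]] := inner_bound; exists C => z.
have i3 : intg (fun y => \1_Y y * (f y * g (aff b y z))) by exact: bbs_L2b2.
rewrite -I3Z//; apply: (le_trans (I3_norm_le (intgZ (p z) i3))).
by apply: (le_trans (H z)); rewrite ler_piMr//; have /andP[] := indic01 R (box N) z.
Qed.

End Exchange.

(** The correlation of [f] and [g] over the cell. Summed over the entries of [s] and [V] it is the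
    function F of the overview. *)
Definition avg f g z := I3 (fun y => \1_Y y * (f y * g (y + z))).

Lemma avgE f g z : avg f g z = I3 (fun y => \1_Y y * (f y * g (aff false y z))).
Proof. by congr I3; apply/funext => y; rewrite aff_add addrC. Qed.

Lemma L2b_avg f g : L2b f -> L2b g -> L2b (avg f g).
Proof.
move=> hf hg.
have E N z : box N z -> avg f g z =
    \1_(box N) z * I3 (fun y => \1_Y y * (f y * g (aff false y z))).
  by move=> zN; rewrite indicE mem_set// mul1r avgE.
apply: L2b_bounded.
  apply: measurable_local => N.
  by exists (fun z => \1_(box N) z * I3 (fun y => \1_Y y * (f y * g (aff false y z))));
    [exact: measurable_avg (bbs_box R N) hf hg|exact: E].
move=> N; have [C HC] := avg_bound false (bbs_box R N) hf hg; exists C => z zN.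
by rewrite (E N).
Qed.

End Averages.

(** * The correlation of a divergence-free field with a gradient vanishes *)

Section DivFree.
Variables (R : realType) (a : 'I_3 -> E3 R).
Hypothesis ha : lin_indep3 a.
Local Notation mu := (@leb3 R).
Local Notation Y := (cell a).
Implicit Types (y z : E3 R) (f g p q : E3 R -> R) (u v : E3 R -> 'cV[R]_3)
  (s e U V : E3 R -> 'M[R]_3).

Lemma I3_mulC f g : I3 (fun y => f y * g y) = I3 (fun y => g y * f y).
Proof. by congr I3; apply/funext => y; rewrite mulrC. Qed.

(** The product is periodic in [y], so the cell may be translated by [- z]. The shift thereby passes
    from [g] to [f], where the divergence condition can act. *)
Lemma avg_reflect f g z : L2b f -> L2b g -> Defs.periodic a f -> Defs.periodic a g ->
  avg a f g z = I3 (fun y => \1_Y y * (g y * f (y - z))).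
Proof.
move=> hf hg pf pg; rewrite /avg.
have lg : locint (fun y => f y * g (y + z)) by apply: locint_mul => //; exact: L2b_shift.
rewrite -(@I3_cell_translate _ _ ha _ (- z) lg); last first.
  move=> t lt; apply: ae_imp2 (pf t lt) (ae_aff false z (pg t lt)) => y -> h.
  by move: h; rewrite !aff_add => h; rewrite addrAC h.
by congr I3; apply/funext => y; rewrite subrK (mulrC (f _)).
Qed.

(** After Fubini, for each fixed [y] the inner integral pairs [V] with the translated test function
    [p (z - y)], and the definition of the weak gradient applies. *)
Lemma wgrad_avg v V f i j p : wgrad v V -> L2b (fun y => v y i 0) -> L2b f ->
  test_fun p ->
  I3 (fun z => p z * avg a f (fun y => V y i j) z) =
  - I3 (fun z => partial j p z * avg a f (fun y => v y i 0) z).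
Proof.
move=> hV lv hf tp; have [LV HV] := hV i j.
have bp := test_bbs tp; have bdp := test_partial_bbs j tp.
have E q g : bbs q -> L2b g -> I3 (fun z => q z * avg a f g z) =
    I3 (fun y => \1_Y y * (f y * I3 (fun z => q z * g (aff false y z)))).
  move=> bq lg; rewrite -(exchange_avg ha false bq hf lg).
  by congr I3; apply/funext => z; rewrite avgE.
rewrite -I3N; last by apply: bbs_L2b => //; exact: L2b_avg.
transitivity (I3 (fun z => - partial j p z * avg a f (fun y => v y i 0) z)); last first.
  by congr I3; apply/funext => z; rewrite mulNr.
have bdn : bbs (fun z => - partial j p z).
  by have := bbsZ (-1) bdp; congr bbs; apply/funext => z; rewrite mulN1r.
rewrite (E _ _ bp LV) (E _ _ bdn lv).
congr I3; apply/funext => y; congr (_ * (_ * _)).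
have tpy := test_aff false (- y) tp.
have := HV _ tpy; rewrite test_partial_aff// expr0 => H.
transitivity (I3 (fun z => V z i j * p (aff false (- y) z))).
  rewrite -[RHS](I3_aff false y).
    rewrite I3_mulC; congr I3; apply/funext => z.
    by rewrite !aff_add addrK.
  by have := bbs_L2b (bbs_aff false (- y) bp) LV; congr intg; apply/funext => z; rewrite mulrC.
apply: oppr_inj; rewrite -H -(I3_aff false y); last first.
  have := bbs_L2b (bbs_aff false (- y) bdp) lv; congr intg; apply/funext => z.
  by rewrite mul1r mulrC.
rewrite -I3N.
  congr I3; apply/funext => z.
  by rewrite !aff_add addrK mul1r mulNr opprK mulrC.
exact: (bbs_L2b bdn (L2b_aff false y lv)).
Qed.

(** After Fubini the sum over [j] is, for each fixed [y], the weak divergence of row [i] of [s]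
    tested with the reflected function [p (y - z)]. *)
Lemma divfree_avg s p i f : Mloc s -> L2b f -> div_free s -> test_fun p ->
  \sum_j I3 (fun z => partial j p z * I3 (fun y => \1_Y y * (f y * s (y - z) i j))) = 0.
Proof.
move=> hs hf ds tp.
have bdp j := test_partial_bbs j tp.
transitivity (\sum_j I3 (fun y => \1_Y y * (f y * I3 (fun z => partial j p z * s (aff true y z) i j)))).
  apply: eq_bigr => j _.
  rewrite -(exchange_avg ha true (bdp j) hf (hs i j)).
  by congr I3; apply/funext => z; congr (_ * I3 _); apply/funext => y; rewrite aff_sub.
transitivity (I3 (fun y => \sum_j
    \1_Y y * (f y * I3 (fun z => partial j p z * s (aff true y z) i j)))).
  by rewrite I3_sum// => j; exact: (intg_exchange ha true (bdp j) hf (hs i j)).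
rewrite -[RHS](I3_0 R); congr I3; apply/funext => y.
rewrite -mulr_sumr -mulr_sumr [X in _ * (_ * X)](_ : _ = 0) ?mulr0//.
(* The reflection changes the sign of the partial derivatives, which the substitution of [y - z] for
   [z] does not undo; the sign is harmless since the integral is zero. *)
have tpy := test_aff true y tp.
have := ds _ tpy i; rewrite -/(I3 _) => /eqP; rewrite oppr_eq0 => /eqP E.
transitivity (I3 (fun z => \sum_j partial j p z * s (aff true y z) i j)).
  rewrite I3_sum// => j.
  exact: (bbs_L2b (bdp j) (L2b_aff true y (hs i j))).
rewrite -[RHS]oppr0 -[in RHS]E.
have iS : intg (fun z => \sum_(j < 3) s z i j * partial j (fun w => p (aff true y w)) z).
  apply: intg_sum => j; have := bbs_L2b (test_partial_bbs j tpy) (hs i j).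
  by congr intg; apply/funext => z; rewrite mulrC.
rewrite -I3N// -[RHS](I3_aff true y); last exact: intgN.
congr I3; apply/funext => z /=; rewrite -sumrN; apply: eq_bigr => j _.
rewrite test_partial_aff// expr1 mulN1r mulrN opprK mulrC.
by congr (_ * partial j p _); rewrite !aff_sub subKr.
Qed.

Lemma cvg_sum_seq (J : Type) (r : seq J) (w : J -> nat -> R) (l : J -> R) :
  (forall j, w j @ \oo --> (l j : R)) ->
  (fun n => \sum_(j <- r) w j n) @ \oo --> (\sum_(j <- r) l j : R).
Proof.
move=> H; elim: r => [|j r IH].
  rewrite big_nil (_ : (fun n => _) = fun=> 0); first exact: cvg_cst.
  by apply/funext => n; rewrite big_nil.
rewrite big_cons (_ : (fun n => _) = fun n => w j n + \sum_(k <- r) w k n).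
  by apply: cvgD; [exact: H|exact: IH].
by apply/funext => n; rewrite big_cons.
Qed.

Lemma I3_box_gt0 (b c : E3 R) : b.1.1 < c.1.1 -> b.1.2 < c.1.2 -> b.2 < c.2 ->
  0 < I3 (\1_(ocbox b c) : E3 R -> R).
Proof.
move=> h1 h2 h3; rewrite I3_indic; last exact: measurable_ocbox.
by rewrite fine_gt0// leb3_ocbox_lty leb3_ocbox_gt0.
Qed.

Lemma divfree_orth_grad s v V : L2s a s -> div_free s -> H1per a v -> wgrad v V ->
  ipY a s V = 0.
Proof.
move=> /L2sP[hs ps ss] ds /H1perP[lv _ pv] hV.
have pV := wgrad_periodic hV lv pv.
have LV i j : L2b (fun y => V y i j) by have [] := hV i j.
have psij i j : Defs.periodic a (fun y => s y i j) by move=> t /ps; apply: ae_imp => y ->.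
have pvi i : Defs.periodic a (fun y => v y i 0) by move=> t /pv; apply: ae_imp => y ->.
pose F z := \sum_i \sum_j avg a (fun y => s y i j) (fun y => V y i j) z.
have LF : L2b F by apply: L2b_sum => i; apply: L2b_sum => j; exact: L2b_avg.
have F0 : {ae mu, forall z, F z = 0}.
  apply: fundamental_lemma => // p tp.
  have bp := test_bbs tp; have bdp j := test_partial_bbs j tp.
  rewrite I3_mulC.
  transitivity (I3 (fun z => \sum_i \sum_j p z * avg a (fun y => s y i j) (fun y => V y i j) z)).
    congr I3; apply/funext => z; rewrite mulr_sumr; apply: eq_bigr => i _.
    by rewrite mulr_sumr.
  rewrite I3_sum => [|i]; last first.
    by apply: intg_sum => j; apply: bbs_L2b => //; exact: L2b_avg.
  rewrite big1// => i _.
  rewrite I3_sum => [|j]; last by apply: bbs_L2b => //; exact: L2b_avg.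
  (* For a fixed row [i], the derivative of [v] passes to the test function by [wgrad_avg] and the
     shift passes to [s] by [avg_reflect]; the sum over [j] is then the divergence of [s]. *)
  have D := divfree_avg i hs (lv i) ds tp.
  transitivity (- \sum_j I3 (fun z => partial j p z *
      I3 (fun y => \1_Y y * (v y i 0 * s (y - z) i j)))); last by rewrite D oppr0.
  rewrite -sumrN; apply: eq_bigr => j _.
  rewrite (wgrad_avg j hV (lv i) (hs i j) tp); congr (- I3 _); apply/funext => z; congr (_ * _).
  exact: avg_reflect.
have F00 : F 0 = ipY a s V.
  rewrite ipYE /F.
  transitivity (I3 (fun y => \sum_i \sum_j \1_Y y * (s y i j * V y i j))).
    have i1 i j : intg (fun y => \1_Y y * (s y i j * V y i j)).
      by apply: bbs_L2b2 => //; exact: bbs_cell.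
    rewrite I3_sum => [|i]; last by apply: intg_sum.
    apply: eq_bigr => i _; rewrite I3_sum//; apply: eq_bigr => j _.
    by congr I3; apply/funext => y; rewrite addr0.
  by congr I3; apply/funext => y; rewrite /frob mulr_sumr; apply: eq_bigr => i _; rewrite mulr_sumr.
pose h (n : nat) : R := n.+1%:R^-1.
have h0 n : 0 < h n by rewrite invr_gt0.
(* A box of positive measure contains a zero of [F]. The boxes lie in the positive octant so that
   the shifts meet the sign condition of [translation_cvg]. *)
have /choice [zs Hzs] : forall n, exists z, ocbox (0 : E3 R) (cst3 (h n)) z /\ F z = 0.
  move=> n; apply: contrapT => /forallNP H.
  have := @I3_box_gt0 0 (cst3 (h n)) (h0 n) (h0 n) (h0 n).
  suff -> : I3 (\1_(ocbox (0 : E3 R) (cst3 (h n))) : E3 R -> R) = 0 by rewrite ltxx.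
  rewrite -[RHS](I3_0 R); apply: I3_ae; apply: ae_imp F0 => z Fz; rewrite indicE memNset// => zo.
  by apply: (H z).
have coz n k : 0 < co k (zs n) <= h n.
  have [zo _] := Hzs n; have /ocboxE[q1 q2 q3] := zo.
  by case: k => -[|[|[|//]]] hk; rewrite /co /crd mxE.
have h1 n : h n <= 1 by rewrite invf_le1// ler1n.
have F0cv : F (zs n) @[n --> \oo] --> F 0.
  have hcv : h n @[n --> \oo] --> (0 : R) by exact: cvg_harmonic.
  have zcv k : co k (zs n) @[n --> \oo] --> (0 : R).
    apply: (squeeze_cvgr _ (cvg_cst 0) hcv); apply: nearW => n.
    by have /andP[/ltW -> ->] := coz n k.
  have z1 n : `|zs n| <= 1.
    rewrite norm3E !ge_max; have H k : `|co k (zs n)| <= 1.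
      have /andP[c0 c1] := coz n k; rewrite ger0_norm ?(ltW c0)//.
      exact: le_trans c1 (h1 n).
    have := (H (@Ordinal 3 0 isT), H (@Ordinal 3 1 isT), H (@Ordinal 3 2 isT)).
    by rewrite /co /crd !mxE /= => -[[-> ->] ->].
  have z0 n k : 0 <= co k (zs n) by have /andP[/ltW] := coz n k.
  apply: cvg_sum_seq => i; apply: cvg_sum_seq => j.
  have := translation_cvg ha (hs i j) (LV i j) z1 z0 zcv.
  by rewrite /avg; under [in X in _ -> _ --> X]eq_fun do rewrite addr0.
have : (fun n => F (zs n)) @ \oo --> (0 : R).
  rewrite (_ : (fun n => _) = fun=> 0); first exact: cvg_cst.
  by apply/funext => n; have [] := Hzs n.
move=> H; rewrite -F00; exact: (cvg_unique _ F0cv H).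
Qed.

End DivFree.

(** * The compliance tensor *)

Section TensorInverse.
Variable R : realType.
Implicit Types (T : tensor4 R) (xi zeta : 'M[R]_3).

Lemma tapp_is_linear T : linear (tapp T).
Proof.
move=> r xi zeta; apply/matrixP => i j; rewrite !mxE.
rewrite mulr_sumr -big_split; apply: eq_bigr => k _ /=.
rewrite mulr_sumr -big_split; apply: eq_bigr => l _ /=.
by rewrite !mxE mulrDr mulrCA.
Qed.
HB.instance Definition _ T :=
  GRing.isLinear.Build R 'M[R]_3 'M[R]_3 _ (tapp T) (tapp_is_linear T).

Lemma symm_is_linear : linear (@symm R).
Proof.
move=> r xi zeta; apply/matrixP => i j; rewrite !mxE; ring.
Qed.
HB.instance Definition _ :=
  GRing.isLinear.Build R 'M[R]_3 'M[R]_3 _ (@symm R) symm_is_linear.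

Lemma symm_id xi : Msym xi -> symm xi = xi.
Proof. by rewrite /Msym/= /symm => ->; apply/matrixP => i j; rewrite !mxE; field. Qed.

(* [T] extended to all matrices by the identity on skew matrices, so that it is
   invertible as a linear map of 'M_3 as soon as [T] is coercive. *)
Definition tfull T xi := tapp T (symm xi) + (xi - symm xi).

Lemma tfull_is_linear T : linear (tfull T).
Proof.
move=> r xi zeta; rewrite /tfull symm_is_linear tapp_is_linear.
move: (symm xi) (symm zeta) => b c; move: (tapp T b) (tapp T c) => d e.
by apply/matrixP => i j; rewrite !mxE; ring.
Qed.
HB.instance Definition _ T :=
  GRing.isLinear.Build R 'M[R]_3 'M[R]_3 _ (tfull T) (tfull_is_linear T).

Definition tmx T : 'M[R]_(3 * 3) := lin_mx (tfull T).

(** Cramer's formula for the inverse of [tmx T]. It depends measurably on the entries of [T], which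
    is not apparent for the choice made in [tinv]. *)
Definition tsol T xi : 'M[R]_3 :=
  vec_mx (mxvec xi *m ((\det (tmx T))^-1 *: \adj (tmx T))).

Definition elliptic T (al : R) :=
  (forall xi, Msym xi -> Msym (tapp T xi)) /\
  (forall xi, Msym xi -> al * frob xi xi <= frob (tapp T xi) xi).

Section Elliptic.
Variables (T : tensor4 R) (al : R).
Hypotheses (al0 : 0 < al) (hT : elliptic T al).

Lemma elliptic_inj xi : Msym xi -> tapp T xi = 0 -> xi = 0.
Proof.
move=> sx Tx; have := hT.2 _ sx; rewrite Tx.
have -> : frob 0 xi = 0 by rewrite -(scale0r (0 : 'M[R]_3)) frobZl mul0r.
rewrite pmulr_rle0// => h; apply: frob_eq0; apply/eqP.
by rewrite eq_le h frob_ge0.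
Qed.

(** [tapp T (symm xi)] is symmetric, so symmetry of the sum makes the skew part [xi - symm xi]
    symmetric as well. Being both, it is zero. *)
Lemma tfull_sym xi : Msym (tfull T xi) -> Msym xi.
Proof.
move=> s1; have s2 := hT.1 _ (Msym_symm xi).
have s3 : Msym (xi - symm xi).
  have -> : xi - symm xi = tfull T xi - tapp T (symm xi) by rewrite /tfull addrAC subrr add0r.
  by rewrite /Msym/= linearB/= s1 s2.
suff -> : xi = symm xi by exact: Msym_symm.
have E : symm (xi - symm xi) = xi - symm xi by exact: symm_id.
apply/eqP; rewrite -subr_eq0 -E linearB/= (symm_id (Msym_symm xi)) subrr//.
Qed.

Lemma tmx_unit : tmx T \in unitmx.
Proof.
rewrite -row_free_unit; apply/inj_row_free => v.
rewrite -(vec_mxK v) /tmx mul_vec_lin /= => /eqP; rewrite mxvec_eq0 => /eqP E.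
have sv : Msym (vec_mx v : 'M[R]_3) by apply: tfull_sym; rewrite E /Msym/= trmx0.
move: E; rewrite /tfull (symm_id sv) subrr addr0 => /(elliptic_inj sv) ->.
by rewrite linear0.
Qed.

Lemma tsolP xi : Msym xi -> Msym (tsol T xi) /\ tapp T (tsol T xi) = xi.
Proof.
move=> sx; have E : tfull T (tsol T xi) = xi.
  apply: (can_inj mxvecK); rewrite -mul_vec_lin /tsol vec_mxK -mulmxA.
  have := tmx_unit; rewrite unitmxE => u.
  by rewrite -/(tmx T) -scalemxAl mul_adj_mx scale_scalar_mx mulVr// mulmx1.
have sd : Msym (tsol T xi) by apply: tfull_sym; rewrite E.
by split=> //; move: E; rewrite /tfull (symm_id sd) subrr addr0.
Qed.

Lemma tinv_tapp xi : Msym xi -> tinv T (tapp T xi) = xi.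
Proof.
move=> sx; have [sz Tz] : [set z | Msym z /\ tapp T z = tapp T xi] (tinv T (tapp T xi)).
  by rewrite /tinv; case: xgetP => [z _ //|/(_ xi)]; case.
apply/eqP; rewrite -subr_eq0; apply/eqP; apply: elliptic_inj.
  by rewrite /Msym/= linearB/= sz sx.
by rewrite linearB/= Tz subrr.
Qed.

(** Expand [|T xi - al xi|^2 >= 0] and use [<T xi, xi> >= al |xi|^2]. This bounds the inverse tensor
    by [1 / al], which keeps the compliance field in L^2. *)
Lemma elliptic_bound xi : Msym xi ->
  al ^+ 2 * frob xi xi <= frob (tapp T xi) (tapp T xi).
Proof.
move=> sx; have h1 := hT.2 _ sx; set s := tapp T xi in h1 *.
have := frob_ge0 (s - al *: xi).
rewrite -scaleNr frobDl !frobDr !frobZl !frobZr (frobC xi).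
have : al * (al * frob xi xi) <= al * frob s xi by rewrite ler_pM2l.
rewrite expr2; move: (frob s xi) (frob xi xi) (frob s s) => b c d; lra.
Qed.

End Elliptic.

Lemma frob_le_sum xi : frob xi xi <= (\sum_i \sum_j `|xi i j|) ^+ 2.
Proof.
set m := \sum_i _; rewrite expr2 {2}/m /frob mulr_sumr; apply: ler_sum => k _.
rewrite mulr_sumr; apply: ler_sum => l _.
rewrite -expr2 -[_ ^+ 2]real_normK ?num_real// expr2 ler_wpM2r//.
rewrite /m (bigD1 k)//= (bigD1 l)//= -addrA lerDl addr_ge0//.
  by apply: sumr_ge0.
by apply: sumr_ge0 => ? _; apply: sumr_ge0.
Qed.

Lemma frob_ge_entry xi i j : `|xi i j| ^+ 2 <= frob xi xi.
Proof.
rewrite -[_ ^+ 2]ger0_norm ?sqr_ge0// normrX normr_id -normrX ger0_norm ?sqr_ge0// /frob (bigD1 i)//= (bigD1 j)//= -expr2 -addrA lerDl addr_ge0//.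
  by apply: sumr_ge0 => ? _; rewrite -expr2 sqr_ge0.
by apply: sumr_ge0 => ? _; apply: sumr_ge0 => ? _; rewrite -expr2 sqr_ge0.
Qed.

Definition Mmeas m n (F : E3 R -> 'M[R]_(m, n)) :=
  forall i j, measurable_fun [set: E3 R] (fun y => F y i j).

Lemma Mmeas_det n (F : E3 R -> 'M[R]_n) : Mmeas F ->
  measurable_fun [set: E3 R] (fun y => \det (F y)).
Proof.
move=> hF; apply: measurable_sum => s; apply: measurable_funM => //.
by apply: measurable_prod => i _; exact: hF.
Qed.

Lemma Mmeas_adj n (F : E3 R -> 'M[R]_n) : Mmeas F -> Mmeas (fun y => \adj (F y)).
Proof.
move=> hF i j; under eq_fun do rewrite mxE /cofactor.
apply: measurable_funM => //; apply: Mmeas_det => k l.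
by under eq_fun do rewrite !mxE; exact: hF.
Qed.

Lemma Mmeas_mul m n p (F : E3 R -> 'M[R]_(m, n)) (G : E3 R -> 'M[R]_(n, p)) :
  Mmeas F -> Mmeas G -> Mmeas (fun y => F y *m G y).
Proof.
move=> hF hG i j; under eq_fun do rewrite mxE.
by apply: measurable_sum => k; apply: measurable_funM.
Qed.

(** The inverse is [f] times the power -1 of [f^2], and [powR] is measurable in its base. At a zero
    of [f] both sides are 0. *)
Lemma measurable_fun_invr (f : E3 R -> R) : measurable_fun [set: E3 R] f ->
  measurable_fun [set: E3 R] (fun y => (f y)^-1).
Proof.
move=> mf; rewrite (_ : (fun y => _) = fun y => f y * powR (f y ^+ 2) (-1)).
  apply: measurable_funM => //.
  by apply: (measurableT_comp (measurable_powR (-1))); exact: measurable_funX.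
apply/funext => y; rewrite powRN powRr1 ?sqr_ge0//.
have [->|fy] := eqVneq (f y) 0; first by rewrite invr0 mul0r.
by rewrite expr2 invfM mulrA divff// mul1r.
Qed.

Variable T : E3 R -> tensor4 R.
Hypothesis mT : forall i j k l, measurable_fun [set: E3 R] (fun y => T y i j k l).

Lemma Mmeas_tapp F : Mmeas F -> Mmeas (fun y => tapp (T y) (F y)).
Proof.
move=> hF i j; under eq_fun do rewrite mxE.
by apply: measurable_sum => k; apply: measurable_sum => l; apply: measurable_funM.
Qed.

Lemma Mmeas_tmx : Mmeas (fun y => tmx (T y)).
Proof.
move=> p q; case/mxvec_indexP: p => k l; case/mxvec_indexP: q => i j.
(* A row of [tmx] is the image of an elementary matrix, so its entries are affine in the entries of
   [T y]. *)
have E y : tmx (T y) (mxvec_index k l) (mxvec_index i j) =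
    tapp (T y) (symm (delta_mx k l)) i j + (delta_mx k l - symm (delta_mx k l) : 'M[R]_3) i j.
  rewrite -[LHS](_ : (row (mxvec_index k l) (tmx (T y))) 0 (mxvec_index i j) = _); last by rewrite mxE.
  by rewrite rowE -mxvec_delta /tmx mul_vec_lin mxvecE /tfull mxE.
under eq_fun do rewrite E.
apply: measurable_funD; last exact: measurable_cst.
by apply: (Mmeas_tapp (F := fun=> symm (delta_mx k l))) => p q; exact: measurable_cst.
Qed.

Lemma Mmeas_tsol F : Mmeas F -> Mmeas (fun y => tsol (T y) (F y)).
Proof.
move=> hF i j; under eq_fun do rewrite mxE.
apply: (Mmeas_mul (F := fun y => mxvec (F y))).
  move=> p q; case/mxvec_indexP: q => k l.
  by rewrite ord1; under eq_fun do rewrite mxvecE; exact: hF.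
move=> p q; under eq_fun do rewrite mxE; apply: measurable_funM.
  by apply: measurable_fun_invr; apply: Mmeas_det; exact: Mmeas_tmx.
by apply: Mmeas_adj; exact: Mmeas_tmx.
Qed.

End TensorInverse.

(** * The elastic energy in terms of strains *)

Section Elasticity.
Variables (R : realType) (a : 'I_3 -> E3 R) (C : E3 R -> tensor4 R).
Hypotheses (ha : lin_indep3 a) (hC : rigidity a C).
Local Notation mu := (@leb3 R).
Local Notation Y := (cell a).
Implicit Types (y z : E3 R) (u v : E3 R -> 'cV[R]_3) (s e : E3 R -> 'M[R]_3).

Lemma rig_elliptic :
  exists2 al : R, 0 < al & {ae mu, forall y, elliptic (C y) al}.
Proof.
have [al al0 hal] := rig_coercive hC; exists al => //.
by apply: ae_imp2 (rig_sym hC) hal => y h1 h2; split.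
Qed.

Lemma L2s_Cf e : L2s a e -> L2s a (Cf C e).
Proof.
move=> /L2sP[le pe se]; apply/L2sP; split.
- move=> i j; under eq_fun do rewrite mxE.
  apply: L2b_sum => k; apply: L2b_sum => l; apply: L2bM => //.
    exact: (rig_measurable hC).
  by have [M hM] := rig_bounded hC; exists M; apply: ae_imp hM => y; apply.
- move=> t lt; apply: ae_imp2 (rig_periodic hC lt) (pe t lt) => y h1 h2.
  by rewrite /Cf h1 h2.
- by apply: ae_imp2 (rig_sym hC) se => y h /h.
Qed.

(** Every stress is written as [C d] with a strain [d] in L^2, obtained pointwise from [tsol]. All
    later energy identities are stated in terms of [d], so that measurability of [Df] never has to
    be discussed. *)
Lemma L2s_compliance s : L2s a s -> exists2 d, L2s a d &
  {ae mu, forall y, s y = Cf C d y}.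
Proof.
move=> /L2sP[ls ps ss]; have [al al0 hal] := rig_elliptic.
have sol : {ae mu, forall y, Msym (tsol (C y) (s y)) /\ tapp (C y) (tsol (C y) (s y)) = s y}.
  by apply: ae_imp2 hal ss => y h /(tsolP al0 h).
exists (fun y => tsol (C y) (s y)); last by apply: ae_imp sol => y [_]; rewrite /Cf => ->.
apply/L2sP; split; last by apply: ae_imp sol => y [].
  (* The dominating function is the sum of the [|s y k l|]: an entry of [d] is at most [|d|], and
     [al |d| <= |C d| = |s|] by [elliptic_bound]. *)
  move=> i j; apply: (@L2b_ae_le _ _ (fun y => \sum_k \sum_l `|s y k l|)).
  - apply: (Mmeas_tsol (rig_measurable hC)) => k l; exact: (ls k l).1.
  - exists (al^-1); apply: ae_imp2 hal sol => y h [h1 h2].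
    set m := \sum_k _; have m0 : 0 <= m by apply: sumr_ge0 => k _; apply: sumr_ge0.
    rewrite (ger0_norm m0) ler_pdivlMl// -(@ler_pXn2r _ 2)// ?nnegrE ?mulr_ge0 ?(ltW al0)//.
    rewrite exprMn; apply: le_trans (frob_le_sum (s y)).
    have := elliptic_bound al0 h h1; rewrite h2; apply: le_trans.
    by rewrite ler_pM2l ?exprn_gt0//; exact: frob_ge_entry.
  - apply: L2b_sum => k; apply: L2b_sum => l; apply: (@L2b_ae_le _ _ (fun y => s y k l)) => //.
      by apply: measurableT_comp => //; exact: (ls k l).1.
    by exists 1; apply: aeW => y; rewrite normr_id mul1r.
move=> t lt; apply: ae_imp2 (rig_periodic hC lt) (ps t lt) => y h1 h2.
by rewrite h1 h2.
Qed.

Lemma Df_Cf e : L2s a e -> {ae mu, forall y, Df C (Cf C e) y = e y}.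
Proof.
move=> /L2sP[_ _ se]; have [al al0 hal] := rig_elliptic.
by apply: ae_imp2 hal se => y h1 h2; exact: (tinv_tapp al0 h1 h2).
Qed.

(** Twice the elastic energy of the strain [e], hence also twice the complementary energy of the
    stress [C e]. *)
Definition quad e := ipY a (Cf C e) e.

Lemma compl_energyE s e : L2s a e -> {ae mu, forall y, s y = Cf C e y} ->
  compl_energy a C s = 2^-1 * quad e.
Proof.
move=> he hs; rewrite /compl_energy ipYC; congr (_ * _); apply: ipY_ae => //.
by apply: ae_imp2 hs (Df_Cf he) => y E; rewrite /Df E.
Qed.

Lemma ipY_CfC e e' : L2s a e -> L2s a e' -> ipY a (Cf C e) e' = ipY a (Cf C e') e.
Proof.
move=> /L2sP[_ _ s1] /L2sP[_ _ s2]; rewrite (ipYC _ (Cf C e')) !ipYE; apply: I3_ae.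
have := ae_imp2 (fun y p q => conj p q) s1 s2.
apply: ae_imp2 (rig_selfadjoint hC) => y h [h1 h2].
by rewrite /Cf (h _ _ h1 h2).
Qed.

Lemma CfB e e' : Cf C (fun y => e y - e' y) = fun y => Cf C e y - Cf C e' y.
Proof. by apply/funext => y; rewrite /Cf linearB. Qed.

Lemma quad_coercive : exists2 al : R, 0 < al & forall e, L2s a e -> al * ipY a e e <= quad e.
Proof.
have [al al0 hal] := rig_elliptic; exists al => // e he.
have le := L2s_Mloc he; have lc := L2s_Mloc (L2s_Cf he).
have /L2sP[_ _ se] := he.
rewrite -ipYZl// /quad !ipYE.
rewrite -subr_ge0 -I3B; [|exact: intg_ipY|apply: intg_ipY => //; exact: MlocZ].
(* Coercivity holds almost everywhere only, so the integrand is replaced by its absolute value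
   before positivity of the integral is used. *)
set f := fun y => _ - _; have -> : I3 f = I3 (fun y => `|f y|); last exact: I3_ge0.
apply: I3_ae; rewrite /f.
apply: ae_imp2 hal se => y h1 h2; rewrite ger0_norm// -mulrBr mulr_ge0//.
by rewrite frobZl subr_ge0; exact: h1.2.
Qed.

Lemma quad_ge0 e : L2s a e -> 0 <= quad e.
Proof.
move=> he; have [al al0 h] := quad_coercive; apply: le_trans (h _ he).
by rewrite mulr_ge0 ?(ltW al0)//; exact: ipY_ge0.
Qed.

Lemma quad_eq0 e : L2s a e -> quad e = 0 -> {ae mu, forall y, e y = 0}.
Proof.
move=> he Q0; have [al al0 h] := quad_coercive; have /L2sP[le pe _] := he.
apply: (ipY_eq0 ha le pe); have := h _ he; rewrite Q0 pmulr_rle0// => h1.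
by apply/eqP; rewrite eq_le h1; exact: ipY_ge0.
Qed.

Lemma ipYBl s s' e : Mloc s -> Mloc s' -> Mloc e ->
  ipY a (fun y => s y - s' y) e = ipY a s e - ipY a s' e.
Proof.
move=> h1 h2 h3; rewrite (_ : (fun y => _) = fun y => s y + (-1) *: s' y).
  by rewrite (ipYDl ha h1 (MlocZ _ h2) h3) (ipYZl ha _ h2 h3) mulN1r.
by apply/funext => y; rewrite scaleN1r.
Qed.

Lemma ipYBr s e e' : Mloc s -> Mloc e -> Mloc e' ->
  ipY a s (fun y => e y - e' y) = ipY a s e - ipY a s e'.
Proof. by move=> h1 h2 h3; rewrite ipYC ipYBl// !(ipYC _ s). Qed.

Lemma quadB e e' : L2s a e -> L2s a e' ->
  quad (fun y => e y - e' y) = quad e - 2 * ipY a (Cf C e') e + quad e'.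
Proof.
move=> h1 h2; rewrite /quad CfB.
have l1 := L2s_Mloc h1; have l2 := L2s_Mloc h2.
have c1 := L2s_Mloc (L2s_Cf h1); have c2 := L2s_Mloc (L2s_Cf h2).
rewrite ipYBl//; last exact: L2s_Mloc (L2sB h1 h2).
rewrite !ipYBr// (ipY_CfC h1 h2); ring.
Qed.

(** For a stress [s = C d] the gap between the two sides is half of [quad (e - d)], which is
    nonnegative and vanishes for [s = C e]. *)
Lemma legendreE e : L2s a e -> legendre a C e = (2^-1 * quad e)%:E.
Proof.
move=> he; apply/eqP; rewrite eq_le; apply/andP; split.
  apply: ge_ereal_sup => _ [s hs <-]; rewrite lee_fin.
  have [d hd sd] := L2s_compliance hs.
  rewrite (compl_energyE hd sd).
  have -> : ipY a e s = ipY a (Cf C d) e by rewrite ipYC; apply: ipY_ae => //; exact: aeW.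
  have := quad_ge0 (L2sB he hd); rewrite quadB//.
  by move: (quad e) (quad d) (ipY _ _ _) => b c f; lra.
apply: ereal_sup_ubound; exists (Cf C e); first exact: L2s_Cf.
rewrite (@compl_energyE _ e) //; last exact: aeW.
by rewrite ipYC -/(quad e); congr EFin; field.
Qed.

End Elasticity.

(** * Affine plus periodic displacements and the constraint on the stress *)

Section LinearPeriodic.
Variables (R : realType) (a : 'I_3 -> E3 R).
Hypothesis ha : lin_indep3 a.
Local Notation Y := (cell a).
Implicit Types (y z : E3 R) (u v w : E3 R -> 'cV[R]_3) (s e m : E3 R -> 'M[R]_3)
  (A B S : 'M[R]_3).

Lemma L2b_affine A (i : 'I_3) : L2b (fun y : E3 R => (A *m crd y) i 0).
Proof.
under eq_fun do rewrite mxE; apply: L2b_sum => k; apply: L2bZ.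
exact: L2b_continuous (@continuous_co R k).
Qed.

Lemma LPA_L2b A u i : LPA a A u -> L2b (fun y => u y i 0).
Proof.
move=> [f /H1perP[lf _ _] ->]; under eq_fun do rewrite mxE.
by apply: L2bD (lf i); exact: L2b_affine.
Qed.

Lemma LPA_wgrad A u : LPA a A u -> exists f V,
  [/\ H1per a f, wgrad f V, wgrad u (fun y => A + V y) &
      u = fun y => A *m crd y + f y].
Proof.
move=> [f hf ->]; have /H1perP[lf [V hV] _] := hf; exists f, V; split=> //.
by apply: wgradD hV => //; [exact: L2b_affine|exact: wgrad_affine].
Qed.

Lemma L2s_sgrad A u : LPA a A u -> L2s a (sgrad u).
Proof.
move=> hu; have [f [V [hf hV hw uE]]] := LPA_wgrad hu.
apply/L2sP; split; last by apply: aeW => y; exact: Msym_symm.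
  apply: (Mloc_symm (s := grad u)) => i j.
  by have [] := wgrad_grad hw i j.
have /H1perP[lf _ pf] := hf; have pV := wgrad_periodic hV lf pf.
move=> t lt; have h := sgrad_ae hw.
have ht := ae_aff false t h.
have := ae_imp2 (fun y p q => conj p q) h ht; apply: ae_imp2 (pV t lt) => y pVy [h1].
by rewrite aff_add => h2; rewrite h1 h2 pVy.
Qed.

(** The strain of [u] is [A] plus the symmetrized gradient of a periodic field, and the latter is
    orthogonal to [s]. The pairing thus depends on [s] only through its mean, which is the source of
    all later cancellations. *)
Lemma LPA_orth A u s : LPA a A u -> L2s a s -> div_free s ->
  ipY a s (sgrad u) = frob (mint Y s) A.
Proof.
move=> hu hs ds; have [f [V [hf hV hw uE]]] := LPA_wgrad hu.
have /L2sP[ls _ ss] := hs.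
have lV : Mloc V by move=> i j; have [] := hV i j.
transitivity (ipY a s (fun y => A + V y)).
  rewrite !ipYE; apply: I3_ae; apply: ae_imp2 ss (sgrad_ae hw) => y sy ->.
  by rewrite frob_symm.
rewrite (ipYDr ha ls (Mloc_cst A) lV) (divfree_orth_grad ha hs ds hf hV) addr0.
by rewrite ipYC (ipY_cst ha _ ls) frobC.
Qed.

Lemma H1per_LPA v : H1per a v -> LPA a 0 v.
Proof.
by move=> hv; exists v => //; apply/funext => y; rewrite mul0mx add0r.
Qed.

Lemma LPA_affine B : LPA a B (fun y => B *m crd y).
Proof.
exists (fun=> 0); last by apply/funext => y; rewrite addr0.
apply/H1perP; split.
- by move=> i; under eq_fun do rewrite mxE; exact: L2b_cst.
- by exists (fun=> 0); exact: wgrad_cst.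
- by move=> t _; exact: aeW.
Qed.

Lemma div_free_intg s p i : Mloc s -> test_fun p ->
  intg (fun y => \sum_(j < 3) s y i j * partial j p y).
Proof.
move=> ls tp; apply: intg_sum => j; have := bbs_L2b (test_partial_bbs j tp) (ls i j).
by congr intg; apply/funext => y; rewrite mulrC.
Qed.

Lemma div_freeB s e : Mloc s -> Mloc e -> div_free s -> div_free e ->
  div_free (fun y => s y - e y).
Proof.
move=> ls le ds de p tp i.
have /eqP := ds p tp i; rewrite oppr_eq0 => /eqP d1.
have /eqP := de p tp i; rewrite oppr_eq0 => /eqP d2.
apply/eqP; rewrite oppr_eq0; apply/eqP.
transitivity (I3 (fun y => \sum_(j < 3) s y i j * partial j p y) -
              I3 (fun y => \sum_(j < 3) e y i j * partial j p y)).
  rewrite -I3B; [|exact: div_free_intg|exact: div_free_intg].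
  congr I3; apply/funext => y; rewrite -sumrB; apply: eq_bigr => j _.
  by rewrite !mxE mulrBl.
by rewrite /I3 d1 d2 subr0.
Qed.

Lemma div_free_cst S : div_free (fun _ : E3 R => S).
Proof.
move=> p tp i; apply/eqP; rewrite oppr_eq0; apply/eqP.
rewrite -/(I3 _) I3_sum => [|j]; last by apply: intgZ; apply: bbs_intg; exact: test_partial_bbs.
rewrite big1// => j _; rewrite I3Z; last by apply: bbs_intg; exact: test_partial_bbs.
by rewrite I3_partial_test// mulr0.
Qed.

Lemma div_free_weak s : L2s a s ->
  (forall v, H1per0 a v -> ipY a s (sgrad v) = 0) -> div_free s.
Proof.
move=> hs H p tp i; have [v hv E] := test_field ha i tp.
by rewrite -/(I3 _) -E// H// oppr0.
Qed.

Lemma TS_mint S s : TS a S s -> mint Y s = volY a *: S.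
Proof.
by move=> [_ _ <-]; rewrite scalerA mulfV ?scale1r//; exact: volY_neq0.
Qed.

Lemma TS_cst S : Msym S -> TS a S (fun=> S).
Proof.
move=> sS; split; [exact: L2s_cst|exact: div_free_cst|].
by rewrite (mint_cst ha) scalerA mulVf ?scale1r//; exact: volY_neq0.
Qed.

Lemma TSB S s e : TS a S s -> TS a S e -> TS a 0 (fun y => s y - e y).
Proof.
move=> h1 h2; have [l1 d1 _] := h1; have [l2 d2 _] := h2; split.
- exact: L2sB.
- exact: (div_freeB (L2s_Mloc l1) (L2s_Mloc l2) d1 d2).
rewrite (_ : (fun y => _) = fun y => s y + (-1) *: e y); last first.
  by apply/funext => y; rewrite scaleN1r.
have m1 := L2s_Mloc l1; have m2 := L2s_Mloc l2.
rewrite (mintD ha m1 (MlocZ (-1) m2)) (mintZ ha _ m2) (TS_mint h1) (TS_mint h2).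
by rewrite scaleN1r subrr scaler0.
Qed.

(** If the functionals agree, testing with periodic fields of mean zero gives zero divergence and
    testing with affine fields gives the mean. Conversely both functionals reduce to the pairing of
    the mean with the affine part, by [LPA_orth]. *)
Lemma Lam_eta S s : Msym S -> L2s a s ->
  @Lam R a s = @Defs.eta R a S <-> TS a S s.
Proof.
move=> sS hs; split.
  move=> E; have H v : LP a v -> ipY a s (sgrad v) = ipY a (fun=> S) (sgrad v).
    by move=> hv; exact: (congr1 (fun F => F (exist _ v hv)) E).
  have ds : div_free s.
    apply: div_free_weak => // v [hv _]; rewrite H; last first.
      by exists 0; [rewrite /Msym/= trmx0|exact: H1per_LPA].
    rewrite (LPA_orth (H1per_LPA hv) (L2s_cst a sS) (div_free_cst S)).
    by rewrite frobC -(scale0r (0 : 'M[R]_3)) frobZl mul0r.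
  (* The affine test field has the defect of the mean as its gradient, so the equality of the
     functionals reads [|B|^2 = 0]. *)
  split=> //; pose B := mint Y s - volY a *: S.
  have /L2sP[_ _ ss] := hs.
  have sB : Msym B.
    by rewrite /Msym/= linearB linearZ/= sS (Msym_mint a ss).
  have := H _ (ex_intro2 _ _ B sB (LPA_affine B)).
  rewrite (LPA_orth (LPA_affine B) hs ds).
  rewrite (LPA_orth (LPA_affine B) (L2s_cst a sS) (div_free_cst S)) (mint_cst ha) => E1.
  have : frob B B = 0.
    by rewrite {1}/B -scaleNr frobDl !frobZl E1 frobZl mulNr subrr.
  move=> /frob_eq0/eqP; rewrite subr_eq0 => /eqP ->.
  by rewrite scalerA mulVf ?scale1r//; exact: volY_neq0.
move=> hT; have [_ ds _] := hT; apply/funext => -[v [B sB hv]] /=.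
rewrite /Defs.eta /Lam/= (LPA_orth hv hs ds) (TS_mint hT).
by rewrite (LPA_orth hv (L2s_cst a sS) (div_free_cst S)) (mint_cst ha).
Qed.

End LinearPeriodic.

(** * Uniqueness of the corrector strain *)

Section Corrector.
Variables (R : realType) (a : 'I_3 -> E3 R) (C : E3 R -> tensor4 R) (A : 'M[R]_3).
Hypotheses (ha : lin_indep3 a) (hC : rigidity a C).
Local Notation mu := (@leb3 R).
Local Notation Y := (cell a).
Implicit Types (u w : E3 R -> 'cV[R]_3).

(** The affine parts cancel, so the difference of two correctors is an admissible test field in both
    cell problems. Subtracting the two equations gives zero energy for the difference of the
    strains. *)
Lemma corrector_sgrad_unique u w : corrector a C A u -> corrector a C A w ->
  {ae mu, forall y, sgrad u y = sgrad w y}.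
Proof.
move=> [[_ mu0] hu Hu] [[_ mw0] hw Hw].
have [f [V [hf hV hgu uE]]] := LPA_wgrad hu.
have [g [W [hg hW hgw wE]]] := LPA_wgrad hw.
have /H1perP[lf _ pf] := hf; have /H1perP[lg _ pg] := hg.
pose d y := f y + (-1) *: g y.
have lg' i : L2b (fun y => ((-1) *: g y) i 0).
  by under eq_fun do rewrite mxE; exact: L2bZ.
have hd : wgrad d (fun y => V y + (-1) *: W y).
  by apply: wgradD => //; apply: wgradZ.
have dE y : d y = u y - w y.
  by rewrite uE wE /d scaleN1r opprD addrACA subrr add0r.
have hd0 : H1per0 a d.
  split.
    apply/H1perP; split; last first.
    - by move=> t lt; apply: ae_imp2 (pf t lt) (pg t lt) => y E1 E2; rewrite /d E1 E2.
    - by exists (fun y => V y + (-1) *: W y).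
    by move=> i; under eq_fun do rewrite mxE; exact: L2bD.
  apply/colP => i; rewrite [RHS]mxE mintE.
  have E1 : I3 (fun y => \1_Y y * u y i 0) = 0 by rewrite -mintE mu0 mxE.
  have E2 : I3 (fun y => \1_Y y * w y i 0) = 0 by rewrite -mintE mw0 mxE.
  have bY := bbs_cell ha.
  transitivity (I3 (fun y => \1_Y y * u y i 0) - I3 (fun y => \1_Y y * w y i 0)).
    rewrite -I3B; last 2 first.
  - by apply: bbs_L2b => //; exact: LPA_L2b hu.
  - by apply: bbs_L2b => //; exact: LPA_L2b hw.
    by congr I3; apply/funext => y; rewrite dE !mxE mulrBr.
  by rewrite E1 E2 subrr.
have Ed : {ae mu, forall y, sgrad d y = sgrad u y - sgrad w y}.
  have := ae_imp2 (fun y p q => conj p q) (sgrad_ae hgu) (sgrad_ae hgw).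
  apply: ae_imp2 (sgrad_ae hd) => y -> [-> ->].
  by apply/matrixP => i j; rewrite !mxE; ring.
have le := L2s_sgrad hu; have lw := L2s_sgrad hw.
have lew := L2sB le lw.
have : quad a C (fun y => sgrad u y - sgrad w y) = 0.
  rewrite /quad CfB ipYBl//; [|exact: L2s_Mloc (L2s_Cf hC le)|exact: L2s_Mloc (L2s_Cf hC lw)|exact: L2s_Mloc lew].
  have E s : ipY a s (fun y => sgrad u y - sgrad w y) = ipY a s (sgrad d).
    by apply: ipY_ae; [exact: aeW|apply: ae_imp Ed => y ->].
  have Eu := etrans (E (Cf C (sgrad u))) (Hu _ hd0).
  have Ew := etrans (E (Cf C (sgrad w))) (Hw _ hd0).
  exact: etrans (congr2 (fun b c : R => b - c) Eu Ew) (subrr 0).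
move=> /(quad_eq0 ha hC lew); apply: ae_imp => y /eqP; rewrite subr_eq0 => /eqP//.
Qed.

(** The choice in [homogenized] may come from another corrector [w]; the strains agree almost
    everywhere, and so do the mean stresses. *)
Lemma homogenizedE u : corrector a C A u ->
  homogenized a C A = (volY a)^-1 *: mint Y (Cf C (sgrad u)).
Proof.
move=> hu; rewrite /homogenized; case: xgetP => [S _ [w hw ->]|/(_ ((volY a)^-1 *: mint Y (Cf C (sgrad u))))]; last first.
  by case; exists u.
have E : {ae mu, forall y, Cf C (sgrad w) y = Cf C (sgrad u) y}.
  by apply: ae_imp (corrector_sgrad_unique hw hu) => y E; rewrite /Cf E.
exact: (congr1 (fun B => (volY a)^-1 *: B) (mint_ae a E)).
Qed.

End Corrector.

(** * The saddle point *)

Section Duality.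
Variables (R : realType) (a : 'I_3 -> E3 R) (C : E3 R -> tensor4 R).
Variables (A S : 'M[R]_3) (e0 : E3 R -> 'M[R]_3).
Hypotheses (ha : lin_indep3 a) (hC : rigidity a C) (sS : Msym S).
Hypothesis he0 : L2s a e0.
Hypothesis e0_orth : forall s, L2s a s -> div_free s ->
  ipY a s e0 = frob (mint (cell a) s) A.
Hypothesis sig_TS : TS a S (Cf C e0).
Local Notation mu := (@leb3 R).
Local Notation sig := (Cf C e0).
Implicit Types (y : E3 R) (s e : E3 R -> 'M[R]_3).

(** By [e0_orth] the pairing with [e0] sees only the mean, and [s] and [sig] have the same mean. *)
Lemma TS_ipY_e0 s : TS a S s -> ipY a s e0 = quad a C e0.
Proof.
move=> hT; have [l1 d1 _] := hT; have [l2 d2 _] := sig_TS.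
by rewrite /quad (e0_orth l1 d1) (e0_orth l2 d2) (TS_mint ha hT) (TS_mint ha sig_TS).
Qed.

Lemma compl_energy_sig : compl_energy a C sig = 2^-1 * quad a C e0.
Proof. by apply: (compl_energyE hC he0); exact: aeW. Qed.

Lemma compl_energy_TS s d : TS a S s -> L2s a d ->
  {ae mu, forall y, s y = Cf C d y} ->
  compl_energy a C s = compl_energy a C sig + 2^-1 * quad a C (fun y => d y - e0 y).
Proof.
move=> hT hd sd; rewrite (compl_energyE hC hd sd) compl_energy_sig (quadB ha hC hd he0).
have E : ipY a sig d = quad a C e0.
  rewrite -(TS_ipY_e0 hT) (ipY_CfC hC he0 hd); apply: ipY_ae; last exact: aeW.
  by apply: ae_imp sd => y ->.
by rewrite E; move: (quad a C d) (quad a C e0) => b c; field.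
Qed.

Lemma compl_energy_min s : TS a S s -> compl_energy a C sig <= compl_energy a C s.
Proof.
move=> hT; have [hs _ _] := hT; have [d hd sd] := L2s_compliance hC hs.
rewrite (compl_energy_TS hT hd sd) lerDl mulr_ge0 ?invr_ge0//.
exact: (quad_ge0 ha hC (L2sB hd he0)).
Qed.

Lemma compl_energy_argmin s : TS a S s -> compl_energy a C s <= compl_energy a C sig ->
  {ae mu, forall y, s y = sig y}.
Proof.
move=> hT; have [hs _ _] := hT; have [d hd sd] := L2s_compliance hC hs.
rewrite (compl_energy_TS hT hd sd) gerDl pmulr_rle0 ?invr_gt0// => Q0.
have hde := L2sB hd he0.
have /(quad_eq0 ha hC hde) : quad a C (fun y => d y - e0 y) = 0.
  by apply/eqP; rewrite eq_le Q0 (quad_ge0 ha hC hde).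
by apply: ae_imp2 sd => y -> /eqP; rewrite subr_eq0 /Cf => /eqP ->.
Qed.

Lemma compl_energy_minimizer :
  is_the_minimizer (fun s => (compl_energy a C s)%:E) (TS a S) sig.
Proof.
split; first by split=> // s hT; rewrite lee_fin; exact: compl_energy_min.
move=> s [hT /(_ _ sig_TS)]; rewrite lee_fin; exact: compl_energy_argmin.
Qed.

Lemma indS_TS s : TS a S s -> indS S (@Lam R a s) = 0%E.
Proof.
move=> hT; have [hs _ _] := hT.
by rewrite /indS; case: pselect => // -[]; apply/(Lam_eta ha sS hs).
Qed.

Lemma indS_nTS s : L2s a s -> ~ TS a S s -> indS S (@Lam R a s) = +oo%E.
Proof.
by move=> hs nT; rewrite /indS; case: pselect => // h; case: nT; move/(Lam_eta ha sS hs): (h).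
Qed.

Lemma Gfun_TS s : TS a S s -> Gfun a C S s = (compl_energy a C s)%:E.
Proof. by move=> hT; rewrite /Gfun indS_TS// adde0. Qed.

Lemma Gfun_nTS s : L2s a s -> ~ TS a S s -> Gfun a C S s = +oo%E.
Proof. by move=> hs nT; rewrite /Gfun indS_nTS// addey. Qed.

Lemma Gfun_min s : L2s a s -> (Gfun a C S sig <= Gfun a C S s)%E.
Proof.
move=> hs; have [hT|nT] := pselect (TS a S s); last by rewrite (Gfun_nTS hs nT) leey.
by rewrite !Gfun_TS// lee_fin; exact: compl_energy_min.
Qed.

Lemma Gfun_minimizer : is_the_minimizer (Gfun a C S) (L2s a) sig.
Proof.
have hsig : L2s a sig by case: sig_TS.
split; first by split=> // s; exact: Gfun_min.
move=> s [hs /(_ _ hsig)]; have [hT|nT] := pselect (TS a S s).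
  by rewrite !Gfun_TS// lee_fin; exact: compl_energy_argmin.
by rewrite (Gfun_nTS hs nT) Gfun_TS.
Qed.

(** This element of [TS a 0] is what the condition [T0perp] is tested with: it turns the linear term
    of [kfun] into a pairing with [sig]. *)
Lemma TS0_sigB : TS a 0 (fun y => sig y - S).
Proof. exact: (TSB ha sig_TS (TS_cst ha sS)). Qed.

Lemma e0_T0perp : T0perp a e0.
Proof.
split=> // m hm; have [lm dm _] := hm.
by rewrite ipYC (e0_orth lm dm) (TS_mint ha hm) scaler0 -(scale0r (0 : 'M[R]_3)) frobZl mul0r.
Qed.

(** On [T0perp] the term [frob S (mint Y e)] equals the pairing of [sig = C e0] with [e], by
    [TS0_sigB]. Completing the square then centres the quadratic form at [e0]. *)
Lemma kfun_T0perp e : T0perp a e ->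
  kfun a C S e = kfun a C S e0 + 2^-1 * quad a C (fun y => e y - e0 y).
Proof.
move=> [he ep]; have [_ e0p] := e0_T0perp.
have le := L2s_Mloc he; have l0 := L2s_Mloc he0.
have ls := L2s_Mloc (L2s_Cf hC he0).
rewrite (quadB ha hC he he0) /kfun -/(quad a C e) -/(quad a C e0).
rewrite -(ipY_cst ha S le) -(ipY_cst ha S l0).
have := ep _ TS0_sigB; rewrite ipYC (ipYBl ha ls (Mloc_cst S) le) => E1.
have := e0p _ TS0_sigB; rewrite ipYC (ipYBl ha ls (Mloc_cst S) l0) -/(quad a C e0) => E2.
move: E1 E2; move: (ipY _ _ _) (ipY _ _ _) (ipY _ _ _) (quad a C e) (quad a C e0).
by move=> b c d f g E1 E2; lra.
Qed.

Lemma kfun_minimizer : is_the_minimizer (fun e => (kfun a C S e)%:E) (T0perp a) e0.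
Proof.
split.
  split=> [|e he]; first exact: e0_T0perp.
  rewrite lee_fin (kfun_T0perp he) lerDl mulr_ge0 ?invr_ge0//.
  by apply: (quad_ge0 ha hC); apply: L2sB => //; case: he.
move=> e [he /(_ _ e0_T0perp)]; have [le _] := he.
rewrite lee_fin (kfun_T0perp he) gerDl pmulr_rle0 ?invr_gt0// => Q0.
have hde := L2sB le he0.
have /(quad_eq0 ha hC hde) : quad a C (fun y => e y - e0 y) = 0.
  by apply/eqP; rewrite eq_le Q0 (quad_ge0 ha hC hde).
by apply: ae_imp => y /eqP; rewrite subr_eq0 => /eqP.
Qed.

Lemma lagrangian_TS s e : L2s a e -> TS a S s ->
  lagrangian a C S s e = (ipY a e s - 2^-1 * quad a C e)%:E.
Proof. by move=> he hT; rewrite /lagrangian legendreE// indS_TS// adde0. Qed.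

Lemma lagrangian_nTS s e : L2s a e -> L2s a s -> ~ TS a S s ->
  lagrangian a C S s e = +oo%E.
Proof. by move=> he hs nT; rewrite /lagrangian legendreE// indS_nTS// addey. Qed.

Lemma lagrangian_le_Gfun s e : L2s a e -> L2s a s ->
  (lagrangian a C S s e <= Gfun a C S s)%E.
Proof.
move=> he hs; have [hT|nT] := pselect (TS a S s); last by rewrite (Gfun_nTS hs nT) leey.
have [d hd sd] := L2s_compliance hC hs.
rewrite lagrangian_TS// Gfun_TS// lee_fin (compl_energyE hC hd sd).
have -> : ipY a e s = ipY a (Cf C d) e by rewrite ipYC; apply: ipY_ae => //; exact: aeW.
have := quad_ge0 ha hC (L2sB he hd); rewrite (quadB ha hC he hd).
by move: (quad a C e) (quad a C d) (ipY _ _ _) => b c f; lra.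
Qed.

(** On [TS a S] the supremum is attained at the strain [d] with [s = C d]. Off [TS a S] the
    constraint term makes every value infinite, and [e0] witnesses it. *)
Lemma sup_lagrangian s : L2s a s ->
  ereal_sup [set lagrangian a C S s e | e in L2s a] = Gfun a C S s.
Proof.
move=> hs; apply/eqP; rewrite eq_le; apply/andP; split.
  by apply: ge_ereal_sup => _ [e he <-]; exact: lagrangian_le_Gfun.
have [hT|nT] := pselect (TS a S s); last first.
  rewrite (Gfun_nTS hs nT); apply: ereal_sup_ubound; exists e0 => //.
  exact: lagrangian_nTS.
have [d hd sd] := L2s_compliance hC hs.
apply: ereal_sup_ubound; exists d => //.
rewrite lagrangian_TS// Gfun_TS// (compl_energyE hC hd sd); congr EFin.
have -> : ipY a d s = quad a C d by rewrite ipYC; apply: ipY_ae => //; exact: aeW.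
by field.
Qed.

Lemma lagrangian_saddle : lagrangian a C S sig e0 = Gfun a C S sig.
Proof.
rewrite (lagrangian_TS he0 sig_TS) (Gfun_TS sig_TS) compl_energy_sig ipYC -/(quad a C e0).
by congr EFin; field.
Qed.

(** At [e0] the Lagrangian is constant on [TS a S] by [TS_ipY_e0], and it is infinite elsewhere. *)
Lemma lagrangian_e0_min s : L2s a s ->
  (lagrangian a C S sig e0 <= lagrangian a C S s e0)%E.
Proof.
move=> hs; have [hT|nT] := pselect (TS a S s); last first.
  by rewrite (lagrangian_nTS he0 hs nT) leey.
by rewrite (lagrangian_TS he0 sig_TS) (lagrangian_TS he0 hT) !(ipYC _ e0) !TS_ipY_e0.
Qed.

Lemma inf_Gfun : ereal_inf [set Gfun a C S s | s in L2s a] = Gfun a C S sig.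
Proof.
apply/eqP; rewrite eq_le; apply/andP; split.
  by apply: ereal_inf_lbound; exists sig => //; case: sig_TS.
by apply: le_ereal_inf_tmp => _ [s hs <-]; exact: Gfun_min.
Qed.

Lemma inf_sup_lagrangian :
  ereal_inf [set ereal_sup [set lagrangian a C S s e | e in L2s a] | s in L2s a] =
  ereal_inf [set Gfun a C S s | s in L2s a].
Proof. by congr ereal_inf; apply: eq_imagel => s hs; exact: sup_lagrangian. Qed.

(** For any [e] the infimum is at most the value at [sig], hence at most [Gfun] at [sig], which is
    the saddle value; the strain [e0] attains it. *)
Lemma sup_inf_lagrangian :
  ereal_sup [set ereal_inf [set lagrangian a C S s e | s in L2s a] | e in L2s a] =
  lagrangian a C S sig e0.
Proof.
have hsig : L2s a sig by case: sig_TS.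
apply/eqP; rewrite eq_le; apply/andP; split.
  apply: ge_ereal_sup => _ [e he <-]; rewrite lagrangian_saddle.
  apply: le_trans (lagrangian_le_Gfun he hsig).
  by apply: ereal_inf_lbound; exists sig.
apply: le_trans (ereal_sup_ubound _); last by exists e0.
by apply: le_ereal_inf_tmp => _ [s hs <-]; exact: lagrangian_e0_min.
Qed.

End Duality.

Theorem theorem28 (R : realType) (a : 'I_3 -> E3 R) (C : E3 R -> tensor4 R)
    (A S : 'M[R]_3) (uA : E3 R -> 'cV[R]_3)
    (ha : lin_indep3 a) (hC : rigidity a C) (hA : Msym A) (hS : Msym S)
    (huA : corrector a C A uA) (hSA : S = homogenized a C A) :
  exists sigmaS : E3 R -> 'M[R]_3,
    [/\ is_the_minimizer (fun s => (compl_energy a C s)%:E) (TS a S) sigmaS,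
        is_the_minimizer (Gfun a C S) (L2s a) sigmaS,
        is_the_minimizer (fun e => (kfun a C S e)%:E) (T0perp a) (sgrad uA)
      & [/\ ereal_inf [set Gfun a C S s | s in L2s a]
            = ereal_inf
                [set ereal_sup [set lagrangian a C S s e | e in L2s a]
                | s in L2s a],
            ereal_inf
              [set ereal_sup [set lagrangian a C S s e | e in L2s a]
              | s in L2s a]
            = lagrangian a C S sigmaS (sgrad uA)
          & lagrangian a C S sigmaS (sgrad uA)
            = ereal_sup
                [set ereal_inf [set lagrangian a C S s e | s in L2s a]
                | e in L2s a]]].
Proof.
have [[_ _] huLP huv] := huA.
have he0 := L2s_sgrad huLP.
have sig_L2s := L2s_Cf hC he0.
have sig_TS : TS a S (Cf C (sgrad uA)).
  split=> //; first exact: (div_free_weak ha sig_L2s huv).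
  (* Here [S = C^H A] enters: it is the mean of the stress of this particular corrector. *)
  by rewrite hSA (homogenizedE ha hC huA).
have orth s (hs : L2s a s) (ds : div_free s) := LPA_orth ha huLP hs ds.
exists (Cf C (sgrad uA)); split.
- exact: (compl_energy_minimizer ha hC he0 orth sig_TS).
- exact: (Gfun_minimizer ha hC hS he0 orth sig_TS).
- exact: (kfun_minimizer ha hC hS he0 orth sig_TS).
split.
- by rewrite (inf_sup_lagrangian ha hC hS he0).
- rewrite (inf_sup_lagrangian ha hC hS he0) (inf_Gfun ha hC hS he0 orth sig_TS).
  by rewrite (lagrangian_saddle ha hC hS he0 sig_TS).
- by rewrite (sup_inf_lagrangian ha hC hS he0 orth sig_TS).
Qed.
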